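(* Let $q>2$ and $2<p<3$ satisfy $(p-1)(pq-1)>p+2$, and fix $\mu$ satisfying the conditions stated in the context. Let $f,\tilde f\in C_0^2(\mathbb{R})$ and $g,\tilde g\in C_0^1(\mathbb{R})$ be even functions. Then there exist $\varepsilon_2>0$ and $C_2>0$ such that, for every $0<\varepsilon<\varepsilon_2$, the system of integral equations $$u=\varepsilon U_0+L|v|^q,\qquad v=\varepsilon V_0+L|\partial_tu|^p$$ has a unique global solution $(u,v)$ on $[0,\infty)\times\mathbb{R}$ satisfying all of the following: - $\|(\partial_tu,v)\|\le C_2\varepsilon$; - $u(t,-r)=u(t,r)$ and $v(t,-r)=v(t,r)$; - $u,v,\partial_tu\in C([0,\infty)\times\mathbb{R})$; - $ru,\,rv\in C^2([0,\infty)\times\mathbb{R})$.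
   Context: For even functions, define $$U_0(t,r)=\frac1{2r}\{(r+t)f(r+t)+(r-t)f(r-t)\}+\frac1{2r}\int_{r-t}^{r+t}\rho g(\rho)\,d\rho,$$ and define $V_0$ in the same way with $f,g$ replaced by $\tilde f,\tilde g$. For a function $F(s,\rho)$ even in $\rho$, define $$LF(t,r)=\frac1{2r}\int_0^t\int_{r-(t-s)}^{r+(t-s)}\rho F(s,\rho)\,d\rho\, ds.$$ (This is the radial Duhamel formula for the 3D wave equation.) Let $\langle\xi\rangle=\sqrt{1+\xi^2}$, and define weights for $t,r\ge0$: $$w_1(t,r)=\langle r\rangle\langle t-r\rangle^{\mu/p},$$ $$w_2(t,r)=\begin{cases}\langle r\rangle^{p-2}\langle t+r\rangle^{\mu} & (r<t/2),\\ \langle t-r\rangle^{p-3+\mu}\langle t+r\rangle & (r\ge t/2),\end{cases}$$ $$w_3(t,r)=\langle t-r\rangle^{\mu}.$$ Here $\mu$ is a fixed number with $$3-p<\mu<1\qquad\text{and}\qquad p\{2-(p-2)q\}<(pq-1)\mu$$ (such $\mu$ exists under the assumptions). Set $$\|(w,v)\|=\|w_1w\|_{L^\infty_{t,r}}+\|w_2v\|_{L^\infty_{t,r}}+\|w_3\,r\partial_rv\|_{L^\infty_{t,r}},$$ where $L^\infty_{t,r}=L^\infty([0,\infty)\times[0,\infty))$. *)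

(* Defs.v *)
From Stdlib Require Import Reals Lra ClassicalEpsilon.
Open Scope R_scope.

(* Total Riemann integral: RiemannInt when f is Riemann integrable on [a,b]
   (oriented), 0 otherwise (the value does not depend on the proof). *)
Definition RInt (f : R -> R) (a b : R) : R :=
  match excluded_middle_informative (inhabited (Riemann_integrable f a b)) with
  | left h => RiemannInt (epsilon h (fun _ => True))
  | right _ => 0
  end.

(* |x|^a for real a, with |0|^a = 0 (a > 0 in use). *)
Definition powabs (x a : R) : R :=
  if Req_EM_T x 0 then 0 else Rpower (Rabs x) a.

Definition jb (x : R) : R := sqrt (1 + x ^ 2).

Definition even_fun (f : R -> R) : Prop := forall x, f (- x) = f x.

Definition compact_supp (f : R -> R) : Prop :=
  exists M, forall x, M < Rabs x -> f x = 0.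
Definition C2_0 (f : R -> R) : Prop :=
  compact_supp f /\
  exists f1 f2 : R -> R, (forall x, derivable_pt_lim f x (f1 x)) /\
    (forall x, derivable_pt_lim f1 x (f2 x)) /\ continuity f2.
Definition C1_0 (f : R -> R) : Prop :=
  compact_supp f /\
  exists f1 : R -> R, (forall x, derivable_pt_lim f x (f1 x)) /\ continuity f1.

Definition U0 (f g : R -> R) (t r : R) : R :=
  / (2 * r) * ((r + t) * f (r + t) + (r - t) * f (r - t))
  + / (2 * r) * RInt (fun rho => rho * g rho) (r - t) (r + t).

Definition Lop (F : R -> R -> R) (t r : R) : R :=
  / (2 * r) * RInt (fun s => RInt (fun rho => rho * F s rho)
                                  (r - (t - s)) (r + (t - s))) 0 t.

Definition w1 (p mu t r : R) : R := jb r * Rpower (jb (t - r)) (mu / p).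
Definition w2 (p mu t r : R) : R :=
  if Rlt_dec r (t / 2)
  then Rpower (jb r) (p - 2) * Rpower (jb (t + r)) mu
  else Rpower (jb (t - r)) (p - 3 + mu) * jb (t + r).
Definition w3 (mu t r : R) : R := Rpower (jb (t - r)) mu.

Definition hderiv (phi : R -> R) (t l : R) : Prop :=
  forall eps, 0 < eps -> exists del, 0 < del /\
    forall tau, 0 <= tau -> tau <> t -> Rabs (tau - t) < del ->
      Rabs ((phi tau - phi t) / (tau - t) - l) < eps.

Definition contH (h : R -> R -> R) : Prop :=
  forall t r, 0 <= t -> forall eps, 0 < eps -> exists del, 0 < del /\
    forall t' r', 0 <= t' -> Rabs (t' - t) < del -> Rabs (r' - r) < del ->
      Rabs (h t' r' - h t r) < eps.

Definition C2H (h : R -> R -> R) : Prop :=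
  exists ht hr htt htr hrt hrr : R -> R -> R,
    (forall t r, 0 <= t ->
       hderiv (fun tau => h tau r) t (ht t r) /\
       derivable_pt_lim (fun rho => h t rho) r (hr t r) /\
       hderiv (fun tau => ht tau r) t (htt t r) /\
       derivable_pt_lim (fun rho => ht t rho) r (htr t r) /\
       hderiv (fun tau => hr tau r) t (hrt t r) /\
       derivable_pt_lim (fun rho => hr t rho) r (hrr t r)) /\
    contH h /\ contH ht /\ contH hr /\ contH htt /\ contH htr /\
    contH hrt /\ contH hrr.

(* ||(w,v)|| <= K, where w = ut; L^oo norms over [0,oo) x [0,oo)
   (for continuous functions these are pointwise sups; r d_r v only
   at r > 0, a null set being irrelevant) *)
Definition norm_le (p mu : R) (w v : R -> R -> R) (K : R) : Prop :=
  exists A B D, A + B + D <= K /\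
    (forall t r, 0 <= t -> 0 <= r -> w1 p mu t r * Rabs (w t r) <= A) /\
    (forall t r, 0 <= t -> 0 <= r -> w2 p mu t r * Rabs (v t r) <= B) /\
    (forall t r d, 0 <= t -> 0 < r -> derivable_pt_lim (fun rho => v t rho) r d ->
       w3 mu t r * Rabs (r * d) <= D).

Definition good_sol (p q mu : R) (f g ft gt : R -> R) (eps C : R)
    (u v : R -> R -> R) : Prop :=
  exists ut : R -> R -> R,
    (forall t r, 0 <= t -> hderiv (fun tau => u tau r) t (ut t r)) /\
    (forall t r, 0 <= t -> r <> 0 ->
       u t r = eps * U0 f g t r + Lop (fun s rho => powabs (v s rho) q) t r) /\
    (forall t r, 0 <= t -> r <> 0 ->
       v t r = eps * U0 ft gt t r + Lop (fun s rho => powabs (ut s rho) p) t r) /\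
    norm_le p mu ut v (C * eps) /\
    (forall t r, 0 <= t -> u t (- r) = u t r /\ v t (- r) = v t r) /\
    contH u /\ contH v /\ contH ut /\
    C2H (fun t r => r * u t r) /\ C2H (fun t r => r * v t r).

(* Main.v *)
(* For a radial solution, [r u] and [r v] solve the one-dimensional wave equation, so the system
   reduces to a fixed point problem for [w = ∂_t u] alone: [w] determines [v], which determines the
   new [∂_t u].  The weights are propagated by integrating the sources along characteristics.  The
   derivative of [r v] along outgoing characteristics is itself such an integral, and a second
   integration along an outgoing characteristic issued from the axis (or from [t = 0]) gives the
   bound on [v].  Near the axis [∂_t u] is controlled by [∂_r (r ∂_t u)], which only involves [v] and
   [r ∂_r v]; since [q > 2] the corresponding source is still locally Lipschitz, so the map
   contracts in the weighted sup norm.  The condition on [μ] is exactly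
   [2 - (p - 2) q < μ q - μ / p], the decay balance in the estimate of [∂_t u]. *)

Require Import Defs.
From Stdlib Require Import Reals Lra Lia FunctionalExtensionality.
From Coquelicot Require Import Coquelicot.
Open Scope R_scope.

(** The iteration runs over functions [w] that are merely continuous, so no derivative of the
    unknown may enter. This works because [v] gains one derivative: the source [r |w|^p] is
    continuous, hence [r v] has a continuous radial derivative, and [r ∂_r v] is read as
    [(r v)_r - v], which makes sense on the axis too. The source [r |v|^q] is then C^1 in [r], as
    the estimate of [∂_t u] near the axis requires. The second derivatives of [r v] ask for a radial
    derivative of [r |w|^p]; it is found only at the fixed point, where [w] is itself a quotient by
    [r]. Fields are kept even or odd over the whole line in [r], so that characteristics cross the
    axis without a boundary condition. Estimates use [1 + |x|] instead of [jb x], because its powers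
    have explicit primitives. Passing back costs a factor 4, so uniqueness in the class of norm at
    most [C2 ε] demands contraction on a ball wider than the one that holds the constructed
    solution; both nonlinearities being superlinear, small [ε] affords this. *)

(** * Continuity in two variables *)

Definition cont2 (h : R -> R -> R) : Prop :=
  forall z : R * R, continuous (fun z : R * R => h (fst z) (snd z)) z.

Lemma cont2_app {U : UniformSpace} (K : R -> R -> R) (a b : U -> R) (x : U) :
  cont2 K -> continuous a x -> continuous b x -> continuous (fun y => K (a y) (b y)) x.
Proof.
  intros HK Ha Hb.
  apply (continuous_comp_2 a b K x Ha Hb).
  exact (HK (a x, b x)).
Qed.

Lemma cont2_ext (h k : R -> R -> R) :
  (forall x y, h x y = k x y) -> cont2 h -> cont2 k.
Proof.
  intros E H z. eapply continuous_ext; [ | exact (H z)]. intros u; simpl; apply E.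
Qed.

Lemma continuous_Rmult {U : UniformSpace} (f g : U -> R) (x : U) :
  continuous f x -> continuous g x -> continuous (fun y => f y * g y) x.
Proof. intros Hf Hg. exact (continuous_mult f g x Hf Hg). Qed.

Lemma continuous_Rplus {U : UniformSpace} (f g : U -> R) (x : U) :
  continuous f x -> continuous g x -> continuous (fun y => f y + g y) x.
Proof. intros Hf Hg. exact (continuous_plus f g x Hf Hg). Qed.

Lemma continuous_Rminus {U : UniformSpace} (f g : U -> R) (x : U) :
  continuous f x -> continuous g x -> continuous (fun y => f y - g y) x.
Proof. intros Hf Hg. exact (continuous_minus f g x Hf Hg). Qed.

Lemma continuous_Ropp {U : UniformSpace} (f : U -> R) (x : U) :
  continuous f x -> continuous (fun y => - f y) x.
Proof. intros Hf. exact (continuous_opp f x Hf). Qed.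

Lemma continuous_Rabs_comp {U : UniformSpace} (f : U -> R) (x : U) :
  continuous f x -> continuous (fun y => Rabs (f y)) x.
Proof. intros Hf. exact (continuous_comp f Rabs x Hf (continuous_Rabs (f x))). Qed.

Lemma continuous_app {U : UniformSpace} (k : R -> R) (f : U -> R) (x : U) :
  (forall y, continuous k y) -> continuous f x -> continuous (fun y => k (f y)) x.
Proof. intros Hk Hf. exact (continuous_comp f k x Hf (Hk _)). Qed.

Lemma continuous_Rmax0 (x : R) : continuous (fun y => Rmax y 0) x.
Proof.
  apply continuous_ext with (f := fun y => / 2 * (y + Rabs y)).
  - intros y. unfold Rmax, Rabs. destruct Rle_dec, Rcase_abs; lra.
  - apply continuous_Rmult; [apply continuous_const |].
    apply continuous_Rplus; [apply continuous_id | apply continuous_Rabs_comp, continuous_id].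
Qed.

Lemma cont2_slice1 (h : R -> R -> R) (t x : R) : cont2 h -> continuous (h t) x.
Proof.
  intros H. apply (cont2_app h (fun _ => t) (fun y => y)); auto.
  - apply continuous_const.
  - apply continuous_id.
Qed.

(** Recursion on the head symbol of the function. The cases [Rplus a], [Rminus a] and [Rmult a]
    catch functions that unification has left eta-reduced. *)
Ltac cnt :=
  lazymatch goal with
  | |- cont2 _ => intros ?; cbv beta; cnt
  | |- continuous (fun x => x) _ => apply continuous_id
  | |- continuous (Rplus ?a) ?z => change (continuous (fun y => a + y) z); cnt
  | |- continuous (Rminus ?a) ?z => change (continuous (fun y => a - y) z); cnt
  | |- continuous (Rmult ?a) ?z => change (continuous (fun y => a * y) z); cnt
  | |- continuous Rabs _ => apply continuous_Rabs
  | |- continuous fst _ => apply continuous_fst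
  | |- continuous snd _ => apply continuous_snd
  | |- continuous (fun x => fst x) _ => apply continuous_fst
  | |- continuous (fun x => snd x) _ => apply continuous_snd
  | |- continuous (fun _ => ?c) _ => apply continuous_const
  | |- continuous (fun x => _ + _) _ => apply continuous_Rplus; cnt
  | |- continuous (fun x => _ - _) _ => apply continuous_Rminus; cnt
  | |- continuous (fun x => _ / _) _ => apply continuous_Rmult; cnt
  | |- continuous (fun x => _ * _) _ => apply continuous_Rmult; cnt
  | |- continuous (fun x => - _) _ => apply continuous_Ropp; cnt
  | |- continuous (fun x => Rmax _ 0) _ =>
      apply (continuous_app (fun y => Rmax y 0)); [apply continuous_Rmax0 | cnt]
  | |- continuous (fun x => Rabs _) _ => apply continuous_Rabs_comp; cnt
  | |- continuous (fun x => ?k _ _) _ =>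
      first [apply (cont2_app k); [solve [assumption | cnt] | cnt | cnt]
            | apply (continuous_app (k _)); [solve [auto] | cnt] ]
  | |- continuous (fun x => ?k _) _ =>
      apply (continuous_app k); [solve [auto] | cnt]
  | |- continuous ?f _ => solve [auto | apply cont2_slice1; assumption]
  end.

Lemma cont2_continuity_2d (h : R -> R -> R) (x y : R) :
  cont2 h <-> forall x y, continuity_2d_pt h x y.
Proof.
  split.
  - intros H u v. apply continuity_2d_pt_filterlim. exact (H (u, v)).
  - intros H [u v]. apply (proj1 (continuity_2d_pt_filterlim h u v)), H.
Qed.

Lemma cont2_pt (h : R -> R -> R) (x y : R) : cont2 h -> continuity_2d_pt h x y.
Proof. intros H. now apply cont2_continuity_2d. Qed.

(** * Integrals with parameters and along characteristics *)

Lemma ex_RInt_cont (f : R -> R) (a b : R) : (forall x, continuous f x) -> ex_RInt f a b.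
Proof. intros H. apply (ex_RInt_continuous (V := R_CompleteNormedModule)). auto. Qed.

Lemma RInt_abs_bound (f : R -> R) (a b M : R) :
  (forall x, continuous f x) ->
  (forall x, Rmin a b <= x <= Rmax a b -> Rabs (f x) <= M) ->
  Rabs (RInt f a b) <= M * Rabs (b - a).
Proof.
  intros Hf HM.
  destruct (Rle_dec a b) as [h | h].
  - rewrite Rmin_left, Rmax_right in HM by lra.
    rewrite (Rabs_right (b - a)) by lra. rewrite Rmult_comm.
    apply abs_RInt_le_const; auto using ex_RInt_cont.
  - rewrite Rmin_right, Rmax_left in HM by lra.
    rewrite (Rabs_left (b - a)) by lra.
    rewrite <- opp_RInt_swap by auto using ex_RInt_cont.
    change (opp (RInt f b a)) with (- RInt f b a). rewrite Rabs_Ropp.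
    replace (M * - (b - a)) with ((a - b) * M) by ring.
    apply abs_RInt_le_const; auto using ex_RInt_cont. lra.
Qed.

Lemma RInt_le_primitive (f h H : R -> R) (a b : R) :
  a <= b -> (forall x, continuous f x) ->
  (forall x, a <= x <= b -> is_derive H x (h x)) ->
  (forall x, a <= x <= b -> continuous h x) ->
  (forall x, a <= x <= b -> Rabs (f x) <= h x) ->
  Rabs (RInt f a b) <= H b - H a.
Proof.
  intros Hab Hf HH Hh Hle.
  apply (norm_RInt_le f h a b); auto.
  - apply (RInt_correct (V := R_CompleteNormedModule)), ex_RInt_cont, Hf.
  - apply (is_RInt_derive (V := R_CompleteNormedModule));
      rewrite Rmin_left, Rmax_right by lra; auto.
Qed.

Lemma is_derive_RInt_cont (f : R -> R) (a x : R) :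
  (forall x, continuous f x) -> is_derive (fun y => RInt f a y) x (f x).
Proof.
  intros Hf. apply (is_derive_RInt f (fun y => RInt f a y) a x).
  - apply filter_forall. intros y. apply (RInt_correct (V := R_CompleteNormedModule)).
    now apply ex_RInt_cont.
  - apply Hf.
Qed.

Lemma is_derive_cont (f : R -> R) (x l : R) : is_derive f x l -> continuous f x.
Proof. intros H. apply (ex_derive_continuous (V := R_NormedModule)). now exists l. Qed.

Lemma is_derive_eq (f : R -> R) (x l l' : R) : is_derive f x l -> l = l' -> is_derive f x l'.
Proof. intros D E. now rewrite <- E. Qed.

Lemma cont2_RInt_param (H : R -> R -> R) :
  cont2 H -> cont2 (fun t y => RInt (fun s => H s y) 0 t).
Proof.
  intros HH. apply (cont2_continuity_2d _ 0 0). intros t0 y0 eps.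
  assert (Hs : forall y x, continuous (fun s => H s y) x) by (intros; cnt).
  (* For [t] within 1 of [t0], all integration times lie in [[-M, M]], so uniform continuity in [y]
     over this one interval controls the change of integrand; the change of endpoint is treated
     separately at fixed [y0]. *)
  set (M := Rabs t0 + 1).
  assert (HM : 0 < M) by (unfold M; pose proof (Rabs_pos t0); lra).
  assert (He : 0 < eps / (2 * M)) by (apply Rdiv_lt_0_compat; [apply cond_pos | lra]).
  assert (HH' : cont2 (fun y s => H s y)) by cnt.
  destruct (uniform_continuity_2d_1d' (fun y s => H s y) (- M) M y0
              (fun s _ => cont2_pt _ _ _ HH') (mkposreal _ He)) as [d1 Hd1].
  assert (Hc : continuous (fun t => RInt (fun s => H s y0) 0 t) t0)
    by (eapply is_derive_cont, is_derive_RInt_cont, Hs).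
  assert (He2 : 0 < eps / 2) by (pose proof (cond_pos eps); lra).
  destruct (proj1 (filterlim_locally _ _) Hc (mkposreal _ He2)) as [d2 Hd2].
  assert (Hd : 0 < Rmin 1 (Rmin d1 d2)).
  { repeat apply Rmin_glb_lt; try lra; apply cond_pos. }
  exists (mkposreal _ Hd). simpl. intros t y Ht Hy.
  assert (Rmin 1 (Rmin d1 d2) <= 1) by apply Rmin_l.
  assert (Rmin 1 (Rmin d1 d2) <= d1) by (eapply Rle_trans; [apply Rmin_r | apply Rmin_l]).
  assert (Rmin 1 (Rmin d1 d2) <= d2) by (eapply Rle_trans; [apply Rmin_r | apply Rmin_r]).
  assert (Ht1 : Rabs t < M).
  { unfold M. replace t with (t0 + (t - t0)) by ring.
    eapply Rle_lt_trans; [apply Rabs_triang | lra]. }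
  assert (Hd2' := Hd2 t ltac:(change (Rabs (t - t0) < d2); lra)).
  change (Rabs (RInt (fun s => H s y0) 0 t - RInt (fun s => H s y0) 0 t0) < eps / 2) in Hd2'.
  replace (RInt (fun s => H s y) 0 t - RInt (fun s => H s y0) 0 t0)
    with ((RInt (fun s => H s y) 0 t - RInt (fun s => H s y0) 0 t)
          + (RInt (fun s => H s y0) 0 t - RInt (fun s => H s y0) 0 t0)) by ring.
  eapply Rle_lt_trans; [apply Rabs_triang |].
  enough (Rabs (RInt (fun s => H s y) 0 t - RInt (fun s => H s y0) 0 t) <= eps / 2) by lra.
  assert (E : RInt (fun s => H s y) 0 t - RInt (fun s => H s y0) 0 t
              = RInt (fun s => H s y - H s y0) 0 t)
    by (symmetry; apply (RInt_minus (V := R_CompleteNormedModule)); auto using ex_RInt_cont).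
  rewrite E.
  eapply Rle_trans.
  - apply (RInt_abs_bound _ 0 t (eps / (2 * M))).
    + intros. cnt.
    + intros s Hs'. left.
      assert (- M <= s <= M).
      { revert Hs' Ht1. unfold Rmin, Rmax, Rabs. destruct Rle_dec, Rcase_abs; lra. }
      apply (Hd1 s y0 s y); try lra.
      all: try (pose proof (cond_pos d1); revert Hy; unfold Rabs; destruct Rcase_abs; intros; lra).
      rewrite Rminus_eq_0, Rabs_R0. apply cond_pos.
  - rewrite Rminus_0_r.
    apply Rle_trans with (eps / (2 * M) * M).
    + apply Rmult_le_compat_l; lra.
    + right. field. lra.
Qed.

(* Integral of [K] over the backward characteristic of slope [-sg] through [(t, r)]. *)
Definition charint (sg : R) (K : R -> R -> R) (t r : R) : R :=
  RInt (fun s => K s (r + sg * (t - s))) 0 t.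

Lemma cont2_charint (sg : R) (K : R -> R -> R) : cont2 K -> cont2 (charint sg K).
Proof.
  intros HK.
  (* In terms of the label [y = r + sg * t], constant along the characteristic, the integrand is
     free of [t] and the parameter lemma applies. *)
  assert (H1 : cont2 (fun s y => K s (y - sg * s))) by cnt.
  apply cont2_RInt_param in H1.
  apply cont2_ext with
    (h := fun t r => (fun t y => RInt (fun s => K s (y - sg * s)) 0 t) t (r + sg * t)).
  - intros t r. unfold charint. apply RInt_ext. intros s _. f_equal. ring.
  - intros z. apply (cont2_app _ fst (fun z => snd z + sg * fst z) z H1); cnt.
Qed.

(** The vertex of the characteristic moves along a line of direction [(b, d)]. The first term comes
    from the upper endpoint; the factor [d + sg * b] is the speed of the label [r + sg * t], so the
    second term drops out when the vertex slides along its own characteristic. *)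
Lemma is_derive_charint (sg a b c d : R) (K k : R -> R -> R) (x : R) :
  cont2 K -> cont2 k -> (forall s y, is_derive (K s) y (k s y)) ->
  is_derive (fun x => charint sg K (a + b * x) (c + d * x)) x
    (b * K (a + b * x) (c + d * x)
     + (d + sg * b) * charint sg k (a + b * x) (c + d * x)).
Proof.
  intros HK Hk HKk.
  set (f := fun x s => K s (c + d * x + sg * (a + b * x - s))).
  assert (Hf : forall s u, is_derive (fun u => f u s) u
             ((d + sg * b) * k s (c + d * u + sg * (a + b * u - s)))).
  { intros s u. unfold f.
    apply (is_derive_comp (K s) (fun u => c + d * u + sg * (a + b * u - s)) u).
    - apply HKk.
    - auto_derive; auto. ring. }
  assert (HD : forall u v, Derive (fun z => f z v) u
                 = (d + sg * b) * k v (c + d * u + sg * (a + b * u - v))).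
  { intros. apply is_derive_unique, Hf. }
  assert (HDc : forall u v, continuity_2d_pt (fun u v => Derive (fun z => f z v) u) u v).
  { intros u v. eapply continuity_2d_pt_ext; [intros; symmetry; apply HD |].
    apply cont2_pt. cnt. }
  assert (Hfc : forall u s, continuous (fun s => f u s) s) by (intros; unfold f; cnt).
  assert (Hint : forall u y z, ex_RInt (fun s => f u s) y z)
    by (intros; apply ex_RInt_cont; intros; apply Hfc).
  pose proof (is_derive_RInt_param_bound_comp f (fun _ => 0) (fun x => a + b * x) x 0 b) as HH.
  assert (HH' : is_derive (fun x0 => RInt (fun t => f x0 t) 0 (a + b * x0)) x
    (RInt (fun t => Derive (fun u => f u t) x) 0 (a + b * x)
     + - f x 0 * 0 + f x (a + b * x) * b)).
  { apply HH.
    - apply filter_forall; auto.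
    - exists (mkposreal 1 Rlt_0_1). apply filter_forall; auto.
    - exists (mkposreal 1 Rlt_0_1). apply filter_forall; auto.
    - apply @is_derive_const.
    - auto_derive; auto; ring.
    - exists (mkposreal 1 Rlt_0_1). apply filter_forall. intros u t _.
      eexists. apply Hf.
    - auto.
    - exists (mkposreal 1 Rlt_0_1). auto.
    - exists (mkposreal 1 Rlt_0_1). auto.
    - apply continuity_pt_filterlim, Hfc.
    - apply continuity_pt_filterlim, Hfc. }
  clear HH.
  match type of HH' with is_derive _ _ ?l => replace (_ + _) with l; [exact HH' |] end.
  replace (f x (a + b * x)) with (K (a + b * x) (c + d * x)) by (unfold f; f_equal; ring).
  replace (RInt (fun t => Derive (fun u => f u t) x) 0 (a + b * x))
    with ((d + sg * b) * charint sg k (a + b * x) (c + d * x)); [ring |].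
  unfold charint.
  rewrite <- (RInt_scal (V := R_CompleteNormedModule)).
  - apply RInt_ext. intros s _. rewrite HD. reflexivity.
  - apply ex_RInt_cont. intros; cnt.
Qed.

(** * Increments bounded through derivatives *)

Lemma MVT_closed (f df : R -> R) (a b : R) :
  (forall x, Rmin a b <= x <= Rmax a b -> is_derive f x (df x)) ->
  exists c, Rmin a b <= c <= Rmax a b /\ f b - f a = df c * (b - a).
Proof.
  intros H. apply (MVT_gen f a b df).
  - intros x Hx. apply H. lra.
  - intros x Hx. apply continuity_pt_filterlim, (is_derive_cont f x (df x)), H, Hx.
Qed.

Lemma derive_bound (f df : R -> R) (a b M : R) :
  (forall x, Rmin a b <= x <= Rmax a b -> is_derive f x (df x)) ->
  (forall x, Rmin a b <= x <= Rmax a b -> Rabs (df x) <= M) ->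
  Rabs (f b - f a) <= M * Rabs (b - a).
Proof.
  intros H HM. destruct (MVT_closed f df a b H) as [c [Hc E]].
  rewrite E, Rabs_mult. apply Rmult_le_compat_r; [apply Rabs_pos | auto].
Qed.

Lemma constant_of_derive0 (f : R -> R) (a b : R) :
  (forall x, is_derive f x 0) -> f b = f a.
Proof.
  intros H. destruct (MVT_closed f (fun _ => 0) a b) as [c [_ E]]; auto. lra.
Qed.

(** The mean value theorem for [H - f] and [H + f] replaces integration of [df], so that nothing
    beyond pointwise derivatives is asked of [f]. *)
Lemma derive_le_primitive (f df H h : R -> R) (a b : R) :
  a <= b ->
  (forall x, a <= x <= b -> is_derive f x (df x)) ->
  (forall x, a <= x <= b -> is_derive H x (h x)) ->
  (forall x, a <= x <= b -> Rabs (df x) <= h x) ->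
  Rabs (f b - f a) <= H b - H a.
Proof.
  intros Hab Hf HH Hle.
  assert (E : forall sg, (sg = 1 \/ sg = -1) -> sg * (f b - f a) <= H b - H a).
  { intros sg Hsg.
    destruct (MVT_closed (fun x => H x - sg * f x) (fun x => h x - sg * df x) a b)
      as [c [Hc E]].
    - intros x Hx. rewrite Rmin_left, Rmax_right in Hx by lra.
      apply (is_derive_minus H (fun x => sg * f x)); auto.
      apply (is_derive_scal f); auto.
    - rewrite Rmin_left, Rmax_right in Hc by lra.
      assert (0 <= h c - sg * df c).
      { specialize (Hle c Hc). destruct Hsg; subst; revert Hle; unfold Rabs;
          destruct Rcase_abs; lra. }
      assert (0 <= (h c - sg * df c) * (b - a)) by (apply Rmult_le_pos; lra). lra. }
  pose proof (E 1 (or_introl eq_refl)). pose proof (E (-1) (or_intror eq_refl)).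
  unfold Rabs; destruct Rcase_abs; lra.
Qed.

(** * Power weights and their primitives *)

(** Stand-in for [jb], comparable to it within a factor 2, whose powers integrate in closed form on
    each half-line. *)
Definition br (x : R) : R := 1 + Rabs x.
Definition bp (x a : R) : R := Rpower (br x) a.

Lemma br_ge1 (x : R) : 1 <= br x.
Proof. unfold br. pose proof (Rabs_pos x). lra. Qed.

Lemma bp_pos (x a : R) : 0 < bp x a.
Proof. apply exp_pos. Qed.

Lemma bp_plus (x a b : R) : bp x (a + b) = bp x a * bp x b.
Proof. apply Rpower_plus. Qed.

Lemma bp_0 (x : R) : bp x 0 = 1.
Proof. apply Rpower_O. pose proof (br_ge1 x). lra. Qed.

Lemma bp_1 (x : R) : bp x 1 = br x.
Proof. apply Rpower_1. pose proof (br_ge1 x). lra. Qed.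

Lemma bp_at0 (a : R) : bp 0 a = 1.
Proof. unfold bp, br. rewrite Rabs_R0, Rplus_0_r. unfold Rpower. rewrite ln_1, Rmult_0_r. apply exp_0. Qed.

Lemma Rpower_bp (x a b : R) : Rpower (bp x a) b = bp x (a * b).
Proof. apply Rpower_mult. Qed.

Lemma bp_opp (x a : R) : bp (- x) a = bp x a.
Proof. unfold bp, br. now rewrite Rabs_Ropp. Qed.

Lemma bp_Rabs (x a : R) : bp (Rabs x) a = bp x a.
Proof. unfold bp, br. now rewrite Rabs_Rabsolu. Qed.

Lemma bp_exp_le (x a b : R) : a <= b -> bp x a <= bp x b.
Proof.
  intros H. destruct (Req_dec (br x) 1) as [E | E].
  - right. unfold bp, Rpower. now rewrite E, ln_1, !Rmult_0_r.
  - apply Rle_Rpower; auto. apply br_ge1.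
Qed.

Lemma bp_le1 (x a : R) : a <= 0 -> bp x a <= 1.
Proof. intros H. rewrite <- (bp_0 x). now apply bp_exp_le. Qed.

Lemma bp_ge1 (x a : R) : 0 <= a -> 1 <= bp x a.
Proof. intros H. rewrite <- (bp_0 x). now apply bp_exp_le. Qed.

Lemma bp_inv (x a : R) : bp x a * bp x (- a) = 1.
Proof. rewrite <- bp_plus, Rplus_opp_r. apply bp_0. Qed.

Lemma bp_base (x y k a : R) :
  0 <= a -> 0 < k -> br x <= k * br y -> bp x a <= Rpower k a * bp y a.
Proof.
  intros Ha Hk H. unfold bp.
  rewrite Rpower_mult_distr; auto; [| pose proof (br_ge1 y); lra].
  apply Rle_Rpower_l; auto. pose proof (br_ge1 x). lra.
Qed.

Lemma bp_base_neg (x y k a : R) :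
  a <= 0 -> 0 < k -> br y <= k * br x -> bp x a <= Rpower k (- a) * bp y a.
Proof.
  intros Ha Hk H.
  pose proof (bp_base y x k (- a) ltac:(lra) Hk H) as HH.
  pose proof (bp_inv x a). pose proof (bp_inv y a).
  pose proof (bp_pos x a). pose proof (bp_pos y a).
  apply Rle_trans with (bp x a * bp y a * bp y (- a)).
  - rewrite Rmult_assoc, (bp_inv y a). lra.
  - apply Rle_trans with (bp x a * bp y a * (Rpower k (- a) * bp x (- a))).
    + apply Rmult_le_compat_l; [| exact HH]. left. now apply Rmult_lt_0_compat.
    + right. transitivity (Rpower k (- a) * bp y a * (bp x a * bp x (- a))); [ring |].
      rewrite bp_inv. ring.
Qed.

Lemma bp_mono (x y a : R) : 0 <= a -> Rabs x <= Rabs y -> bp x a <= bp y a.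
Proof.
  intros Ha H. pose proof (bp_base x y 1 a Ha Rlt_0_1) as HH.
  unfold Rpower in HH at 1. rewrite ln_1, Rmult_0_r, exp_0 in HH.
  rewrite !Rmult_1_l in HH. apply HH. unfold br. lra.
Qed.

Lemma bp_anti (x y a : R) : a <= 0 -> Rabs y <= Rabs x -> bp x a <= bp y a.
Proof.
  intros Ha H. pose proof (bp_base_neg x y 1 a Ha Rlt_0_1) as HH.
  unfold Rpower in HH at 1. rewrite ln_1, Rmult_0_r, exp_0 in HH.
  rewrite !Rmult_1_l in HH. apply HH. unfold br. lra.
Qed.

Lemma continuous_Rpower_l (f : R -> R) (a x : R) :
  continuous f x -> 0 < f x -> continuous (fun y => Rpower (f y) a) x.
Proof.
  intros Hf H. unfold Rpower.
  apply (continuous_comp (fun y => a * ln (f y)) exp).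
  - apply continuous_Rmult; [apply continuous_const |].
    apply (continuous_comp f ln); auto.
    apply (ex_derive_continuous (V := R_NormedModule)). eexists.
    apply is_derive_Reals. now apply derivable_pt_lim_ln.
  - apply (ex_derive_continuous (V := R_NormedModule)). eexists.
    apply is_derive_Reals. apply derivable_pt_lim_exp.
Qed.

Lemma continuous_bp (a x : R) : continuous (fun y => bp y a) x.
Proof.
  unfold bp, br. apply continuous_Rpower_l; [cnt | pose proof (Rabs_pos x); lra].
Qed.

(** The shift by one makes the sign of [a] decide the behaviour: growth like [bp x a / a] for
    positive [a], boundedness for negative [a]. The integral form gives differentiability at 0,
    where the closed formula changes sign. *)
Definition prim (a x : R) : R := RInt (fun s => bp s (a - 1)) 0 x.

Lemma is_derive_prim (a x : R) : is_derive (prim a) x (bp x (a - 1)).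
Proof. apply (is_derive_RInt_cont (fun s => bp s (a - 1))). intros; apply continuous_bp. Qed.

Lemma prim_nonneg_eq (a x : R) : a <> 0 -> 0 <= x -> prim a x = (bp x a - 1) / a.
Proof.
  intros Ha Hx. unfold prim.
  transitivity (RInt (fun s => Rpower (1 + s) (a - 1)) 0 x).
  - apply RInt_ext. intros s. rewrite Rmin_left, Rmax_right by lra. intros Hs.
    unfold bp, br. now rewrite Rabs_right by lra.
  - apply is_RInt_unique.
    replace ((bp x a - 1) / a)
      with (minus ((fun s => Rpower (1 + s) a / a) x) ((fun s => Rpower (1 + s) a / a) 0)).
    + apply (is_RInt_derive (V := R_CompleteNormedModule)
               (fun s => Rpower (1 + s) a / a) (fun s => Rpower (1 + s) (a - 1)));
        rewrite Rmin_left, Rmax_right by lra; intros s Hs.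
      * assert (D : is_derive (fun s => Rpower (1 + s) a) s (a * Rpower (1 + s) (a - 1))).
        { replace (a * Rpower (1 + s) (a - 1)) with (1 * (a * Rpower (1 + s) (a - 1))) by ring.
          apply (is_derive_comp (fun y => Rpower y a) (fun s => 1 + s)).
          - apply is_derive_Reals, derivable_pt_lim_power. lra.
          - auto_derive; auto. }
        apply (is_derive_scal _ _ (/ a)) in D.
        eapply is_derive_ext; [| replace (Rpower (1 + s) (a - 1))
          with (/ a * (a * Rpower (1 + s) (a - 1))); [exact D |]].
        -- intros y; simpl. unfold Rdiv. ring.
        -- now field.
      * apply continuous_Rpower_l; [cnt | lra].
    + unfold minus, plus, opp; simpl. unfold bp, br. rewrite Rabs_right by lra.
      replace (Rpower (1 + 0) a) with 1; [field; auto |].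
      unfold Rpower. now rewrite Rplus_0_r, ln_1, Rmult_0_r, exp_0.
Qed.

Lemma prim_odd (a x : R) : prim a (- x) = - prim a x.
Proof.
  assert (H : forall y, is_derive (fun y => prim a y + prim a (- y)) y 0).
  { intros y.
    replace 0 with (bp y (a - 1) + (- 1) * bp (- y) (a - 1)) by (rewrite bp_opp; ring).
    apply (is_derive_plus (prim a) (fun y => prim a (- y))).
    - apply is_derive_prim.
    - apply (is_derive_comp (prim a) Ropp); [apply is_derive_prim |].
      auto_derive; auto. }
  pose proof (constant_of_derive0 _ 0 x H) as Hc. simpl in Hc.
  rewrite Ropp_0 in Hc.
  replace (prim a 0) with 0 in Hc; [lra |].
  unfold prim. now rewrite RInt_point.
Qed.

Lemma prim_abs_pos (a x : R) : 0 < a -> Rabs (prim a x) <= bp x a / a.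
Proof.
  intros Ha.
  assert (H : forall y, 0 <= y -> Rabs (prim a y) <= bp y a / a).
  { intros y Hy. rewrite prim_nonneg_eq by lra.
    pose proof (bp_ge1 y a ltac:(lra)).
    rewrite Rabs_right.
    - apply Rmult_le_compat_r; [left; now apply Rinv_0_lt_compat | lra].
    - apply Rle_ge, Rdiv_le_0_compat; lra. }
  destruct (Rle_dec 0 x); auto.
  rewrite <- (Ropp_involutive x), prim_odd, Rabs_Ropp, (bp_opp (- x)). apply H. lra.
Qed.

Lemma prim_abs_neg (a x : R) : a < 0 -> Rabs (prim a x) <= / - a.
Proof.
  intros Ha.
  assert (H : forall y, 0 <= y -> Rabs (prim a y) <= / - a).
  { intros y Hy. rewrite prim_nonneg_eq by lra.
    pose proof (bp_le1 y a ltac:(lra)). pose proof (bp_pos y a).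
    replace ((bp y a - 1) / a) with ((1 - bp y a) * / - a) by (field; lra).
    assert (0 < / - a) by (apply Rinv_0_lt_compat; lra).
    rewrite Rabs_right.
    - rewrite <- (Rmult_1_l (/ - a)) at 2. apply Rmult_le_compat_r; lra.
    - apply Rle_ge, Rmult_le_pos; lra. }
  destruct (Rle_dec 0 x); auto.
  rewrite <- (Ropp_involutive x), prim_odd, Rabs_Ropp. apply H. lra.
Qed.

Lemma prim_diff_neg (a x y : R) : a < 0 -> 0 <= x <= y -> prim a y - prim a x <= bp x a / - a.
Proof.
  intros Ha H. rewrite !prim_nonneg_eq by lra.
  replace ((bp y a - 1) / a - (bp x a - 1) / a) with ((bp x a - bp y a) * / - a) by (field; lra).
  assert (0 < / - a) by (apply Rinv_0_lt_compat; lra).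
  apply Rmult_le_compat_r; [lra |]. pose proof (bp_pos y a). lra.
Qed.

(** [(1+x)^a = (1+x)^(a-1) + x (1+x)^(a-1)], and the first summand is at most 1. The point is the
    factor [x]: it becomes the [r] that is divided out when passing from [r v] to [v]. *)
Lemma prim_le_linear (a x : R) : 0 < a <= 1 -> 0 <= x -> prim a x <= x * bp x (a - 1) / a.
Proof.
  intros Ha Hx. rewrite prim_nonneg_eq by lra.
  apply Rmult_le_compat_r; [left; apply Rinv_0_lt_compat; lra |].
  replace (bp x a) with (bp x (a - 1) * bp x 1) by (rewrite <- bp_plus; f_equal; ring).
  rewrite bp_1. unfold br. rewrite Rabs_right by lra.
  pose proof (bp_le1 x (a - 1) ltac:(lra)). lra.
Qed.

(** Common form of the integrals along characteristics: in each term one bracket varies, affinely in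
    the time [s], either the radius (slope 1 or -1) or a light-cone coordinate (slope 2). Dividing
    by the slope lets it have either sign. *)
Lemma RInt_bp2 (f : R -> R) (a b c1 u1 k1 e1 c2 u2 k2 e2 : R) :
  a <= b -> k1 <> 0 -> k2 <> 0 -> (forall x, continuous f x) ->
  (forall s, a <= s <= b ->
     Rabs (f s) <= c1 * bp (u1 + k1 * s) (e1 - 1) + c2 * bp (u2 + k2 * s) (e2 - 1)) ->
  Rabs (RInt f a b) <= c1 / k1 * (prim e1 (u1 + k1 * b) - prim e1 (u1 + k1 * a))
                     + c2 / k2 * (prim e2 (u2 + k2 * b) - prim e2 (u2 + k2 * a)).
Proof.
  intros Hab Hk1 Hk2 Hf Hle.
  assert (D : forall c u k e x, k <> 0 ->
    is_derive (fun s => c / k * prim e (u + k * s)) x (c * bp (u + k * x) (e - 1))).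
  { intros c u k e x Hk.
    replace (c * bp (u + k * x) (e - 1)) with (c / k * (k * bp (u + k * x) (e - 1))) by now field.
    apply (is_derive_scal (fun s => prim e (u + k * s))).
    apply (is_derive_comp (prim e) (fun s => u + k * s)); [apply is_derive_prim |].
    auto_derive; auto. ring. }
  replace (c1 / k1 * (prim e1 (u1 + k1 * b) - prim e1 (u1 + k1 * a))
            + c2 / k2 * (prim e2 (u2 + k2 * b) - prim e2 (u2 + k2 * a)))
    with ((c1 / k1 * prim e1 (u1 + k1 * b) + c2 / k2 * prim e2 (u2 + k2 * b))
        - (c1 / k1 * prim e1 (u1 + k1 * a) + c2 / k2 * prim e2 (u2 + k2 * a))) by ring.
  apply (RInt_le_primitive f
    (fun s => c1 * bp (u1 + k1 * s) (e1 - 1) + c2 * bp (u2 + k2 * s) (e2 - 1))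
    (fun s => c1 / k1 * prim e1 (u1 + k1 * s) + c2 / k2 * prim e2 (u2 + k2 * s))); auto.
  - intros x _. apply (is_derive_plus (fun s => c1 / k1 * prim e1 (u1 + k1 * s))
      (fun s => c2 / k2 * prim e2 (u2 + k2 * s))); apply D; auto.
  - intros x _.
    assert (forall u k e, continuous (fun s => bp (u + k * s) e) x).
    { intros. apply (continuous_app (fun y => bp y e) (fun s => u + k * s));
        [intros; apply continuous_bp | cnt]. }
    apply continuous_Rplus; apply continuous_Rmult; auto; apply continuous_const.
Qed.

Lemma RInt_bp1 (f : R -> R) (a b c u k e : R) :
  a <= b -> k <> 0 -> (forall x, continuous f x) ->
  (forall s, a <= s <= b -> Rabs (f s) <= c * bp (u + k * s) (e - 1)) ->
  Rabs (RInt f a b) <= c / k * (prim e (u + k * b) - prim e (u + k * a)).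
Proof.
  intros Hab Hk Hf H.
  replace (c / k * (prim e (u + k * b) - prim e (u + k * a)))
    with (c / k * (prim e (u + k * b) - prim e (u + k * a))
        + 0 / k * (prim e (u + k * b) - prim e (u + k * a))) by (field; auto).
  apply RInt_bp2; auto. intros s Hs. rewrite Rmult_0_l, Rplus_0_r. auto.
Qed.

Lemma bp_m1 (x : R) : bp x (-1) = / br x.
Proof.
  unfold bp. replace (-1) with (- (1)) by ring. rewrite Rpower_Ropp, Rpower_1; auto. pose proof (br_ge1 x). lra.
Qed.

Lemma derive_bp1 (f df : R -> R) (a b c u k e : R) :
  a <= b -> k <> 0 -> (forall x, a <= x <= b -> is_derive f x (df x)) ->
  (forall x, a <= x <= b -> Rabs (df x) <= c * bp (u + k * x) (e - 1)) ->
  Rabs (f b - f a) <= c / k * (prim e (u + k * b) - prim e (u + k * a)).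
Proof.
  intros Hab Hk Hf H. rewrite Rmult_minus_distr_l.
  apply (derive_le_primitive f df (fun x => c / k * prim e (u + k * x))
           (fun x => c * bp (u + k * x) (e - 1))); auto.
  intros x _.
  replace (c * bp (u + k * x) (e - 1)) with (c / k * (k * bp (u + k * x) (e - 1))) by now field.
  apply (is_derive_scal (fun s => prim e (u + k * s))).
  apply (is_derive_comp (prim e) (fun s => u + k * s)); [apply is_derive_prim |].
  auto_derive; auto. ring.
Qed.

(** * One-dimensional estimates for the source |∂_t u|^p *)

Lemma Rpower_pos (x a : R) : 0 < Rpower x a.
Proof. apply exp_pos. Qed.

Ltac rabs := unfold Rabs in *; repeat destruct Rcase_abs; lra.

Section FirstKernel.
Variables p mu : R.
Hypotheses (Hp : 2 < p) (Hp3 : p < 3) (Hmu : 3 - p < mu) (Hmu1 : mu < 1).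

(** On the characteristic [s + y = al] with radius [y = la] one has [s - y = al - 2 * la]. The two
    brackets cannot both be small against [al]: for [la <= al / 4] the second is at least [al / 2],
    otherwise [la > al / 4]. So the product is at most a sum of terms in each of which only one
    bracket varies. *)
Lemma kernel1_majorant :
  exists C, 0 < C /\ forall al la, 0 <= la <= al ->
    bp la (1 - p) * bp (al - 2 * la) (- mu)
    <= C * (bp al (- mu) * bp la (1 - p) + bp al (1 - p) * bp (al - 2 * la) (- mu)).
Proof.
  exists (Rpower 2 mu + Rpower 4 (p - 1)).
  pose proof (Rpower_pos 2 mu). pose proof (Rpower_pos 4 (p - 1)).
  split; [lra |]. intros al la Hla.
  pose proof (bp_pos la (1 - p)) as P1. pose proof (bp_pos (al - 2 * la) (- mu)) as P2.
  pose proof (bp_pos al (- mu)) as P3. pose proof (bp_pos al (1 - p)) as P4.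
  assert (Q1 := Rmult_lt_0_compat _ _ P3 P1). assert (Q2 := Rmult_lt_0_compat _ _ P4 P2).
  destruct (Rle_dec la (al / 4)) as [h | h].
  - apply Rle_trans with (Rpower 2 mu * (bp al (- mu) * bp la (1 - p))).
    + assert (bp (al - 2 * la) (- mu) <= Rpower 2 (- - mu) * bp al (- mu)).
      { apply bp_base_neg; try lra. unfold br. rabs. }
      rewrite Ropp_involutive in *.
      replace (Rpower 2 mu * (bp al (- mu) * bp la (1 - p)))
        with (bp la (1 - p) * (Rpower 2 mu * bp al (- mu))) by ring.
      apply Rmult_le_compat_l; lra.
    + apply Rmult_le_compat; try lra.
  - apply Rle_trans with (Rpower 4 (p - 1) * (bp al (1 - p) * bp (al - 2 * la) (- mu))).
    + assert (bp la (1 - p) <= Rpower 4 (- (1 - p)) * bp al (1 - p)).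
      { apply bp_base_neg; try lra. unfold br. rabs. }
      replace (- (1 - p)) with (p - 1) in * by ring.
      rewrite <- Rmult_assoc. apply Rmult_le_compat_r; lra.
    + apply Rmult_le_compat; try lra.
Qed.

(** The radius is [al - s], which grows backwards in time from its value [al - tau] at the vertex.
    In the first term of the majorant [1 - p < -1], so the integral is governed by that smallest
    radius; in the second [mu < 1] yields [bp al (1 - mu)], and the surplus [bp al (2 - p)] is at
    most [bp (al - tau) (2 - p)]. *)
Lemma kernel1_outgoing :
  exists C, 0 < C /\ forall A (h : R -> R) al tau,
    0 <= tau <= al -> 0 <= A -> (forall s, continuous h s) ->
    (forall s, 0 <= s <= tau -> Rabs (h s) <= A * (bp (al - s) (1 - p) * bp (2 * s - al) (- mu))) ->
    Rabs (RInt h 0 tau) <= C * A * (bp (al - tau) (2 - p) * bp al (- mu)).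
Proof.
  destruct kernel1_majorant as [C0 [HC0 HC]].
  exists (C0 * (/ (p - 2) + / (1 - mu))).
  assert (I1 : 0 < / (p - 2)) by (apply Rinv_0_lt_compat; lra).
  assert (I2 : 0 < / (1 - mu)) by (apply Rinv_0_lt_compat; lra).
  split. { apply Rmult_lt_0_compat; lra. }
  intros A h al tau Ht HA Hh Hb.
  eapply Rle_trans.
  - apply (RInt_bp2 h 0 tau (A * C0 * bp al (- mu)) al (-1) (2 - p)
             (A * C0 * bp al (1 - p)) (- al) 2 (1 - mu)); auto; try lra.
    intros s Hs. eapply Rle_trans; [now apply Hb |].
    specialize (HC al (al - s) ltac:(lra)).
    replace (al - 2 * (al - s)) with (2 * s - al) in HC by ring.
    replace (al + -1 * s) with (al - s) by ring. replace (- al + 2 * s) with (2 * s - al) by ring.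
    replace (2 - p - 1) with (1 - p) by ring. replace (1 - mu - 1) with (- mu) by ring.
    apply Rle_trans with (A * (C0 * (bp al (- mu) * bp (al - s) (1 - p)
                                  + bp al (1 - p) * bp (2 * s - al) (- mu)))).
    + now apply Rmult_le_compat_l.
    + right; ring.
  - replace (al + -1 * tau) with (al - tau) by ring. replace (al + -1 * 0) with al by ring.
    replace (- al + 2 * tau) with (2 * tau - al) by ring. replace (- al + 2 * 0) with (- al) by ring.
    assert (B1 := prim_diff_neg (2 - p) (al - tau) al ltac:(lra) ltac:(lra)).
    replace (- (2 - p)) with (p - 2) in B1 by ring.
    assert (B2 := prim_abs_pos (1 - mu) (2 * tau - al) ltac:(lra)).
    assert (B3 := prim_abs_pos (1 - mu) (- al) ltac:(lra)).
    rewrite bp_opp in B3.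
    assert (B4 := bp_mono (2 * tau - al) al (1 - mu) ltac:(lra) ltac:(rabs)).
    assert (B5 : (prim (1 - mu) (2 * tau - al) - prim (1 - mu) (- al)) / 2 <= bp al (1 - mu) / (1 - mu)).
    { assert (bp (2 * tau - al) (1 - mu) / (1 - mu) <= bp al (1 - mu) / (1 - mu))
        by (apply Rmult_le_compat_r; lra).
      pose proof (Rle_abs (prim (1 - mu) (2 * tau - al))).
      pose proof (Rle_abs (- prim (1 - mu) (- al))). rewrite Rabs_Ropp in *. lra. }
    assert (B6 : bp al (1 - p) * bp al (1 - mu) <= bp (al - tau) (2 - p) * bp al (- mu)).
    { rewrite <- bp_plus. replace (1 - p + (1 - mu)) with (2 - p + - mu) by ring.
      rewrite bp_plus. apply Rmult_le_compat_r; [left; apply bp_pos |].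
      apply bp_anti; [lra | rabs]. }
    pose proof (bp_pos al (- mu)) as P3. pose proof (bp_pos al (1 - p)) as P4.
    assert (PA : 0 <= A * C0) by (apply Rmult_le_pos; lra).
    apply Rle_trans with (A * C0 * (bp al (- mu) * (bp (al - tau) (2 - p) * / (p - 2))
       + bp al (1 - p) * (bp al (1 - mu) * / (1 - mu)))).
    + match goal with |- ?l <= _ => replace l with
        (A * C0 * (bp al (- mu) * (prim (2 - p) al - prim (2 - p) (al - tau))
          + bp al (1 - p) * ((prim (1 - mu) (2 * tau - al) - prim (1 - mu) (- al)) / 2))) by field end.
      apply Rmult_le_compat_l; auto.
      apply Rplus_le_compat; apply Rmult_le_compat_l; try lra; auto.
    + apply Rle_trans with (A * C0 * (bp al (- mu) * (bp (al - tau) (2 - p) * / (p - 2))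
       + (bp (al - tau) (2 - p) * bp al (- mu)) * / (1 - mu))).
      * apply Rmult_le_compat_l; auto. apply Rplus_le_compat_l.
        rewrite <- Rmult_assoc. apply Rmult_le_compat_r; lra.
      * right; ring.
Qed.

(** Here the signed radius is [s - T]. For [s >= T] the cone coordinate is constantly [T] and the
    integrable power of the radius remains. For [s < T] the line has crossed the axis; its
    reflection is the characteristic of [kernel1_outgoing] with [al = tau = T], ending on the
    axis. *)
Lemma kernel1_incoming :
  exists C, 0 < C /\ forall A (h : R -> R) t T,
    0 <= t -> T <= t -> 0 <= A -> (forall s, continuous h s) ->
    (forall s, 0 <= s <= t ->
       Rabs (h s) <= A * (bp (s - T) (1 - p) * bp (s - Rabs (s - T)) (- mu))) ->
    Rabs (RInt h 0 t) <= C * A * bp T (- mu).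
Proof.
  destruct kernel1_outgoing as [C0 [HC0 HC]].
  exists (C0 + 2 / (p - 2)).
  assert (I1 : 0 < / (p - 2)) by (apply Rinv_0_lt_compat; lra).
  split. { unfold Rdiv; lra. }
  intros A h t T Ht HTt HA Hh Hb.
  assert (PT := bp_pos T (- mu)).
  assert (Hright : forall m, 0 <= m <= t -> T <= m ->
            Rabs (RInt h m t) <= 2 / (p - 2) * A * bp T (- mu)).
  { intros m Hm HTm. eapply Rle_trans.
    - apply (RInt_bp1 h m t (A * bp T (- mu)) (- T) 1 (2 - p)); try lra; auto.
      intros s Hs. eapply Rle_trans; [apply Hb; lra |].
      rewrite (Rabs_right (s - T)) by lra.
      replace (s - (s - T)) with T by ring. replace (- T + 1 * s) with (s - T) by ring.
      replace (2 - p - 1) with (1 - p) by ring. right; ring.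
    - replace (- (2 - p)) with (p - 2) by ring.
      assert (B1 := prim_abs_neg (2 - p) (- T + 1 * t) ltac:(lra)).
      assert (B2 := prim_abs_neg (2 - p) (- T + 1 * m) ltac:(lra)).
      replace (- (2 - p)) with (p - 2) in * by ring.
      pose proof (Rle_abs (prim (2 - p) (- T + 1 * t))).
      pose proof (Rle_abs (- prim (2 - p) (- T + 1 * m))). rewrite Rabs_Ropp in *.
      apply Rle_trans with (A * bp T (- mu) * (2 * / (p - 2))).
      + unfold Rdiv at 1. rewrite Rinv_1, Rmult_1_r.
        apply Rmult_le_compat_l; [apply Rmult_le_pos; lra | lra].
      + right; field; lra. }
  destruct (Rle_dec T 0) as [h0 | h0].
  - eapply Rle_trans; [apply (Hright 0); lra |].
    apply Rmult_le_compat_r; [lra |]. apply Rmult_le_compat_r; lra.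
  - assert (Hl : Rabs (RInt h 0 T) <= C0 * A * (bp (T - T) (2 - p) * bp T (- mu))).
    { apply HC; auto; try lra. intros s Hs. eapply Rle_trans; [apply Hb; lra |].
      rewrite (Rabs_left1 (s - T)) by lra.
      replace (s - - (s - T)) with (2 * s - T) by ring.
      rewrite <- (bp_opp (s - T)). replace (- (s - T)) with (T - s) by ring. lra. }
    replace (T - T) with 0 in Hl by ring. rewrite bp_at0, Rmult_1_l in Hl.
    rewrite <- (RInt_Chasles (V := R_CompleteNormedModule) h 0 T t) by now apply ex_RInt_cont.
    eapply Rle_trans; [apply Rabs_triang |].
    specialize (Hright T ltac:(lra) ltac:(lra)). lra.
Qed.

(** The path starts on the axis at time [t - r]. As [r < t / 2] gives [t + r <= 3 * (t - r)], the
    cone bracket may be frozen at [t + r], and [prim_le_linear] preserves the factor [r]. *)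
Lemma outgoing_near :
  exists C, 0 < C /\ forall r t D (f df : R -> R),
    0 <= r < t / 2 -> 0 <= D -> f 0 = 0 ->
    (forall x, is_derive f x (df x)) ->
    (forall x, 0 <= x <= r -> Rabs (df x) <= D * (bp x (2 - p) * bp (t - r + 2 * x) (- mu))) ->
    Rabs (f r) <= C * D * (r * (bp r (2 - p) * bp (t + r) (- mu))).
Proof.
  exists (Rpower 3 mu / (3 - p)).
  assert (I1 : 0 < / (3 - p)) by (apply Rinv_0_lt_compat; lra).
  pose proof (Rpower_pos 3 mu).
  split. { apply Rmult_lt_0_compat; lra. }
  intros r t D f df Hr HD Hf0 Hf Hb.
  assert (Q1 : bp (t - r) (- mu) <= Rpower 3 mu * bp (t + r) (- mu)).
  { rewrite <- (Ropp_involutive mu) at 2. apply bp_base_neg; try lra. unfold br. rabs. }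
  replace (f r) with (f r - f 0) by lra.
  eapply Rle_trans.
  - apply (derive_bp1 f df 0 r (D * bp (t - r) (- mu)) 0 1 (3 - p)); auto; try lra.
    intros x Hx. eapply Rle_trans; [now apply Hb |].
    replace (3 - p - 1) with (2 - p) by ring. replace (0 + 1 * x) with x by ring.
    rewrite (Rmult_comm (bp x (2 - p))), <- Rmult_assoc.
    apply Rmult_le_compat_r; [left; apply bp_pos |].
    apply Rmult_le_compat_l; auto. apply bp_anti; [lra | rabs].
  - replace (0 + 1 * 0) with 0 by ring. replace (0 + 1 * r) with r by ring.
    assert (B := prim_le_linear (3 - p) r ltac:(lra) ltac:(lra)).
    replace (3 - p - 1) with (2 - p) in B by ring.
    assert (Z : prim (3 - p) 0 = 0) by (unfold prim; now rewrite RInt_point).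
    rewrite Z. unfold Rdiv at 1. rewrite Rinv_1, Rmult_1_r, Rminus_0_r.
    apply Rle_trans with ((D * (Rpower 3 mu * bp (t + r) (- mu))) * (r * bp r (2 - p) / (3 - p))).
    + pose proof (bp_pos (t - r) (- mu)).
      assert (0 <= D * bp (t - r) (- mu)) by (apply Rmult_le_pos; lra).
      eapply Rle_trans; [apply Rmult_le_compat_l; [auto | exact B] |].
      apply Rmult_le_compat_r.
      * apply Rmult_le_pos; [| lra]. apply Rmult_le_pos; [lra | left; apply bp_pos].
      * now apply Rmult_le_compat_l.
    + right. field. lra.
Qed.

(** In this region [t] and [r] are bounded, so the target weight is bounded below and a crude
    estimate of size [r] will do; for large [r] the factor [r] is instead absorbed by
    [bp (t + r) (-1)]. *)
Lemma weight_far_small :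
  exists C, 0 < C /\ forall r t, 0 <= t <= 2 * r -> r <= 1 ->
    1 <= C * (bp (t - r) (3 - p - mu) * bp (t + r) (-1)).
Proof.
  exists (Rpower 2 (p - 3 + mu) * Rpower 4 1).
  split. { apply Rmult_lt_0_compat; apply Rpower_pos. }
  intros r t Ht Hr.
  assert (B1 : bp 0 (3 - p - mu) <= Rpower 2 (- (3 - p - mu)) * bp (t - r) (3 - p - mu)).
  { apply bp_base_neg; try lra. unfold br. rabs. }
  assert (B2 : bp 0 (-1) <= Rpower 4 (- -1) * bp (t + r) (-1)).
  { apply bp_base_neg; try lra. unfold br. rabs. }
  rewrite bp_at0 in *. replace (- (3 - p - mu)) with (p - 3 + mu) in B1 by ring.
  replace (- -1) with 1 in B2 by ring.
  replace (Rpower 2 (p - 3 + mu) * Rpower 4 1 * (bp (t - r) (3 - p - mu) * bp (t + r) (-1)))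
    with ((Rpower 2 (p - 3 + mu) * bp (t - r) (3 - p - mu)) * (Rpower 4 1 * bp (t + r) (-1))) by ring.
  rewrite <- (Rmult_1_l 1) at 1. apply Rmult_le_compat; lra.
Qed.

Lemma weight_far_large (r t : R) : 0 <= t <= 2 * r -> 1 <= r -> 1 <= 4 * (r * bp (t + r) (-1)).
Proof.
  intros Ht Hr. rewrite bp_m1.
  assert (0 < br (t + r)) by (pose proof (br_ge1 (t + r)); lra).
  apply Rmult_le_reg_r with (br (t + r)); auto.
  replace (4 * (r * / br (t + r)) * br (t + r)) with (4 * r) by (field; lra).
  unfold br. rabs.
Qed.

(* Both cases reduce to the integral of <σ>^(2-p) <T+σ>^(-μ), which is O(<T>^(3-p-μ)). *)
Lemma outgoing_far :
  exists C, 0 < C /\ forall r t D (f df : R -> R),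
    0 <= t <= 2 * r -> 0 <= D -> f 0 = 0 ->
    (forall x, is_derive f x (df x)) ->
    (forall x, 0 <= x <= Rmin r t -> Rabs (df x) <=
       D * (bp (x + Rmax (r - t) 0) (2 - p) * bp (Rabs (t - r) + 2 * x) (- mu))) ->
    Rabs (f (Rmin r t)) <= C * D * (r * (bp (t - r) (3 - p - mu) * bp (t + r) (-1))).
Proof.
  destruct weight_far_small as [C1 [HC1 HW]].
  assert (I1 : 0 < / (3 - p)) by (apply Rinv_0_lt_compat; lra).
  assert (I2 : 0 < / (p - 3 + mu)) by (apply Rinv_0_lt_compat; lra).
  exists (C1 + 4 * (/ (3 - p) + / (p - 3 + mu))).
  split; [lra |].
  intros r t D f df Ht HD Hf0 Hf Hb.
  set (W := bp (t - r) (3 - p - mu)). set (V := bp (t + r) (-1)).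
  assert (PW : 0 < W) by apply bp_pos. assert (PV : 0 < V) by apply bp_pos.
  assert (PWV : 0 <= D * (r * (W * V))).
  { apply Rmult_le_pos; auto. apply Rmult_le_pos; [lra |]. left. now apply Rmult_lt_0_compat. }
  set (m := Rmin r t) in *.
  assert (Hm : 0 <= m <= r) by (unfold m, Rmin; destruct Rle_dec; lra).
  assert (Hmt : m <= t) by (unfold m, Rmin; destruct Rle_dec; lra).
  replace (f m) with (f m - f 0) by lra.
  destruct (Rle_dec r 1) as [h | h].
  (* For [r <= 1] the derivative is at most [D] and the path has length [m <= r], which already
     supplies the factor [r]. *)
  - apply Rle_trans with (D * Rabs (m - 0)).
    + apply (derive_bound f df); auto. intros x Hx. rewrite Rmin_left, Rmax_right in Hx by lra.
      eapply Rle_trans; [now apply Hb |].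
      rewrite <- (Rmult_1_r D) at 2. apply Rmult_le_compat_l; auto.
      rewrite <- (Rmult_1_r 1).
      apply Rmult_le_compat; try (left; apply bp_pos); apply bp_le1; lra.
    + rewrite Rminus_0_r, (Rabs_right m) by lra.
      specialize (HW r t Ht h). fold W V in HW.
      apply Rle_trans with (C1 * (D * (r * (W * V)))).
      * replace (C1 * (D * (r * (W * V)))) with (D * (r * (C1 * (W * V)))) by ring.
        apply Rmult_le_compat_l; auto. rewrite <- (Rmult_1_r m). apply Rmult_le_compat; lra.
      * assert (0 <= 4 * (/ (3 - p) + / (p - 3 + mu)) * (D * (r * (W * V))))
          by (apply Rmult_le_pos; lra). lra.
  - assert (HL := weight_far_large r t Ht ltac:(lra)). fold V in HL.
    assert (Key : Rabs (f m - f 0) <= D * W * (/ (3 - p) + / (p - 3 + mu))).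
    { destruct (Rle_dec r t) as [hrt | hrt].
      - assert (Em : m = r) by (unfold m; now apply Rmin_left). rewrite Em in *.
        rewrite Rmax_right in Hb by lra.
        (* Up to [x = T] the bracket of [T + 2 * x] is replaced by that of [T], beyond it by that of
           [x]. The second integral is a convergent tail because [3 - p - mu < 0]. *)
        set (T := t - r) in *. assert (HT : 0 <= T <= r) by (unfold T; lra).
        rewrite (Rabs_right T) in Hb by lra.
        assert (S1 : Rabs (f T - f 0) <= D * bp T (- mu) * (bp T (3 - p) * / (3 - p))).
        { eapply Rle_trans.
          - apply (derive_bp1 f df 0 T (D * bp T (- mu)) 0 1 (3 - p)); auto; try lra.
            intros x Hx. eapply Rle_trans; [apply Hb; lra |].
            replace (3 - p - 1) with (2 - p) by ring. replace (0 + 1 * x) with x by ring.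
            rewrite Rplus_0_r, (Rmult_comm (bp x (2 - p))), <- Rmult_assoc.
            apply Rmult_le_compat_r; [left; apply bp_pos |].
            apply Rmult_le_compat_l; auto. apply bp_anti; [lra | rabs].
          - replace (0 + 1 * 0) with 0 by ring. replace (0 + 1 * T) with T by ring.
            assert (Z : prim (3 - p) 0 = 0) by (unfold prim; now rewrite RInt_point).
            rewrite Z. unfold Rdiv at 1. rewrite Rinv_1, Rmult_1_r, Rminus_0_r.
            apply Rmult_le_compat_l.
            + apply Rmult_le_pos; [auto | left; apply bp_pos].
            + eapply Rle_trans; [apply Rle_abs |]. apply prim_abs_pos. lra. }
        assert (S2 : Rabs (f r - f T) <= D * (bp T (3 - p - mu) * / (p - 3 + mu))).
        { eapply Rle_trans.
          - apply (derive_bp1 f df T r D 0 1 (3 - p - mu)); auto; try lra.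
            intros x Hx. eapply Rle_trans; [apply Hb; lra |].
            replace (3 - p - mu - 1) with (2 - p + - mu) by ring. replace (0 + 1 * x) with x by ring.
            rewrite Rplus_0_r, bp_plus.
            apply Rmult_le_compat_l; auto. apply Rmult_le_compat_l; [left; apply bp_pos |].
            apply bp_anti; [lra | rabs].
          - replace (0 + 1 * r) with r by ring. replace (0 + 1 * T) with T by ring.
            unfold Rdiv at 1. rewrite Rinv_1, Rmult_1_r.
            apply Rmult_le_compat_l; auto.
            replace (p - 3 + mu) with (- (3 - p - mu)) by ring.
            apply prim_diff_neg; lra. }
        replace (f r - f 0) with ((f r - f T) + (f T - f 0)) by ring.
        eapply Rle_trans; [apply Rabs_triang |].
        unfold W. replace (bp T (- mu)) with (bp T (- mu)) in S1 by ring.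
        replace (D * bp T (- mu) * (bp T (3 - p) * / (3 - p)))
          with (D * (bp T (3 - p - mu) * / (3 - p))) in S1.
        2: { replace (3 - p - mu) with (3 - p + - mu) by ring. rewrite bp_plus. ring. }
        lra.
      - assert (Em : m = t) by (unfold m; apply Rmin_right; lra). rewrite Em in *.
        rewrite Rmax_left in Hb by lra. rewrite (Rabs_left1 (t - r)) in Hb by lra.
        assert (S2 : Rabs (f t - f 0) <= D * (bp (r - t) (3 - p - mu) * / (p - 3 + mu))).
        { eapply Rle_trans.
          - apply (derive_bp1 f df 0 t D (r - t) 1 (3 - p - mu)); auto; try lra.
            intros x Hx. eapply Rle_trans; [apply Hb; lra |].
            replace (3 - p - mu - 1) with (2 - p + - mu) by ring.
            replace (r - t + 1 * x) with (x + (r - t)) by ring.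
            rewrite bp_plus.
            apply Rmult_le_compat_l; auto. apply Rmult_le_compat_l; [left; apply bp_pos |].
            apply bp_anti; [lra | rabs].
          - replace (r - t + 1 * t) with r by ring. replace (r - t + 1 * 0) with (r - t) by ring.
            unfold Rdiv at 1. rewrite Rinv_1, Rmult_1_r.
            apply Rmult_le_compat_l; auto.
            replace (p - 3 + mu) with (- (3 - p - mu)) by ring.
            apply prim_diff_neg; lra. }
        rewrite <- (bp_opp (r - t)) in S2. replace (- (r - t)) with (t - r) in S2 by ring.
        fold W in S2.
        assert (0 <= D * W * / (3 - p)) by (repeat apply Rmult_le_pos; lra). lra. }
    eapply Rle_trans; [exact Key |].
    apply Rle_trans with (D * W * (/ (3 - p) + / (p - 3 + mu)) * (4 * (r * V))).
    + rewrite <- (Rmult_1_r (D * W * (/ (3 - p) + / (p - 3 + mu)))) at 1.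
      apply Rmult_le_compat_l; auto. repeat apply Rmult_le_pos; lra.
    + assert (0 <= C1 * (D * (r * (W * V)))) by (apply Rmult_le_pos; lra). lra.
Qed.

End FirstKernel.

(** * One-dimensional estimates for the source |v|^q *)

(* Reciprocal of the weight [w2], with [br x = 1 + |x|] in place of [jb x]. *)
Definition iw2 (p mu t r : R) : R :=
  if Rlt_dec r (t / 2)
  then bp r (2 - p) * bp (t + r) (- mu)
  else bp (t - r) (3 - p - mu) * bp (t + r) (-1).

Lemma iw2_pos (p mu t r : R) : 0 < iw2 p mu t r.
Proof. unfold iw2. destruct Rlt_dec; apply Rmult_lt_0_compat; apply bp_pos. Qed.

Lemma Rpower_iw2 (p mu t r a : R) :
  Rpower (iw2 p mu t r) a =
  if Rlt_dec r (t / 2)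
  then bp r ((2 - p) * a) * bp (t + r) (- mu * a)
  else bp (t - r) ((3 - p - mu) * a) * bp (t + r) (- a).
Proof.
  unfold iw2. destruct Rlt_dec; rewrite <- Rpower_mult_distr by apply bp_pos;
    rewrite !Rpower_bp; auto.
  do 2 f_equal. ring.
Qed.

Section SecondKernel.
Variables p mu q : R.
Hypotheses (Hq : 2 < q) (Hp : 2 < p) (Hp3 : p < 3) (Hmu : 3 - p < mu) (Hmu1 : mu < 1)
  (Hpq : p * (2 - (p - 2) * q) < (p * q - 1) * mu).

(* [ka] and [ka'] are chosen so that both terms of [majorant2] integrate to [<al>^(-nu)]. *)
Let nu := mu / p.
Let ka := mu * q - nu.
Let ka' := q - 1 - nu.

Local Lemma nu_bounds : 0 < nu < 1.
Proof.
  unfold nu. split; [apply Rdiv_lt_0_compat; lra |].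
  apply Rmult_lt_reg_r with p; [lra |]. unfold Rdiv. rewrite Rmult_assoc, Rinv_l; lra.
Qed.

Local Lemma ka_lower : 2 - (p - 2) * q <= ka.
Proof.
  apply Rmult_le_reg_l with p; [lra |]. unfold ka, nu.
  replace (p * (mu * q - mu / p)) with ((p * q - 1) * mu) by (field; lra). lra.
Qed.

Local Lemma ka_pos : 0 < ka.
Proof.
  unfold ka, nu. apply Rmult_lt_reg_l with p; [lra |].
  replace (p * (mu * q - mu / p)) with ((p * q - 1) * mu) by (field; lra).
  rewrite Rmult_0_r. apply Rmult_lt_0_compat; [nra | lra].
Qed.

Local Lemma ka'_pos : 0 < ka'.
Proof. pose proof nu_bounds. unfold ka'. lra. Qed.

(** The same inequality as [ka_lower] in disguise: both say [2 + nu <= (p - 2 + mu) * q]. A single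
    condition therefore serves the interior region and the region near the cone. *)
Local Lemma ka'_lower : 1 - (p - 3 + mu) * q <= ka'.
Proof. pose proof ka_lower. unfold ka, ka' in *. lra. Qed.

(** One term for each branch of [iw2], raised to the power [q] and multiplied by the radius, along
    [s + y = al]. The exponent of the varying bracket is enlarged to [ka - 1], respectively
    [ka' - 1]. *)
Definition majorant2 (al la : R) : R :=
  bp al (- mu * q) * bp la (ka - 1) + bp al (1 - q) * bp (al - 2 * la) (ka' - 1).

(** The bound on [v] is the stronger one, so a factor [|v|] may always be downgraded to the weight
    of [r ∂_r v]. This puts both terms of the derivative of [r |v|^q] under one weight. *)
Lemma iw2_le_iw3 (s la : R) : 0 <= s -> 0 <= la -> iw2 p mu s la <= bp (s - la) (- mu).
Proof.
  intros Hs Hla. unfold iw2. destruct Rlt_dec as [h | h].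
  - apply Rle_trans with (1 * bp (s + la) (- mu)).
    + apply Rmult_le_compat_r; [left; apply bp_pos | apply bp_le1; lra].
    + rewrite Rmult_1_l. apply bp_anti; [lra | rabs].
  - apply Rle_trans with (bp (s - la) (3 - p - mu) * bp (s - la) (-1)).
    + apply Rmult_le_compat_l; [left; apply bp_pos | apply bp_anti; [lra | rabs]].
    + rewrite <- bp_plus. apply bp_exp_le. lra.
Qed.

Lemma majorant2_value (al la : R) :
  0 <= la <= al -> br la * Rpower (iw2 p mu (al - la) la) q <= majorant2 al la.
Proof.
  intros H. rewrite Rpower_iw2, <- bp_1. unfold majorant2.
  pose proof ka_lower. pose proof ka'_lower.
  replace (al - la + la) with al by ring. replace (al - la - la) with (al - 2 * la) by ring.
  assert (P1 := bp_pos al (- mu * q)). assert (P2 := bp_pos la (ka - 1)).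
  assert (P3 := bp_pos al (1 - q)). assert (P4 := bp_pos (al - 2 * la) (ka' - 1)).
  assert (Q1 := Rmult_lt_0_compat _ _ P1 P2). assert (Q2 := Rmult_lt_0_compat _ _ P3 P4).
  destruct Rlt_dec as [h | h].
  - apply Rle_trans with (bp al (- mu * q) * bp la (ka - 1)); [| lra].
    rewrite <- Rmult_assoc, <- bp_plus, Rmult_comm.
    apply Rmult_le_compat_l; [lra |]. apply bp_exp_le. lra.
  - apply Rle_trans with (bp al (1 - q) * bp (al - 2 * la) (ka' - 1)); [| lra].
    replace (1 - q) with (1 + - q) by ring. rewrite bp_plus.
    apply Rle_trans with (bp al 1 * (bp (al - 2 * la) (ka' - 1) * bp al (- q))); [| right; ring].
    apply Rmult_le_compat.
    + left; apply bp_pos.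
    + apply Rmult_le_pos; left; apply bp_pos.
    + apply bp_mono; [lra | rabs].
    + apply Rmult_le_compat_r; [left; apply bp_pos |]. apply bp_exp_le. lra.
Qed.

(** Against the weight in [majorant2_value], one factor [br la * iw2] has been exchanged for the
    weight of [r ∂_r v]. In the interior region the exchange loses nothing, since there the cone
    bracket is comparable to [al] and [br la * bp la (2 - p) >= 1] by [p < 3]. *)
Lemma majorant2_deriv :
  exists C, 0 < C /\ forall al la, 0 <= la <= al ->
    Rpower (iw2 p mu (al - la) la) (q - 1) * bp (al - 2 * la) (- mu) <= C * majorant2 al la.
Proof.
  exists (Rpower 3 mu + 1). pose proof (Rpower_pos 3 mu). split; [lra |].
  intros al la Hla. rewrite Rpower_iw2. unfold majorant2.
  pose proof ka_lower. pose proof ka'_lower.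
  replace (al - la + la) with al by ring. replace (al - la - la) with (al - 2 * la) by ring.
  assert (P1 := bp_pos al (- mu * q)). assert (P2 := bp_pos la (ka - 1)).
  assert (P3 := bp_pos al (1 - q)). assert (P4 := bp_pos (al - 2 * la) (ka' - 1)).
  assert (Q1 := Rmult_lt_0_compat _ _ P1 P2). assert (Q2 := Rmult_lt_0_compat _ _ P3 P4).
  destruct Rlt_dec as [h | h].
  - apply Rle_trans with (Rpower 3 mu * (bp al (- mu * q) * bp la (ka - 1))).
    + assert (B : bp (al - 2 * la) (- mu) <= Rpower 3 mu * bp al (- mu)).
      { rewrite <- (Ropp_involutive mu) at 2. apply bp_base_neg; try lra. unfold br. rabs. }
      replace (- mu * q) with (- mu * (q - 1) + - mu) by ring.
      rewrite (bp_plus al).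
      apply Rle_trans with (bp la (ka - 1) * bp al (- mu * (q - 1)) * (Rpower 3 mu * bp al (- mu)));
        [| right; ring].
      apply Rmult_le_compat; auto.
      * apply Rmult_le_pos; left; apply bp_pos.
      * left; apply bp_pos.
      * apply Rmult_le_compat_r; [left; apply bp_pos |]. apply bp_exp_le. lra.
    + assert (0 <= Rpower 3 mu * (bp al (1 - q) * bp (al - 2 * la) (ka' - 1)))
        by (apply Rmult_le_pos; lra). lra.
  - apply Rle_trans with (bp al (1 - q) * bp (al - 2 * la) (ka' - 1)).
    + replace (- (q - 1)) with (1 - q) by ring.
      rewrite (Rmult_comm _ (bp al (1 - q))), Rmult_assoc, <- bp_plus.
      apply Rmult_le_compat_l; [lra |]. apply bp_exp_le. lra.
    + assert (0 <= Rpower 3 mu * (bp al (1 - q) * bp (al - 2 * la) (ka' - 1)))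
        by (apply Rmult_le_pos; lra).
      assert (0 <= Rpower 3 mu * (bp al (- mu * q) * bp la (ka - 1)))
        by (apply Rmult_le_pos; lra). lra.
Qed.

Lemma kernel2_outgoing :
  exists C, 0 < C /\ forall A (h : R -> R) al tau,
    0 <= tau <= al -> 0 <= A -> (forall s, continuous h s) ->
    (forall s, 0 <= s <= tau -> Rabs (h s) <= A * majorant2 al (al - s)) ->
    Rabs (RInt h 0 tau) <= C * A * bp al (- nu).
Proof.
  pose proof ka_pos as K1. pose proof ka'_pos as K2.
  assert (I1 : 0 < / ka) by (apply Rinv_0_lt_compat; lra).
  assert (I2 : 0 < / ka') by (apply Rinv_0_lt_compat; lra).
  exists (/ ka + / ka'). split; [lra |].
  intros A h al tau Ht HA Hh Hb.
  eapply Rle_trans.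
  - apply (RInt_bp2 h 0 tau (A * bp al (- mu * q)) al (-1) ka (A * bp al (1 - q)) (- al) 2 ka');
      auto; try lra.
    intros s Hs. eapply Rle_trans; [now apply Hb |]. unfold majorant2.
    replace (al - 2 * (al - s)) with (2 * s - al) by ring.
    replace (al + -1 * s) with (al - s) by ring. replace (- al + 2 * s) with (2 * s - al) by ring.
    right; ring.
  - replace (al + -1 * tau) with (al - tau) by ring. replace (al + -1 * 0) with al by ring.
    replace (- al + 2 * tau) with (2 * tau - al) by ring. replace (- al + 2 * 0) with (- al) by ring.
    assert (B1 : prim ka al - prim ka (al - tau) <= bp al ka * / ka).
    { rewrite !prim_nonneg_eq by lra.
      apply Rle_trans with ((bp al ka - bp (al - tau) ka) * / ka); [right; unfold Rdiv; ring |].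
      apply Rmult_le_compat_r; [lra |]. pose proof (bp_pos (al - tau) ka). lra. }
    assert (B2 := prim_abs_pos ka' (2 * tau - al) K2).
    assert (B3 := prim_abs_pos ka' (- al) K2). rewrite bp_opp in B3.
    assert (B4 := bp_mono (2 * tau - al) al ka' ltac:(lra) ltac:(rabs)).
    assert (B5 : (prim ka' (2 * tau - al) - prim ka' (- al)) / 2 <= bp al ka' * / ka').
    { assert (bp (2 * tau - al) ka' / ka' <= bp al ka' / ka')
        by (apply Rmult_le_compat_r; lra).
      pose proof (Rle_abs (prim ka' (2 * tau - al))).
      pose proof (Rle_abs (- prim ka' (- al))). rewrite Rabs_Ropp in *. lra. }
    replace (A * bp al (- mu * q) / -1 * (prim ka (al - tau) - prim ka al)
              + A * bp al (1 - q) / 2 * (prim ka' (2 * tau - al) - prim ka' (- al)))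
      with (A * (bp al (- mu * q) * (prim ka al - prim ka (al - tau))
              + bp al (1 - q) * ((prim ka' (2 * tau - al) - prim ka' (- al)) / 2))) by field.
    apply Rle_trans with (A * (bp al (- mu * q) * (bp al ka * / ka)
              + bp al (1 - q) * (bp al ka' * / ka'))).
    + apply Rmult_le_compat_l; auto.
      apply Rplus_le_compat; apply Rmult_le_compat_l; auto; left; apply bp_pos.
    + rewrite <- (Rmult_assoc (bp al (- mu * q))), <- (Rmult_assoc (bp al (1 - q))).
      rewrite <- !bp_plus.
      replace (- mu * q + ka) with (- nu) by (unfold ka; ring).
      replace (1 - q + ka') with (- nu) by (unfold ka'; ring).
      right; ring.
Qed.

(** Here [2 * s - T >= |T|], and because [q > 2] the integral of the power [1 - q] is of order
    [bp T (2 - q)]. By [ka'_lower] the exponents of [bp T] then add up to at most [- nu]. *)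
Local Lemma far_part (A a b T : R) (h : R -> R) :
  0 <= a <= b -> T <= a -> 0 <= A ->
  A * bp T (- ((p - 3 + mu) * q)) / 2 * (prim (2 - q) (- T + 2 * b) - prim (2 - q) (- T + 2 * a))
  <= / (q - 2) * A * bp T (- nu).
Proof.
  intros Ha HT HA.
  assert (I : 0 < / (q - 2)) by (apply Rinv_0_lt_compat; lra).
  assert (B := prim_diff_neg (2 - q) (- T + 2 * a) (- T + 2 * b) ltac:(lra) ltac:(lra)).
  replace (- (2 - q)) with (q - 2) in B by ring.
  assert (B2 : bp (- T + 2 * a) (2 - q) <= bp T (2 - q)) by (apply bp_anti; [lra | rabs]).
  assert (B3 : bp T (- ((p - 3 + mu) * q)) * bp T (2 - q) <= bp T (- nu)).
  { rewrite <- bp_plus. apply bp_exp_le. pose proof ka'_lower. unfold ka' in *. lra. }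
  pose proof (bp_pos T (- ((p - 3 + mu) * q))) as P. pose proof (bp_pos T (- nu)).
  apply Rle_trans with (A * bp T (- ((p - 3 + mu) * q)) / 2 * (bp T (2 - q) * / (q - 2))).
  - apply Rmult_le_compat_l.
    + apply Rmult_le_pos; [apply Rmult_le_pos; lra | lra].
    + eapply Rle_trans; [exact B |]. apply Rmult_le_compat_r; lra.
  - replace (A * bp T (- ((p - 3 + mu) * q)) / 2 * (bp T (2 - q) * / (q - 2)))
      with (/ (q - 2) * A * (/ 2 * (bp T (- ((p - 3 + mu) * q)) * bp T (2 - q)))) by (field; lra).
    apply Rmult_le_compat_l; [apply Rmult_le_pos; lra | ].
    lra.
Qed.

Local Lemma incoming_far_pointwise (s T : R) :
  0 <= s -> T <= s -> ~ (s - T < s / 2) ->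
  br (s - T) * Rpower (iw2 p mu s (s - T)) q
  <= bp T (- ((p - 3 + mu) * q)) * bp (- T + 2 * s) (2 - q - 1).
Proof.
  intros Hs HT Hn. rewrite Rpower_iw2. destruct Rlt_dec; [contradiction |].
  replace (s - (s - T)) with T by ring. replace (s + (s - T)) with (- T + 2 * s) by ring.
  replace ((3 - p - mu) * q) with (- ((p - 3 + mu) * q)) by ring.
  replace (2 - q - 1) with (1 + - q) by ring. rewrite bp_plus, <- bp_1.
  rewrite (Rmult_comm (bp (s - T) 1)), Rmult_assoc.
  apply Rmult_le_compat_l; [left; apply bp_pos |].
  rewrite Rmult_comm. apply Rmult_le_compat_r; [left; apply bp_pos |].
  apply bp_mono; [lra | rabs].
Qed.

Local Lemma incoming_near_pointwise (s T : R) :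
  0 <= s -> T <= s -> s - T < s / 2 ->
  br (s - T) * Rpower (iw2 p mu s (s - T)) q
  <= bp T (- mu * q) * bp (- T + 1 * s) (ka - 1).
Proof.
  intros Hs HT Hn. rewrite Rpower_iw2. destruct Rlt_dec; [| contradiction].
  replace (- T + 1 * s) with (s - T) by ring.
  rewrite <- bp_1, <- Rmult_assoc, <- bp_plus, (Rmult_comm (bp T (- mu * q))).
  pose proof ka_lower.
  apply Rmult_le_compat; try (left; apply bp_pos).
  - apply bp_exp_le. lra.
  - apply bp_anti; [nra | rabs].
Qed.

(** With [s - y = T] fixed, the interior region [s - T < s / 2] means [s < 2 * T]: it is met only
    for positive [T], and there the radius stays below [T]. Beyond [2 * T] the cone weight
    applies. *)
Lemma kernel2_incoming_right :
  exists C, 0 < C /\ forall A (h : R -> R) a t T,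
    0 <= a <= t -> T <= a -> 0 <= A -> (forall s, continuous h s) ->
    (forall s, a <= s <= t -> Rabs (h s) <= A * (br (s - T) * Rpower (iw2 p mu s (s - T)) q)) ->
    Rabs (RInt h a t) <= C * A * bp T (- nu).
Proof.
  pose proof ka_pos as K1.
  assert (I1 : 0 < / ka) by (apply Rinv_0_lt_compat; lra).
  assert (I2 : 0 < / (q - 2)) by (apply Rinv_0_lt_compat; lra).
  exists (/ ka + 2 * / (q - 2)). split; [lra |].
  intros A h a t T Ha HT HA Hh Hb.
  pose proof (bp_pos T (- nu)) as PT.
  assert (PA : 0 <= A * bp T (- nu)) by (apply Rmult_le_pos; lra).
  assert (Far : forall b, a <= b <= t -> 2 * T <= b ->
            Rabs (RInt h b t) <= / (q - 2) * A * bp T (- nu)).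
  { intros b Hb1 Hb2. eapply Rle_trans.
    - apply (RInt_bp1 h b t (A * bp T (- ((p - 3 + mu) * q))) (- T) 2 (2 - q)); auto; try lra.
      intros s Hs. eapply Rle_trans; [apply Hb; lra |]. rewrite (Rmult_assoc A).
      apply Rmult_le_compat_l; auto. apply incoming_far_pointwise; lra.
    - apply far_part; auto; lra. }
  destruct (Rle_dec (2 * T) a) as [c | c].
  - eapply Rle_trans; [apply (Far a); lra |].
    assert (0 <= (/ ka + / (q - 2)) * (A * bp T (- nu))) by (apply Rmult_le_pos; lra). lra.
  - assert (HTp : 0 < T) by lra.
    (* At [s = 2 * T] the weight takes the branch near the cone, so the bound on the closed interval
       carries both terms. This accounts for the factor 2 in front of [/ (q - 2)]. *)
    assert (Near : forall b, a <= b <= t -> b <= 2 * T ->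
       Rabs (RInt h a b) <= / ka * A * bp T (- nu) + / (q - 2) * A * bp T (- nu)).
    { intros b Hb1 Hb2. eapply Rle_trans.
      - apply (RInt_bp2 h a b (A * bp T (- mu * q)) (- T) 1 ka
                 (A * bp T (- ((p - 3 + mu) * q))) (- T) 2 (2 - q)); auto; try lra.
        intros s Hs. eapply Rle_trans; [apply Hb; lra |].
        rewrite !(Rmult_assoc A), <- Rmult_plus_distr_l. apply Rmult_le_compat_l; auto.
        assert (0 <= bp T (- mu * q) * bp (- T + 1 * s) (ka - 1))
          by (apply Rmult_le_pos; left; apply bp_pos).
        assert (0 <= bp T (- ((p - 3 + mu) * q)) * bp (- T + 2 * s) (2 - q - 1))
          by (apply Rmult_le_pos; left; apply bp_pos).
        destruct (Rlt_dec (s - T) (s / 2)) as [h1 | h1].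
        + pose proof (incoming_near_pointwise s T ltac:(lra) ltac:(lra) h1). lra.
        + pose proof (incoming_far_pointwise s T ltac:(lra) ltac:(lra) h1). lra.
      - apply Rplus_le_compat; [| apply far_part; auto; lra].
        replace (- T + 1 * b) with (b - T) by ring. replace (- T + 1 * a) with (a - T) by ring.
        assert (B1 : prim ka (b - T) - prim ka (a - T) <= bp T ka * / ka).
        { rewrite !prim_nonneg_eq by lra.
          apply Rle_trans with ((bp (b - T) ka - bp (a - T) ka) * / ka); [right; unfold Rdiv; ring |].
          apply Rmult_le_compat_r; [lra |]. pose proof (bp_pos (a - T) ka).
          assert (bp (b - T) ka <= bp T ka) by (apply bp_mono; [lra | rabs]). lra. }
        unfold Rdiv at 1. rewrite Rinv_1, Rmult_1_r.
        apply Rle_trans with (A * bp T (- mu * q) * (bp T ka * / ka)).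
        + apply Rmult_le_compat_l; auto. apply Rmult_le_pos; [auto | left; apply bp_pos].
        + rewrite <- !Rmult_assoc, (Rmult_assoc A), <- bp_plus.
          replace (- mu * q + ka) with (- nu) by (unfold ka; ring). right; ring. }
    destruct (Rle_dec t (2 * T)) as [d | d].
    + eapply Rle_trans; [apply (Near t); lra |].
      assert (0 <= / (q - 2) * (A * bp T (- nu))) by (apply Rmult_le_pos; lra). lra.
    + rewrite <- (RInt_Chasles (V := R_CompleteNormedModule) h a (2 * T) t)
        by now apply ex_RInt_cont.
      eapply Rle_trans; [apply Rabs_triang |].
      pose proof (Near (2 * T) ltac:(lra) ltac:(lra)).
      pose proof (Far (2 * T) ltac:(lra) ltac:(lra)). lra.
Qed.

Lemma kernel2_incoming :
  exists C, 0 < C /\ forall A (h : R -> R) t T,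
    0 <= t -> T <= t -> 0 <= A -> (forall s, continuous h s) ->
    (forall s, 0 <= s <= t -> Rabs (h s) <=
        A * (br (s - T) * Rpower (iw2 p mu s (Rabs (s - T))) q)) ->
    Rabs (RInt h 0 t) <= C * A * bp T (- nu).
Proof.
  destruct kernel2_incoming_right as [C1 [HC1 H1]].
  destruct kernel2_outgoing as [C2 [HC2 H2]].
  exists (C1 + C2). split; [lra |].
  intros A h t T Ht HT HA Hh Hb.
  assert (PA : 0 <= A * bp T (- nu)) by (apply Rmult_le_pos; [lra | left; apply bp_pos]).
  assert (Rt : forall a, 0 <= a <= t -> T <= a -> Rabs (RInt h a t) <= C1 * A * bp T (- nu)).
  { intros a Ha HTa. apply H1; auto. intros s Hs. eapply Rle_trans; [apply Hb; lra |].
    rewrite (Rabs_right (s - T)) by lra. lra. }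
  destruct (Rle_dec T 0) as [c | c].
  - eapply Rle_trans; [apply Rt; lra |].
    assert (0 <= C2 * (A * bp T (- nu))) by (apply Rmult_le_pos; lra). lra.
  - rewrite <- (RInt_Chasles (V := R_CompleteNormedModule) h 0 T t) by now apply ex_RInt_cont.
    eapply Rle_trans; [apply Rabs_triang |].
    pose proof (Rt T ltac:(lra) ltac:(lra)).
    assert (Rabs (RInt h 0 T) <= C2 * A * bp T (- nu)); [| lra].
    apply H2; auto; [lra |]. intros s Hs. eapply Rle_trans; [apply Hb; lra |].
    apply Rmult_le_compat_l; auto.
    rewrite (Rabs_left1 (s - T)) by lra. replace (- (s - T)) with (T - s) by ring.
    rewrite <- bp_1, <- bp_opp, bp_1. replace (- (s - T)) with (T - s) by ring.
    replace s with (T - (T - s)) at 2 by ring. apply majorant2_value. lra.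
Qed.

(** The derivative source lacks a good decay in the radius, whence the restriction [t - T <= 1]:
    after leaving the axis the path has length at most 1, and the pointwise bound
    [bp T (- mu * q) <= bp T (- nu)] suffices. Before the axis the reflected path is handled by
    [kernel2_outgoing]. *)
Lemma kernel2_deriv_incoming :
  exists C, 0 < C /\ forall A (h : R -> R) t T,
    0 <= t -> T <= t -> t - T <= 1 -> 0 <= A -> (forall s, continuous h s) ->
    (forall s, 0 <= s <= t -> Rabs (h s) <=
        A * (Rpower (iw2 p mu s (Rabs (s - T))) (q - 1) * bp (s - Rabs (s - T)) (- mu))) ->
    Rabs (RInt h 0 t) <= C * A * bp T (- nu).
Proof.
  destruct majorant2_deriv as [C1 [HC1 H1]].
  destruct kernel2_outgoing as [C2 [HC2 H2]].
  exists (1 + C2 * C1). split. { assert (0 < C2 * C1) by now apply Rmult_lt_0_compat. lra. }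
  intros A h t T Ht HT HtT HA Hh Hb.
  assert (PA : 0 <= A * bp T (- nu)) by (apply Rmult_le_pos; [lra | left; apply bp_pos]).
  assert (Rt : forall a, 0 <= a <= t -> T <= a -> Rabs (RInt h a t) <= A * bp T (- nu)).
  { intros a Ha HTa. eapply Rle_trans.
    - apply (RInt_abs_bound h a t (A * bp T (- nu))); auto.
      intros s. rewrite Rmin_left, Rmax_right by lra. intros Hs.
      eapply Rle_trans; [apply Hb; lra |]. apply Rmult_le_compat_l; auto.
      rewrite (Rabs_right (s - T)) by lra.
      assert (B := iw2_le_iw3 s (s - T) ltac:(lra) ltac:(lra)).
      replace (s - (s - T)) with T in * by ring.
      assert (B2 : Rpower (iw2 p mu s (s - T)) (q - 1) <= bp T (- mu * (q - 1))).
      { rewrite <- Rpower_bp. apply Rle_Rpower_l; [lra |]. split; [apply iw2_pos | exact B]. }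
      apply Rle_trans with (bp T (- mu * (q - 1)) * bp T (- mu)).
      + apply Rmult_le_compat_r; [left; apply bp_pos | exact B2].
      + rewrite <- bp_plus. apply bp_exp_le. pose proof ka_pos. unfold ka in *. lra.
    - rewrite Rabs_right by lra. rewrite <- (Rmult_1_r (A * bp T (- nu))) at 2.
      apply Rmult_le_compat_l; lra. }
  destruct (Rle_dec T 0) as [c | c].
  - eapply Rle_trans; [apply Rt; lra |].
    assert (0 <= C2 * C1 * (A * bp T (- nu))) by (apply Rmult_le_pos; [apply Rmult_le_pos |]; lra). lra.
  - rewrite <- (RInt_Chasles (V := R_CompleteNormedModule) h 0 T t) by now apply ex_RInt_cont.
    eapply Rle_trans; [apply Rabs_triang |].
    pose proof (Rt T ltac:(lra) ltac:(lra)).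
    assert (Rabs (RInt h 0 T) <= C2 * (A * C1) * bp T (- nu)); [| lra].
    apply H2; auto; [lra | apply Rmult_le_pos; lra |].
    intros s Hs. eapply Rle_trans; [apply Hb; lra |].
    rewrite Rmult_assoc. apply Rmult_le_compat_l; auto.
    rewrite (Rabs_left1 (s - T)) by lra. replace (- (s - T)) with (T - s) by ring.
    replace (s - (T - s)) with (T - 2 * (T - s)) by ring.
    replace s with (T - (T - s)) at 1 by ring. apply H1. lra.
Qed.

End SecondKernel.

(** * Radial Duhamel operators *)

(** The inner integral of the Duhamel formula is a difference of two values of [Gam], which turns
    the double integral into integrals along the two backward characteristics. *)
Definition Gam (G : R -> R -> R) (s x : R) : R := RInt (G s) 0 x.

Lemma cont2_Gam (G : R -> R -> R) : cont2 G -> cont2 (Gam G).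
Proof.
  intros HG.
  assert (H : cont2 (fun s y => G y s)) by cnt.
  apply cont2_RInt_param in H.
  intros z. apply (cont2_app _ (fun z => snd z) (fun z => fst z) z H); cnt.
Qed.

Lemma is_derive_Gam (G : R -> R -> R) (s y : R) : cont2 G -> is_derive (Gam G s) y (G s y).
Proof. intros HG. apply (is_derive_RInt_cont (G s)). intros; cnt. Qed.

(* For [G = ρ F], [r LF = cminus (Gam G)], with [∂_t] equal to [cplus G] and [∂_r] equal to [cminus G]. *)
Definition cplus (K : R -> R -> R) (t r : R) : R := (charint 1 K t r + charint (-1) K t r) / 2.
Definition cminus (K : R -> R -> R) (t r : R) : R := (charint 1 K t r - charint (-1) K t r) / 2.

Lemma cont2_cplus (K : R -> R -> R) : cont2 K -> cont2 (cplus K).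
Proof.
  intros H. pose proof (cont2_charint 1 K H). pose proof (cont2_charint (-1) K H).
  unfold cplus. intros z.
  apply continuous_Rmult; [apply continuous_Rplus; [apply H0 | apply H1] | cnt].
Qed.

Lemma cont2_cminus (K : R -> R -> R) : cont2 K -> cont2 (cminus K).
Proof.
  intros H. pose proof (cont2_charint 1 K H). pose proof (cont2_charint (-1) K H).
  unfold cminus. intros z.
  apply continuous_Rmult; [apply continuous_Rminus; [apply H0 | apply H1] | cnt].
Qed.

Section CharDerivatives.
Variables K k : R -> R -> R.
Hypotheses (HK : cont2 K) (Hk : cont2 k) (HKk : forall s y, is_derive (K s) y (k s y)).

Lemma is_derive_cminus_line (a b c d x : R) :
  is_derive (fun x => cminus K (a + b * x) (c + d * x)) x
    (((d + b) * charint 1 k (a + b * x) (c + d * x)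
      - (d - b) * charint (-1) k (a + b * x) (c + d * x)) / 2).
Proof.
  pose proof (is_derive_charint 1 a b c d K k x HK Hk HKk) as D1.
  pose proof (is_derive_charint (-1) a b c d K k x HK Hk HKk) as D2.
  pose proof (is_derive_scal _ _ (/ 2) _ (is_derive_minus _ _ _ _ _ D1 D2)) as D.
  eapply is_derive_ext; [| apply (is_derive_eq _ _ _ _ D)].
  - intros y. unfold cminus, minus, plus, opp, scal; simpl. unfold mult; simpl. field.
  - unfold minus, plus, opp, scal; simpl. unfold mult; simpl. field.
Qed.

Lemma is_derive_cplus_line (a b c d x : R) :
  is_derive (fun x => cplus K (a + b * x) (c + d * x)) x
    (b * K (a + b * x) (c + d * x) +
    ((d + b) * charint 1 k (a + b * x) (c + d * x)
      + (d - b) * charint (-1) k (a + b * x) (c + d * x)) / 2).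
Proof.
  pose proof (is_derive_charint 1 a b c d K k x HK Hk HKk) as D1.
  pose proof (is_derive_charint (-1) a b c d K k x HK Hk HKk) as D2.
  pose proof (is_derive_scal _ _ (/ 2) _ (is_derive_plus _ _ _ _ _ D1 D2)) as D.
  eapply is_derive_ext; [| apply (is_derive_eq _ _ _ _ D)].
  - intros y. unfold cplus, minus, plus, opp, scal; simpl. unfold mult; simpl. field.
  - unfold minus, plus, opp, scal; simpl. unfold mult; simpl. field.
Qed.

Lemma is_derive_cminus_t (t r : R) : is_derive (fun t => cminus K t r) t (cplus k t r).
Proof.
  pose proof (is_derive_cminus_line 0 1 r 0 t) as D.
  replace (cplus k t r) with
    (((0 + 1) * charint 1 k (0 + 1 * t) (r + 0 * t)
      - (0 - 1) * charint (-1) k (0 + 1 * t) (r + 0 * t)) / 2).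
  - eapply is_derive_ext; [| exact D]. intros y; cbv beta. f_equal; ring.
  - replace (0 + 1 * t) with t by ring. replace (r + 0 * t) with r by ring. unfold cplus. field.
Qed.

Lemma is_derive_cminus_r (t r : R) : is_derive (cminus K t) r (cminus k t r).
Proof.
  pose proof (is_derive_cminus_line t 0 0 1 r) as D.
  replace (cminus k t r) with
    (((1 + 0) * charint 1 k (t + 0 * r) (0 + 1 * r)
      - (1 - 0) * charint (-1) k (t + 0 * r) (0 + 1 * r)) / 2).
  - eapply is_derive_ext; [| exact D]. intros y; cbv beta. f_equal; ring.
  - replace (0 + 1 * r) with r by ring. replace (t + 0 * r) with t by ring. unfold cminus. field.
Qed.

Lemma is_derive_cplus_t (t r : R) : is_derive (fun t => cplus K t r) t (K t r + cminus k t r).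
Proof.
  pose proof (is_derive_cplus_line 0 1 r 0 t) as D.
  replace (K t r + cminus k t r) with
    (1 * K (0 + 1 * t) (r + 0 * t) + ((0 + 1) * charint 1 k (0 + 1 * t) (r + 0 * t)
      + (0 - 1) * charint (-1) k (0 + 1 * t) (r + 0 * t)) / 2).
  - eapply is_derive_ext; [| exact D]. intros y; cbv beta. f_equal; ring.
  - replace (0 + 1 * t) with t by ring. replace (r + 0 * t) with r by ring. unfold cminus. field.
Qed.

Lemma is_derive_cplus_r (t r : R) : is_derive (cplus K t) r (cplus k t r).
Proof.
  pose proof (is_derive_cplus_line t 0 0 1 r) as D.
  replace (cplus k t r) with
    (0 * K (t + 0 * r) (0 + 1 * r) + ((1 + 0) * charint 1 k (t + 0 * r) (0 + 1 * r)
      + (1 - 0) * charint (-1) k (t + 0 * r) (0 + 1 * r)) / 2).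
  - eapply is_derive_ext; [| exact D]. intros y; cbv beta. f_equal; ring.
  - replace (0 + 1 * r) with r by ring. replace (t + 0 * r) with t by ring. unfold cplus. field.
Qed.

(** [r - t] is constant in the outgoing direction, so the family of label [r - t] contributes
    nothing and a single characteristic integral of the source remains. *)
Lemma is_derive_cminus_outgoing (a c x : R) :
  is_derive (fun x => cminus K (a + x) (c + x)) x (charint 1 k (a + x) (c + x)).
Proof.
  pose proof (is_derive_cminus_line a 1 c 1 x) as D.
  replace (charint 1 k (a + x) (c + x)) with
    (((1 + 1) * charint 1 k (a + 1 * x) (c + 1 * x)
      - (1 - 1) * charint (-1) k (a + 1 * x) (c + 1 * x)) / 2).
  - eapply is_derive_ext; [| exact D]. intros y; cbv beta. f_equal; ring.
  - rewrite !Rmult_1_l. field.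
Qed.

End CharDerivatives.

(** * Parity, differences, and division by the radius *)

Definition odd_r (G : R -> R -> R) : Prop := forall s y, G s (- y) = - G s y.
Definition even_r (G : R -> R -> R) : Prop := forall s y, G s (- y) = G s y.

(** Reflection in the axis exchanges the two families of characteristics; all parity statements
    below come from this. *)
Lemma charint_odd (sg t r : R) (K : R -> R -> R) :
  cont2 K -> odd_r K -> charint sg K t (- r) = - charint (- sg) K t r.
Proof.
  intros HK HO. unfold charint.
  rewrite <- (RInt_opp (V := R_CompleteNormedModule)).
  - apply RInt_ext. intros s _. rewrite <- HO. f_equal. ring.
  - apply ex_RInt_cont. intros; cnt.
Qed.

Lemma charint_even (sg t r : R) (K : R -> R -> R) :
  even_r K -> charint sg K t (- r) = charint (- sg) K t r.
Proof.
  intros HO. unfold charint. apply RInt_ext. intros s _. rewrite <- HO. f_equal. ring.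
Qed.

Lemma cplus_odd (K : R -> R -> R) : cont2 K -> odd_r K -> odd_r (cplus K).
Proof.
  intros HK HO t r. unfold cplus. rewrite !charint_odd by auto.
  replace (- (1)) with (-1) by ring. replace (- -1) with 1 by ring.
  field.
Qed.

Lemma cminus_odd (K : R -> R -> R) : even_r K -> odd_r (cminus K).
Proof.
  intros HO t r. unfold cminus. rewrite !charint_even by auto.
  replace (- (1)) with (-1) by ring. replace (- -1) with 1 by ring. field.
Qed.

Lemma Gam_even (G : R -> R -> R) : cont2 G -> odd_r G -> even_r (Gam G).
Proof.
  intros HG HO s y. unfold Gam.
  assert (E := RInt_comp_lin (V := R_CompleteNormedModule) (G s) (-1) 0 0 y
                 (ex_RInt_cont _ _ _ (fun x => cont2_slice1 G s x HG))).
  replace (-1 * 0 + 0) with 0 in E by ring. replace (-1 * y + 0) with (- y) in E by ring.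
  rewrite <- E. apply RInt_ext. intros x _.
  change (-1 * G s (-1 * x + 0) = G s x).
  replace (-1 * x + 0) with (- x) by ring. rewrite HO. ring.
Qed.

Lemma odd_at_0 (G : R -> R -> R) (t : R) : odd_r G -> G t 0 = 0.
Proof. intros H. specialize (H t 0). rewrite Ropp_0 in H. lra. Qed.

Lemma charint_minus (sg t r : R) (K L : R -> R -> R) :
  cont2 K -> cont2 L ->
  charint sg (fun s y => K s y - L s y) t r = charint sg K t r - charint sg L t r.
Proof.
  intros HK HL. unfold charint.
  apply (RInt_minus (V := R_CompleteNormedModule)); apply ex_RInt_cont; intros; cnt.
Qed.

Lemma cplus_minus (t r : R) (K L : R -> R -> R) :
  cont2 K -> cont2 L -> cplus (fun s y => K s y - L s y) t r = cplus K t r - cplus L t r.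
Proof. intros HK HL. unfold cplus. rewrite !charint_minus by auto. field. Qed.

Lemma cminus_minus (t r : R) (K L : R -> R -> R) :
  cont2 K -> cont2 L -> cminus (fun s y => K s y - L s y) t r = cminus K t r - cminus L t r.
Proof. intros HK HL. unfold cminus. rewrite !charint_minus by auto. field. Qed.

Lemma Gam_minus (s y : R) (G H : R -> R -> R) :
  cont2 G -> cont2 H -> Gam (fun s y => G s y - H s y) s y = Gam G s y - Gam H s y.
Proof.
  intros HG HH. unfold Gam.
  apply (RInt_minus (V := R_CompleteNormedModule)); apply ex_RInt_cont; intros; cnt.
Qed.

(* [N / r] for a function [N] odd in [r], completed at [r = 0] by [N_r]. *)
Definition quot (N Nr : R -> R -> R) (t r : R) : R :=
  if Req_EM_T r 0 then Nr t 0 else N t r / r.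

Lemma quot_mult (N Nr : R -> R -> R) (t r : R) : N t 0 = 0 -> r * quot N Nr t r = N t r.
Proof.
  intros H. unfold quot. destruct Req_EM_T as [E | E].
  - rewrite E, H. ring.
  - field. auto.
Qed.

Lemma quot_at0 (N Nr : R -> R -> R) (t : R) : quot N Nr t 0 = Nr t 0.
Proof. unfold quot. destruct Req_EM_T; lra. Qed.

Lemma quot_neq0 (N Nr : R -> R -> R) (t r : R) : r <> 0 -> quot N Nr t r = N t r / r.
Proof. intros H. unfold quot. destruct Req_EM_T; [contradiction | reflexivity]. Qed.

Lemma quot_even (N Nr : R -> R -> R) : odd_r N -> even_r (quot N Nr).
Proof.
  intros H t r. destruct (Req_EM_T r 0) as [-> | E].
  - now rewrite Ropp_0.
  - rewrite !quot_neq0 by lra. rewrite H. field. lra.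
Qed.

(** Behind both uses of [quot] near the axis: the quotient is a value of [Nr] at a radius between 0
    and [r], which yields continuity at [r = 0] and turns bounds on the radial derivative into
    bounds on the quotient. *)
Lemma quot_MVT (N Nr : R -> R -> R) (t r : R) :
  (forall t r, is_derive (N t) r (Nr t r)) -> N t 0 = 0 ->
  exists c, Rmin 0 r <= c <= Rmax 0 r /\ quot N Nr t r = Nr t c.
Proof.
  intros HD H0. destruct (Req_EM_T r 0) as [-> | E].
  - exists 0. rewrite quot_at0. split; [| reflexivity].
    rewrite Rmin_left, Rmax_left; lra.
  - destruct (MVT_closed (N t) (Nr t) 0 r) as [c [Hc Ec]]; auto.
    exists c. split; auto. rewrite quot_neq0, <- (Rminus_0_r (N t r)), <- H0, Ec by auto.
    field. auto.
Qed.

Lemma cont2_quot (N Nr : R -> R -> R) :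
  cont2 N -> cont2 Nr -> (forall t r, is_derive (N t) r (Nr t r)) -> (forall t, N t 0 = 0) ->
  cont2 (quot N Nr).
Proof.
  intros HN HNr HD H0. apply (cont2_continuity_2d _ 0 0). intros t r.
  destruct (Req_EM_T r 0) as [-> | E].
  - intros eps. destruct (cont2_pt Nr t 0 HNr eps) as [d Hd].
    exists d. intros t' r' Ht Hr. rewrite quot_at0.
    destruct (quot_MVT N Nr t' r' HD (H0 t')) as [c [Hc Ec]]. rewrite Ec.
    apply Hd; auto. revert Hr Hc. unfold Rmin, Rmax. rewrite !Rminus_0_r.
    destruct Rle_dec; rabs.
  - apply continuity_2d_pt_ext_loc with (f := fun t r => N t r * / r).
    + assert (P : 0 < Rabs r) by now apply Rabs_pos_lt.
      exists (mkposreal _ P). simpl. intros t' r' _ Hr. symmetry. apply quot_neq0.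
      intros ->. rewrite Rminus_0_l, Rabs_Ropp in Hr. lra.
    + apply continuity_2d_pt_mult; [now apply cont2_pt |].
      apply continuity_2d_pt_inv; [apply continuity_2d_pt_id2 | auto].
Qed.

Lemma is_derive_quot (N Nr : R -> R -> R) (t r : R) :
  r <> 0 -> N t 0 = 0 -> is_derive (N t) r (Nr t r) ->
  is_derive (quot N Nr t) r ((Nr t r - quot N Nr t r) / r).
Proof.
  intros Hr H0 HD.
  apply is_derive_ext_loc with (f := fun r => N t r * / r).
  - assert (P : 0 < Rabs r) by now apply Rabs_pos_lt.
    exists (mkposreal _ P). intros y Hy. symmetry. apply quot_neq0.
    intros ->. change (Rabs (0 - r) < Rabs r) in Hy. rewrite Rminus_0_l, Rabs_Ropp in Hy. lra.
  - rewrite quot_neq0 by auto.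
    assert (DI : is_derive (fun y => / y) r (- / r ^ 2)).
    { auto_derive; auto. simpl. field. auto. }
    pose proof (is_derive_mult (N t) (fun r => / r) r _ _ HD DI Rmult_comm) as D.
    apply (is_derive_eq _ _ _ _ D).
    unfold plus, mult; simpl. field. auto.
Qed.

(** The difference quotient at 0 is [k h] itself, so continuity of [k] is enough. On the axis [v] is
    only known to be continuous, yet [r |v|^q] must be differentiable there. *)
Lemma is_derive_mult_at0 (k : R -> R) : continuous k 0 -> is_derive (fun y => y * k y) 0 (k 0).
Proof.
  intros Hc. apply is_derive_Reals. intros eps Heps.
  destruct (proj1 (filterlim_locally _ _) Hc (mkposreal eps Heps)) as [d Hd].
  exists d. intros h Hh Hhd. rewrite Rplus_0_l, Rmult_0_l, Rminus_0_r.
  replace (h * k h / h) with (k h) by (field; auto).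
  apply (Hd h). change (Rabs (h - 0) < d). now rewrite Rminus_0_r.
Qed.

(* The factor [Nr - N / ρ] is [ρ ∂_ρ (N / ρ)], which vanishes on the axis. *)
Lemma is_derive_mult_comp_quot (phi dphi : R -> R) (N Nr : R -> R -> R) (t r : R) :
  cont2 N -> cont2 Nr ->
  (forall x, is_derive phi x (dphi x)) ->
  (forall t r, is_derive (N t) r (Nr t r)) -> (forall t, N t 0 = 0) ->
  is_derive (fun y => y * phi (quot N Nr t y)) r
    (phi (quot N Nr t r) + dphi (quot N Nr t r) * (Nr t r - quot N Nr t r)).
Proof.
  intros HN HNr Hphi HD H0.
  destruct (Req_EM_T r 0) as [-> | E].
  - rewrite quot_at0, Rminus_diag, Rmult_0_r, Rplus_0_r.
    assert (Hc : continuous (fun y => phi (quot N Nr t y)) 0).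
    { apply (continuous_app phi (quot N Nr t)).
      - intros y. apply (is_derive_cont phi y (dphi y)), Hphi.
      - apply cont2_slice1. now apply cont2_quot. }
    rewrite <- (quot_at0 N Nr t). now apply (is_derive_mult_at0 (fun y => phi (quot N Nr t y))).
  - pose proof (is_derive_quot N Nr t r E (H0 t) (HD t r)) as DQ.
    pose proof (is_derive_comp phi (quot N Nr t) r _ _ (Hphi _) DQ) as DC.
    pose proof (is_derive_mult (fun y => y) (fun y => phi (quot N Nr t y)) r 1 _
                  (is_derive_id r) DC Rmult_comm) as D.
    apply (is_derive_eq _ _ _ _ D).
    unfold plus, mult, scal; simpl. unfold mult; simpl. field. auto.
Qed.

(** * Powers of absolute values *)

Lemma powabs_neq0 (x a : R) : x <> 0 -> powabs x a = Rpower (Rabs x) a.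
Proof. intros H. unfold powabs. destruct Req_EM_T; [contradiction | reflexivity]. Qed.

Lemma powabs_0 (a : R) : powabs 0 a = 0.
Proof. unfold powabs. destruct Req_EM_T; [reflexivity | lra]. Qed.

Lemma powabs_nonneg (x a : R) : 0 <= powabs x a.
Proof. unfold powabs. destruct Req_EM_T; [lra | left; apply Rpower_pos]. Qed.

Lemma powabs_le (x a M : R) : 0 <= a -> Rabs x <= M -> 0 < M -> powabs x a <= Rpower M a.
Proof.
  intros Ha Hx HM. unfold powabs. destruct Req_EM_T.
  - left; apply Rpower_pos.
  - apply Rle_Rpower_l; auto. split; auto. now apply Rabs_pos_lt.
Qed.

(* [sign x |x|^b]. *)
Definition dpow (x b : R) : R := x * powabs x (b - 1).

Lemma dpow_abs (x b : R) : Rabs (dpow x b) = powabs x b.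
Proof.
  unfold dpow. destruct (Req_EM_T x 0) as [-> | E].
  - now rewrite !powabs_0, Rmult_0_r, Rabs_R0.
  - rewrite !powabs_neq0, Rabs_mult, (Rabs_right (Rpower _ _)) by
      (auto; left; apply Rpower_pos).
    assert (P : 0 < Rabs x) by now apply Rabs_pos_lt.
    rewrite <- (Rpower_1 (Rabs x)) at 1 by auto.
    rewrite <- Rpower_plus. f_equal. ring.
Qed.

Lemma is_derive_powabs_neq0 (x a : R) :
  x <> 0 -> is_derive (fun y => powabs y a) x (a * dpow x (a - 1)).
Proof.
  intros Hx. assert (P : 0 < Rabs x) by now apply Rabs_pos_lt.
  (* Within distance [|x|] of [x] the sign is constant, so the function is there a smooth power of
     [sg * y]. *)
  set (sg := if Rlt_dec 0 x then 1 else -1).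
  assert (Hsg : forall y, Rabs (y - x) < Rabs x -> y <> 0 /\ Rabs y = sg * y).
  { intros y. unfold sg. destruct Rlt_dec; intros H; split; rabs. }
  apply is_derive_ext_loc with (f := fun y => Rpower (sg * y) a).
  - exists (mkposreal _ P). intros y Hy. destruct (Hsg y Hy) as [Hy0 Hy1].
    now rewrite powabs_neq0, Hy1.
  - destruct (Hsg x) as [_ Hx1]; [now rewrite Rminus_diag, Rabs_R0 |].
    assert (D : is_derive (fun y => Rpower (sg * y) a) x (sg * (a * Rpower (sg * x) (a - 1)))).
    { apply (is_derive_comp (fun y => Rpower y a) (fun y => sg * y)).
      - apply is_derive_Reals, derivable_pt_lim_power. lra.
      - auto_derive; auto. ring. }
    apply (is_derive_eq _ _ _ _ D).
    unfold dpow. rewrite powabs_neq0, Hx1 by auto.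
    replace (a - 1) with (1 + (a - 1 - 1)) at 1 by ring.
    rewrite Rpower_plus, Rpower_1 by lra.
    assert (sg * sg = 1) by (unfold sg; destruct Rlt_dec; ring).
    transitivity (sg * sg * (a * (x * Rpower (sg * x) (a - 1 - 1)))); [ring |].
    rewrite H. ring.
Qed.

Lemma powabs_small (a eps : R) :
  0 < a -> 0 < eps -> exists d, 0 < d /\ forall x, Rabs x < d -> powabs x a < eps.
Proof.
  intros Ha He. exists (Rpower eps (/ a)). split; [apply Rpower_pos |].
  intros x Hx. unfold powabs. destruct Req_EM_T; auto.
  assert (P : 0 < Rabs x) by now apply Rabs_pos_lt.
  replace eps with (Rpower (Rpower eps (/ a)) a).
  - now apply Rlt_Rpower_l.
  - rewrite Rpower_mult, Rinv_l, Rpower_1; lra.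
Qed.

Lemma continuous_powabs (a x : R) : 0 < a -> continuous (fun y => powabs y a) x.
Proof.
  intros Ha. destruct (Req_EM_T x 0) as [-> | E].
  - apply filterlim_locally. intros eps.
    destruct (powabs_small a eps Ha (cond_pos eps)) as [d [Hd H]].
    exists (mkposreal d Hd). intros y Hy. change (Rabs (powabs y a - powabs 0 a) < eps).
    rewrite powabs_0, Rminus_0_r, Rabs_right by (apply Rle_ge, powabs_nonneg).
    apply H. change (Rabs (y - 0) < d) in Hy. now rewrite Rminus_0_r in Hy.
  - eapply (is_derive_cont (fun y => powabs y a) x), is_derive_powabs_neq0, E.
Qed.

Lemma is_derive_dpow (x b : R) : 1 < b -> is_derive (fun y => dpow y b) x (b * powabs x (b - 1)).
Proof.
  intros Hb. unfold dpow. destruct (Req_EM_T x 0) as [-> | E].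
  - replace (b * powabs 0 (b - 1)) with (powabs 0 (b - 1)) by (rewrite powabs_0; ring).
    apply (is_derive_mult_at0 (fun y => powabs y (b - 1))).
    apply continuous_powabs. lra.
  - pose proof (is_derive_mult (fun y => y) (fun y => powabs y (b - 1)) x 1 _
                  (is_derive_id x) (is_derive_powabs_neq0 x (b - 1) E) Rmult_comm) as D.
    apply (is_derive_eq _ _ _ _ D).
    unfold plus, mult; simpl. unfold dpow. rewrite !powabs_neq0 by auto.
    assert (P : 0 < Rabs x) by now apply Rabs_pos_lt.
    (* Splitting off the square of [Rabs x] allows it to be replaced by [x * x], as produced by the
       product rule. *)
    replace (b - 1) with (1 + 1 + (b - 1 - 1 - 1)) at 1 4 by ring.
    rewrite (Rpower_plus (1 + 1)), (Rpower_plus 1 1), Rpower_1 by auto.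
    assert (Q : Rabs x * Rabs x = x * x) by (rewrite <- Rabs_mult; apply Rabs_right; nra).
    rewrite Q. ring.
Qed.

Lemma is_derive_powabs (x a : R) :
  1 < a -> is_derive (fun y => powabs y a) x (a * dpow x (a - 1)).
Proof.
  intros Ha. destruct (Req_EM_T x 0) as [-> | E]; [| now apply is_derive_powabs_neq0].
  unfold dpow. rewrite Rmult_0_l, Rmult_0_r.
  apply is_derive_Reals. intros eps Heps.
  destruct (powabs_small (a - 1) eps ltac:(lra) Heps) as [d [Hd H]].
  exists (mkposreal d Hd). intros h Hh Hhd. rewrite Rplus_0_l, powabs_0, !Rminus_0_r.
  unfold Rdiv. rewrite Rabs_mult, Rabs_inv.
  specialize (H h Hhd). rewrite <- dpow_abs in H.
  rewrite (Rabs_right (powabs h a)) by (apply Rle_ge, powabs_nonneg).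
  assert (P : 0 < Rabs h) by now apply Rabs_pos_lt.
  replace (powabs h a) with (Rabs h * Rabs (dpow h (a - 1))).
  - replace (Rabs h * Rabs (dpow h (a - 1)) * / Rabs h) with (Rabs (dpow h (a - 1))) by (field; lra).
    exact H.
  - rewrite dpow_abs, !powabs_neq0 by auto.
    rewrite <- (Rpower_1 (Rabs h)) at 1 by auto. rewrite <- Rpower_plus. f_equal. ring.
Qed.

Lemma powabs_lipschitz (x y a M : R) :
  1 < a -> 0 < M -> Rabs x <= M -> Rabs y <= M ->
  Rabs (powabs x a - powabs y a) <= a * Rpower M (a - 1) * Rabs (x - y).
Proof.
  intros Ha HM Hx Hy.
  apply (derive_bound (fun y => powabs y a) (fun y => a * dpow y (a - 1))).
  - intros; now apply is_derive_powabs.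
  - intros c Hc. rewrite Rabs_mult, dpow_abs, (Rabs_right a) by lra.
    apply Rmult_le_compat_l; [lra |]. apply powabs_le; auto; [lra |].
    revert Hc Hx Hy. unfold Rmin, Rmax. destruct Rle_dec; rabs.
Qed.

Lemma dpow_lipschitz (x y b M : R) :
  1 < b -> 0 < M -> Rabs x <= M -> Rabs y <= M ->
  Rabs (dpow x b - dpow y b) <= b * Rpower M (b - 1) * Rabs (x - y).
Proof.
  intros Hb HM Hx Hy.
  apply (derive_bound (fun y => dpow y b) (fun y => b * powabs y (b - 1))).
  - intros; now apply is_derive_dpow.
  - intros c Hc. rewrite Rabs_mult, (Rabs_right b), (Rabs_right (powabs _ _))
      by (try apply Rle_ge, powabs_nonneg; lra).
    apply Rmult_le_compat_l; [lra |]. apply powabs_le; auto; [lra |].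
    revert Hc Hx Hy. unfold Rmin, Rmax. destruct Rle_dec; rabs.
Qed.

(** * Weighted estimates of the Duhamel operators *)

Section DuhamelFirst.
Variables p mu : R.
Hypotheses (Hp : 2 < p) (Hp3 : p < 3) (Hmu : 3 - p < mu) (Hmu1 : mu < 1).

(** The weight is [br y] times the [p]-th power of the reciprocal of [w1], that is, the size of
    [r |∂_t u|^p]. *)
Definition bound1 (A : R) (G : R -> R -> R) : Prop :=
  forall s y, 0 <= s -> Rabs (G s y) <= A * (bp y (1 - p) * bp (s - Rabs y) (- mu)).

Lemma charint_out_bound1 :
  exists C, 0 < C /\ forall A G t r, 0 <= A -> cont2 G -> bound1 A G -> 0 <= t -> 0 <= r ->
    Rabs (charint 1 G t r) <= C * A * (bp r (2 - p) * bp (t + r) (- mu)).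
Proof.
  destruct (kernel1_outgoing p mu Hp Hp3 Hmu Hmu1) as [C [HC H]].
  exists C. split; auto. intros A G t r HA HG HB Ht Hr. unfold charint.
  replace (bp r (2 - p)) with (bp (t + r - t) (2 - p)) by (f_equal; ring).
  apply H; auto; try lra.
  - intros s. cnt.
  - intros s Hs. eapply Rle_trans; [apply HB; lra |].
    replace (r + 1 * (t - s)) with (t + r - s) by ring. rewrite Rabs_right by lra.
    replace (s - (t + r - s)) with (2 * s - (t + r)) by ring. lra.
Qed.

Lemma charint_in_bound1 :
  exists C, 0 < C /\ forall A G t r, 0 <= A -> cont2 G -> bound1 A G -> 0 <= t -> 0 <= r ->
    Rabs (charint (-1) G t r) <= C * A * bp (t - r) (- mu).
Proof.
  destruct (kernel1_incoming p mu Hp Hp3 Hmu Hmu1) as [C [HC H]].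
  exists C. split; auto. intros A G t r HA HG HB Ht Hr. unfold charint.
  apply H; auto; try lra.
  - intros s. cnt.
  - intros s Hs. eapply Rle_trans; [apply HB; lra |].
    replace (r + -1 * (t - s)) with (s - (t - r)) by ring. lra.
Qed.

Lemma cminus_at_time0 (K : R -> R -> R) (r : R) : cminus K 0 r = 0.
Proof.
  unfold cminus, charint. rewrite !RInt_point. unfold zero; simpl. field.
Qed.

Lemma cminus_Gam_odd (G : R -> R -> R) : cont2 G -> odd_r G -> odd_r (cminus (Gam G)).
Proof. intros. apply cminus_odd. now apply Gam_even. Qed.

Lemma duhamel_value_bound :
  exists C, 0 < C /\ forall A G t r, 0 <= A -> cont2 G -> odd_r G -> bound1 A G -> 0 <= t -> 0 < r ->
    Rabs (cminus (Gam G) t r) <= C * A * (r * iw2 p mu t r).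
Proof.
  destruct charint_out_bound1 as [C0 [HC0 H0]].
  destruct (outgoing_near p mu Hp Hp3 Hmu Hmu1) as [C1 [HC1 H1]].
  destruct (outgoing_far p mu Hp Hp3 Hmu Hmu1) as [C2 [HC2 H2]].
  exists ((C1 + C2) * C0). split; [apply Rmult_lt_0_compat; lra |].
  intros A G t r HA HG HO HB Ht Hr.
  assert (HGG := cont2_Gam G HG).
  assert (HD := fun s y => is_derive_Gam G s y HG).
  assert (HCA : 0 <= C0 * A) by (apply Rmult_le_pos; lra).
  assert (PW : 0 <= C0 * A * (r * iw2 p mu t r)).
  { apply Rmult_le_pos; auto. apply Rmult_le_pos; [lra | left; apply iw2_pos]. }
  assert (HV0 : forall t, cminus (Gam G) t 0 = 0) by (intros; apply odd_at_0; now apply cminus_Gam_odd).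
  unfold iw2 in *. destruct (Rlt_dec r (t / 2)) as [h | h].
  - pose proof (H1 r t (C0 * A) (fun x => cminus (Gam G) (t - r + x) (0 + x))
                  (fun x => charint 1 G (t - r + x) (0 + x))) as HH.
    cbv beta in HH. replace (t - r + r) with t in HH by ring. rewrite (Rplus_0_l r) in HH.
    eapply Rle_trans; [apply HH; auto; try lra |].
    + now rewrite !Rplus_0_r.
    + intros x. apply is_derive_cminus_outgoing; auto.
    + intros x Hx. rewrite Rplus_0_l.
      replace (t - r + 2 * x) with (t - r + x + x) by ring. apply H0; auto; lra.
    + assert (0 <= C2 * (C0 * A * (r * (bp r (2 - p) * bp (t + r) (- mu)))))
        by (apply Rmult_le_pos; lra). lra.
  (* [(a, c)] is where the outgoing characteristic through [(t, r)] starts, on the axis if [r <= t]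
     and on the initial line otherwise; it reaches [(t, r)] after time [Rmin r t]. The function
     vanishes at the start, by oddness or by the empty time integral. *)
  - set (a := Rmax (t - r) 0). set (c := Rmax (r - t) 0).
    assert (Hac : a + c = Rabs (t - r)) by (unfold a, c, Rmax; repeat destruct Rle_dec; rabs).
    assert (Ha : 0 <= a) by apply Rmax_r. assert (Hc : 0 <= c) by apply Rmax_r.
    assert (Ham : a + Rmin r t = t) by (unfold a, Rmax, Rmin; repeat destruct Rle_dec; lra).
    assert (Hcm : c + Rmin r t = r) by (unfold c, Rmax, Rmin; repeat destruct Rle_dec; lra).
    pose proof (H2 r t (C0 * A) (fun x => cminus (Gam G) (a + x) (c + x))
                  (fun x => charint 1 G (a + x) (c + x))) as HH.
    cbv beta in HH. rewrite Ham, Hcm in HH.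
    eapply Rle_trans; [apply HH; auto; try lra |].
    + rewrite !Rplus_0_r. destruct (Rle_dec r t) as [hrt | hrt].
      * replace c with 0 by (unfold c, Rmax; destruct Rle_dec; lra). apply HV0.
      * replace a with 0 by (unfold a, Rmax; destruct Rle_dec; lra). apply cminus_at_time0.
    + intros x. apply is_derive_cminus_outgoing; auto.
    + intros x Hx. rewrite <- Hac.
      replace (a + c + 2 * x) with (a + x + (c + x)) by ring. fold c.
      replace (x + c) with (c + x) by ring. apply H0; auto; lra.
    + assert (0 <= C1 * (C0 * A * (r * (bp (t - r) (3 - p - mu) * bp (t + r) (-1)))))
        by (apply Rmult_le_pos; lra). lra.
Qed.

Lemma duhamel_rderiv_bound :
  exists C, 0 < C /\ forall A G t r, 0 <= A -> cont2 G -> bound1 A G -> 0 <= t -> 0 <= r ->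
    Rabs (cminus G t r) <= C * A * bp (t - r) (- mu).
Proof.
  destruct charint_out_bound1 as [C0 [HC0 H0]].
  destruct charint_in_bound1 as [C1 [HC1 H1]].
  exists (C0 + C1). split; [lra |]. intros A G t r HA HG HB Ht Hr.
  specialize (H0 A G t r HA HG HB Ht Hr). specialize (H1 A G t r HA HG HB Ht Hr).
  assert (B : bp r (2 - p) * bp (t + r) (- mu) <= bp (t - r) (- mu)).
  { apply Rle_trans with (1 * bp (t + r) (- mu)).
    - apply Rmult_le_compat_r; [left; apply bp_pos | apply bp_le1; lra].
    - rewrite Rmult_1_l. apply bp_anti; [lra | rabs]. }
  assert (PA : 0 <= C0 * A) by (apply Rmult_le_pos; lra).
  assert (PA1 : 0 <= C1 * A) by (apply Rmult_le_pos; lra).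
  assert (B2 := Rmult_le_compat_l _ _ _ PA B).
  pose proof (bp_pos (t - r) (- mu)).
  assert (0 <= C1 * A * bp (t - r) (- mu)) by (apply Rmult_le_pos; lra).
  assert (0 <= C0 * A * bp (t - r) (- mu)) by (apply Rmult_le_pos; lra).
  unfold cminus. unfold Rdiv. rewrite Rabs_mult, (Rabs_right (/ 2)) by lra.
  pose proof (Rabs_triang (charint 1 G t r) (- charint (-1) G t r)) as TR.
  rewrite Rabs_Ropp in TR. unfold Rminus at 1. lra.
Qed.

Lemma duhamel_first :
  exists C, 0 < C /\ forall A G, 0 <= A -> cont2 G -> odd_r G -> bound1 A G ->
    forall t r, 0 <= t -> 0 <= r ->
      Rabs (quot (cminus (Gam G)) (cminus G) t r) <= C * A * iw2 p mu t r /\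
      Rabs (cminus G t r - quot (cminus (Gam G)) (cminus G) t r) <= C * A * bp (t - r) (- mu).
Proof.
  destruct duhamel_value_bound as [C0 [HC0 H0]].
  destruct duhamel_rderiv_bound as [C1 [HC1 H1]].
  exists (C0 + C1 + C1). split; [lra |]. intros A G HA HG HO HB t r Ht Hr.
  specialize (H1 A G t r HA HG HB Ht Hr).
  pose proof (iw2_pos p mu t r) as PI. pose proof (bp_pos (t - r) (- mu)) as PB.
  assert (PC0 : 0 <= C0 * A) by (apply Rmult_le_pos; lra).
  assert (PC1 : 0 <= C1 * A) by (apply Rmult_le_pos; lra).
  assert (Q1 : 0 <= C0 * A * iw2 p mu t r) by (apply Rmult_le_pos; lra).
  assert (Q2 : 0 <= C1 * A * iw2 p mu t r) by (apply Rmult_le_pos; lra).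
  assert (Q3 : 0 <= C0 * A * bp (t - r) (- mu)) by (apply Rmult_le_pos; lra).
  assert (Q4 : 0 <= C1 * A * bp (t - r) (- mu)) by (apply Rmult_le_pos; lra).
  assert (V : Rabs (quot (cminus (Gam G)) (cminus G) t r) <= (C0 + C1) * A * iw2 p mu t r).
  { destruct (Req_EM_T r 0) as [-> | E].
    - rewrite quot_at0. eapply Rle_trans; [exact H1 |]. rewrite Rminus_0_r.
      (* On the axis the quotient is the radial derivative, and its weaker weight coincides there
         with that of [v]. At [t = 0] the second branch of [iw2] is taken and everything equals
         1. *)
      assert (bp t (- mu) <= iw2 p mu t 0).
      { unfold iw2. destruct Rlt_dec.
        - rewrite bp_at0, Rplus_0_r. lra.
        - replace t with 0 by lra. rewrite Rplus_0_r, Rminus_0_r, !bp_at0. lra. }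
      pose proof (Rmult_le_compat_l _ _ _ PC1 H). lra.
    - specialize (H0 A G t r HA HG HO HB Ht ltac:(lra)).
      rewrite quot_neq0 by auto. unfold Rdiv.
      rewrite Rabs_mult, (Rabs_right (/ r)) by (left; apply Rinv_0_lt_compat; lra).
      apply Rle_trans with (C0 * A * iw2 p mu t r); [| lra].
      apply Rmult_le_reg_r with r; [lra |].
      rewrite Rmult_assoc, Rinv_l, Rmult_1_r by auto. lra. }
  split; [lra |].
  pose proof (iw2_le_iw3 p mu Hp Hp3 Hmu t r Ht Hr) as B.
  assert (B1 := Rmult_le_compat_l _ _ _ PC0 B). assert (B2 := Rmult_le_compat_l _ _ _ PC1 B).
  pose proof (Rabs_triang (cminus G t r) (- quot (cminus (Gam G)) (cminus G) t r)) as TR.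
  rewrite Rabs_Ropp in TR. unfold Rminus at 1. lra.
Qed.

End DuhamelFirst.

Section DuhamelSecond.
Variables p mu q : R.
Hypotheses (Hq : 2 < q) (Hp : 2 < p) (Hp3 : p < 3) (Hmu : 3 - p < mu) (Hmu1 : mu < 1)
  (Hpq : p * (2 - (p - 2) * q) < (p * q - 1) * mu).

(** Sizes of [r |v|^q] and of its radial derivative. The second has no factor [br y], and one of the
    [q] powers of [iw2] is replaced by the weight of [r ∂_r v]. *)
Definition bound2 (A : R) (G g : R -> R -> R) : Prop :=
  forall s y, 0 <= s ->
    Rabs (G s y) <= A * (br y * Rpower (iw2 p mu s (Rabs y)) q) /\
    Rabs (g s y) <= A * (Rpower (iw2 p mu s (Rabs y)) (q - 1) * bp (s - Rabs y) (- mu)).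

Local Lemma bp_cone (t r : R) : 0 <= t -> 0 <= r -> bp (t + r) (- (mu / p)) <= bp (t - r) (- (mu / p)).
Proof.
  intros. apply bp_anti; [| rabs].
  assert (0 < mu / p) by (apply Rdiv_lt_0_compat; lra). lra.
Qed.

Lemma duhamel_tderiv_bound :
  exists C, 0 < C /\ forall A G g t r, 0 <= A -> cont2 G -> bound2 A G g -> 0 <= t -> 0 <= r ->
    Rabs (cplus G t r) <= C * A * bp (t - r) (- (mu / p)).
Proof.
  destruct (kernel2_outgoing p mu q Hq Hp Hp3 Hmu Hmu1) as [C0 [HC0 H0]].
  destruct (kernel2_incoming p mu q Hq Hp Hp3 Hmu Hmu1 Hpq) as [C1 [HC1 H1]].
  exists (C0 + C1). split; [lra |]. intros A G g t r HA HG HB Ht Hr.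
  assert (E1 : Rabs (charint 1 G t r) <= C0 * A * bp (t - r) (- (mu / p))).
  { apply Rle_trans with (C0 * A * bp (t + r) (- (mu / p))).
    2:{ apply Rmult_le_compat_l; [apply Rmult_le_pos; lra | now apply bp_cone]. }
    unfold charint. apply H0; auto; try lra; [intros; cnt |].
    intros s Hs. eapply Rle_trans; [apply HB; lra |]. apply Rmult_le_compat_l; auto.
    replace (r + 1 * (t - s)) with (t + r - s) by ring. rewrite Rabs_right by lra.
    replace s with (t + r - (t + r - s)) at 2 by ring.
    apply majorant2_value; auto. lra. }
  assert (E2 : Rabs (charint (-1) G t r) <= C1 * A * bp (t - r) (- (mu / p))).
  { unfold charint. apply H1; auto; try lra; [intros; cnt |].
    intros s Hs. eapply Rle_trans; [apply HB; lra |].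
    replace (r + -1 * (t - s)) with (s - (t - r)) by ring. lra. }
  pose proof (bp_pos (t - r) (- (mu / p))) as PB.
  assert (0 <= C0 * A * bp (t - r) (- (mu / p))) by (repeat apply Rmult_le_pos; lra).
  assert (0 <= C1 * A * bp (t - r) (- (mu / p))) by (repeat apply Rmult_le_pos; lra).
  unfold cplus. unfold Rdiv at 1. rewrite Rabs_mult, (Rabs_right (/ 2)) by lra.
  pose proof (Rabs_triang (charint 1 G t r) (charint (-1) G t r)). lra.
Qed.

Lemma duhamel_trderiv_bound :
  exists C, 0 < C /\ forall A G g t r, 0 <= A -> cont2 g -> bound2 A G g ->
    0 <= t -> 0 <= r <= 1 ->
    Rabs (cplus g t r) <= C * A * bp (t - r) (- (mu / p)).
Proof.
  destruct (kernel2_outgoing p mu q Hq Hp Hp3 Hmu Hmu1) as [C0 [HC0 H0]].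
  destruct (majorant2_deriv p mu q Hp Hp3 Hmu Hmu1 Hpq) as [C3 [HC3 H3]].
  destruct (kernel2_deriv_incoming p mu q Hq Hp Hp3 Hmu Hmu1 Hpq) as [C1 [HC1 H1]].
  exists (C0 * C3 + C1). assert (P03 : 0 < C0 * C3) by now apply Rmult_lt_0_compat.
  split; [lra |]. intros A G g t r HA HG HB Ht Hr.
  assert (E1 : Rabs (charint 1 g t r) <= C0 * (A * C3) * bp (t - r) (- (mu / p))).
  { assert (0 <= A * C3) by (apply Rmult_le_pos; lra).
    apply Rle_trans with (C0 * (A * C3) * bp (t + r) (- (mu / p))).
    2:{ apply Rmult_le_compat_l; [apply Rmult_le_pos; lra | apply bp_cone; lra]. }
    unfold charint. apply H0; auto; try lra; [intros; cnt |].
    intros s Hs. eapply Rle_trans; [apply HB; lra |]. rewrite Rmult_assoc.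
    apply Rmult_le_compat_l; auto.
    replace (r + 1 * (t - s)) with (t + r - s) by ring. rewrite Rabs_right by lra.
    replace (s - (t + r - s)) with (t + r - 2 * (t + r - s)) by ring.
    replace s with (t + r - (t + r - s)) at 1 by ring. apply H3. lra. }
  assert (E2 : Rabs (charint (-1) g t r) <= C1 * A * bp (t - r) (- (mu / p))).
  { unfold charint. apply H1; auto; try lra; [intros; cnt |].
    intros s Hs. eapply Rle_trans; [apply HB; lra |].
    replace (r + -1 * (t - s)) with (s - (t - r)) by ring. lra. }
  pose proof (bp_pos (t - r) (- (mu / p))) as PB.
  assert (0 <= C0 * (A * C3) * bp (t - r) (- (mu / p))) by (repeat apply Rmult_le_pos; lra).
  assert (0 <= C1 * A * bp (t - r) (- (mu / p))) by (repeat apply Rmult_le_pos; lra).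
  unfold cplus. unfold Rdiv at 1. rewrite Rabs_mult, (Rabs_right (/ 2)) by lra.
  pose proof (Rabs_triang (charint 1 g t r) (charint (-1) g t r)). lra.
Qed.

(** For [r >= 1] dividing by [r] produces the bracket of [r]. For [r < 1] it would be singular, so
    the quotient is read as the mixed derivative at some [c <= r]; the brackets of [t - c] and
    [t - r] differ by a factor at most 2. *)
Lemma duhamel_second :
  exists C, 0 < C /\ forall A G g, 0 <= A -> cont2 G -> cont2 g -> odd_r G ->
    (forall s y, is_derive (G s) y (g s y)) -> bound2 A G g ->
    forall t r, 0 <= t -> 0 <= r ->
      Rabs (quot (cplus G) (cplus g) t r) <= C * A * (bp r (-1) * bp (t - r) (- (mu / p))).
Proof.
  destruct duhamel_tderiv_bound as [C0 [HC0 H0]].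
  destruct duhamel_trderiv_bound as [C1 [HC1 H1]].
  exists (2 * C0 + 2 * C1 * Rpower 2 (mu / p)).
  pose proof (Rpower_pos 2 (mu / p)) as P2.
  assert (P12 : 0 < C1 * Rpower 2 (mu / p)) by now apply Rmult_lt_0_compat.
  split; [lra |]. intros A G g HA HG Hg HO HD HB t r Ht Hr.
  pose proof (bp_pos r (-1)) as PR. pose proof (bp_pos (t - r) (- (mu / p))) as PB.
  assert (PAB : 0 <= A * (bp r (-1) * bp (t - r) (- (mu / p)))) by (repeat apply Rmult_le_pos; lra).
  destruct (Rle_dec 1 r) as [h | h].
  - rewrite quot_neq0 by lra. unfold Rdiv at 1.
    rewrite Rabs_mult, (Rabs_right (/ r)) by (left; apply Rinv_0_lt_compat; lra).
    specialize (H0 A G g t r HA HG HB Ht Hr).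
    assert (B : / r <= 2 * bp r (-1)).
    { rewrite bp_m1. unfold br. rewrite Rabs_right by lra.
      apply Rmult_le_reg_r with (r * (1 + r)); [nra |].
      replace (/ r * (r * (1 + r))) with (1 + r) by (field; lra).
      replace (2 * / (1 + r) * (r * (1 + r))) with (2 * r) by (field; lra). lra. }
    apply Rle_trans with (C0 * A * bp (t - r) (- (mu / p)) * (2 * bp r (-1))).
    + apply Rmult_le_compat; auto; [apply Rabs_pos | left; apply Rinv_0_lt_compat; lra].
    + assert (0 <= 2 * C1 * Rpower 2 (mu / p) * (A * (bp r (-1) * bp (t - r) (- (mu / p)))))
        by (apply Rmult_le_pos; lra). lra.
  - destruct (quot_MVT (cplus G) (cplus g) t r) as [c [Hc Ec]].
    + intros; now apply is_derive_cplus_r.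
    + apply odd_at_0. now apply cplus_odd.
    + rewrite Rmin_left, Rmax_right in Hc by lra. rewrite Ec.
      specialize (H1 A G g t c HA Hg HB Ht ltac:(lra)).
      assert (B1 : bp (t - c) (- (mu / p)) <= Rpower 2 (- - (mu / p)) * bp (t - r) (- (mu / p))).
      { assert (0 < mu / p) by (apply Rdiv_lt_0_compat; lra).
        apply bp_base_neg; try lra. unfold br. rabs. }
      rewrite Ropp_involutive in B1.
      assert (B2 : 1 <= 2 * bp r (-1)).
      { rewrite bp_m1. unfold br. rewrite Rabs_right by lra.
        apply Rmult_le_reg_r with (1 + r); [lra |].
        replace (2 * / (1 + r) * (1 + r)) with 2 by (field; lra). lra. }
      eapply Rle_trans; [exact H1 |].
      apply Rle_trans with (C1 * A * (Rpower 2 (mu / p) * bp (t - r) (- (mu / p))) * (2 * bp r (-1))).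
      * rewrite <- (Rmult_1_r (C1 * A * bp (t - c) (- (mu / p)))).
        pose proof (bp_pos (t - c) (- (mu / p))).
        apply Rmult_le_compat; try lra.
        -- repeat apply Rmult_le_pos; lra.
        -- apply Rmult_le_compat_l; [apply Rmult_le_pos; lra | exact B1].
      * assert (0 <= 2 * C0 * (A * (bp r (-1) * bp (t - r) (- (mu / p)))))
          by (apply Rmult_le_pos; lra). lra.
Qed.

End DuhamelSecond.

(** * Free waves *)

(* [r] times a radial free wave is [lin θ] for a profile [θ]; [linp] gives its radial derivative. *)
Definition lin (th : R -> R) (t r : R) : R := (th (t + r) - th (t - r)) / 2.
Definition linp (th : R -> R) (t r : R) : R := (th (t + r) + th (t - r)) / 2.

(** Bounds and support are shared by a function and its derivative, so that one predicate serves the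
    pair [(th, th1)] for [v] and the pair [(th1, th2)] for [∂_t u]. *)
Definition profile (M L : R) (th th1 : R -> R) : Prop :=
  (forall x, is_derive th x (th1 x)) /\ (forall x, continuous th1 x) /\
  (forall x, Rabs (th x) <= L) /\ (forall x, Rabs (th1 x) <= L) /\
  (forall x, M < Rabs x -> th x = 0) /\ (forall x, M < Rabs x -> th1 x = 0).

Section LinearDerivatives.
Variables th th1 : R -> R.
Hypothesis (Hth : forall x, is_derive th x (th1 x)).

Local Lemma is_derive_th_comp (a : R -> R) (c x : R) :
  is_derive a x c -> is_derive (fun x => th (a x)) x (c * th1 (a x)).
Proof. intros D. apply (is_derive_comp th a); auto. Qed.

Lemma is_derive_lin_t (t r : R) : is_derive (fun t => lin th t r) t (lin th1 t r).
Proof.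
  apply is_derive_ext with (f := fun t => / 2 * (th (t + r) - th (t - r))).
  { intros y; simpl. unfold lin, linp. field. }
  apply (is_derive_eq _ _ (/ 2 * (1 * th1 (t + r) - 1 * th1 (t - r)))).
  - apply (is_derive_scal (fun t => th (t + r) - th (t - r))).
    apply (is_derive_minus (fun t => th (t + r)) (fun t => th (t - r)));
      [apply (is_derive_th_comp (fun t => t + r)) | apply (is_derive_th_comp (fun t => t - r))];
      auto_derive; auto; ring.
  - unfold lin, linp. field.
Qed.

Lemma is_derive_lin_r (t r : R) : is_derive (lin th t) r (linp th1 t r).
Proof.
  apply is_derive_ext with (f := fun r => / 2 * (th (t + r) - th (t - r))).
  { intros y; simpl. unfold lin, linp. field. }
  apply (is_derive_eq _ _ (/ 2 * (1 * th1 (t + r) - (-1) * th1 (t - r)))).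
  - apply (is_derive_scal (fun r => th (t + r) - th (t - r))).
    apply (is_derive_minus (fun r => th (t + r)) (fun r => th (t - r)));
      [apply (is_derive_th_comp (fun r => t + r)) | apply (is_derive_th_comp (fun r => t - r))];
      auto_derive; auto; ring.
  - unfold lin, linp. field.
Qed.

Lemma is_derive_linp_t (t r : R) : is_derive (fun t => linp th t r) t (linp th1 t r).
Proof.
  apply is_derive_ext with (f := fun t => / 2 * (th (t + r) + th (t - r))).
  { intros y; simpl. unfold lin, linp. field. }
  apply (is_derive_eq _ _ (/ 2 * (1 * th1 (t + r) + 1 * th1 (t - r)))).
  - apply (is_derive_scal (fun t => th (t + r) + th (t - r))).
    apply (is_derive_plus (fun t => th (t + r)) (fun t => th (t - r)));
      [apply (is_derive_th_comp (fun t => t + r)) | apply (is_derive_th_comp (fun t => t - r))];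
      auto_derive; auto; ring.
  - unfold lin, linp. field.
Qed.

Lemma is_derive_linp_r (t r : R) : is_derive (linp th t) r (lin th1 t r).
Proof.
  apply is_derive_ext with (f := fun r => / 2 * (th (t + r) + th (t - r))).
  { intros y; simpl. unfold lin, linp. field. }
  apply (is_derive_eq _ _ (/ 2 * (1 * th1 (t + r) + (-1) * th1 (t - r)))).
  - apply (is_derive_scal (fun r => th (t + r) + th (t - r))).
    apply (is_derive_plus (fun r => th (t + r)) (fun r => th (t - r)));
      [apply (is_derive_th_comp (fun r => t + r)) | apply (is_derive_th_comp (fun r => t - r))];
      auto_derive; auto; ring.
  - unfold lin, linp. field.
Qed.

End LinearDerivatives.

Lemma cont2_lin (th : R -> R) : (forall x, continuous th x) -> cont2 (lin th).
Proof. intros H. unfold lin. cnt. Qed.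

Lemma cont2_linp (th : R -> R) : (forall x, continuous th x) -> cont2 (linp th).
Proof. intros H. unfold linp. cnt. Qed.

Lemma lin_odd (th : R -> R) : odd_r (lin th).
Proof.
  intros t r. unfold lin. replace (t - - r) with (t + r) by ring.
  replace (t + - r) with (t - r) by ring. field.
Qed.

Lemma linp_even (th : R -> R) : even_r (linp th).
Proof.
  intros t r. unfold linp. replace (t - - r) with (t + r) by ring.
  replace (t + - r) with (t - r) by ring. field.
Qed.

Lemma quot_linear (e : R) (N Nr M Mr : R -> R -> R) (t r : R) :
  quot (fun t r => e * N t r + M t r) (fun t r => e * Nr t r + Mr t r) t r
  = e * quot N Nr t r + quot M Mr t r.
Proof. unfold quot. destruct Req_EM_T; [reflexivity | now field]. Qed.

Lemma quot_minus (N Nr M Mr : R -> R -> R) (t r : R) :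
  quot (fun t r => N t r - M t r) (fun t r => Nr t r - Mr t r) t r
  = quot N Nr t r - quot M Mr t r.
Proof. unfold quot. destruct Req_EM_T; [reflexivity | now field]. Qed.

Lemma quot_ext (N Nr M Mr : R -> R -> R) (t r : R) :
  N t r = M t r -> Nr t r = Mr t r -> quot N Nr t r = quot M Mr t r.
Proof.
  intros H1 H2. unfold quot. destruct Req_EM_T as [E |]; [now rewrite E in H2 | now rewrite H1].
Qed.

Lemma one_le_bp (M x a : R) : 0 <= M -> Rabs x <= M -> 0 <= a -> 1 <= Rpower (1 + M) a * bp x (- a).
Proof.
  intros HM Hx Ha. rewrite <- (bp_at0 (- a)) at 1.
  replace a with (- - a) at 2 by ring.
  apply bp_base_neg; try lra. unfold br. rewrite Rabs_R0. pose proof (Rabs_pos x). lra.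
Qed.

(** The second part is the strong Huygens principle: as [t + r >= |t - r|], both arguments leave the
    support together. Since the wave lives in [|t - r| <= M], any power of that bracket can then be
    inserted at the cost of a constant depending on [M]. *)
Lemma lin_decay (M L : R) (th th1 : R -> R) (t r : R) :
  0 <= L -> profile M L th th1 -> 0 <= t -> 0 <= r ->
  Rabs (quot (lin th) (linp th1) t r) <= 2 * L * bp r (-1) /\
  (M < Rabs (t - r) -> quot (lin th) (linp th1) t r = 0).
Proof.
  intros HL (HD & Hc & B0 & B1 & Z0 & Z1) Ht Hr.
  assert (BR : 1 <= br r) by apply br_ge1.
  split.
  - rewrite bp_m1. destruct (Rle_dec 1 r) as [h | h].
    + rewrite quot_neq0 by lra. unfold lin.
      assert (Rabs ((th (t + r) - th (t - r)) / 2) <= L).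
      { unfold Rdiv. rewrite Rabs_mult, (Rabs_right (/ 2)) by lra.
        pose proof (B0 (t + r)). pose proof (B0 (t - r)).
        pose proof (Rabs_triang (th (t + r)) (- th (t - r))). rewrite Rabs_Ropp in *.
        unfold Rminus at 1. lra. }
      unfold Rdiv at 1. rewrite Rabs_mult, (Rabs_right (/ r)) by (left; apply Rinv_0_lt_compat; lra).
      apply Rle_trans with (L * / r).
      * apply Rmult_le_compat_r; [left; apply Rinv_0_lt_compat; lra | auto].
      * rewrite (Rmult_comm 2), Rmult_assoc. apply Rmult_le_compat_l; auto.
        unfold br. rewrite Rabs_right by lra.
        apply Rmult_le_reg_r with (r * (1 + r)); [nra |].
        replace (/ r * (r * (1 + r))) with (1 + r) by (field; lra).
        replace (2 * / (1 + r) * (r * (1 + r))) with (2 * r) by (field; lra). lra.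
    + destruct (quot_MVT (lin th) (linp th1) t r) as [c [_ E]].
      * intros; now apply is_derive_lin_r.
      * apply odd_at_0, lin_odd.
      * rewrite E. unfold linp, Rdiv. rewrite Rabs_mult, (Rabs_right (/ 2)) by lra.
        pose proof (B1 (t + c)). pose proof (B1 (t - c)).
        pose proof (Rabs_triang (th1 (t + c)) (th1 (t - c))).
        apply Rle_trans with L; [lra |].
        rewrite (Rmult_comm 2), Rmult_assoc. rewrite <- (Rmult_1_r L) at 1.
        apply Rmult_le_compat_l; auto.
        apply Rmult_le_reg_r with (br r); [lra |]. rewrite Rmult_assoc, Rinv_l by lra.
        unfold br. rewrite Rabs_right; lra.
  - intros HM. assert (HM2 : M < Rabs (t + r)) by (apply Rlt_le_trans with (Rabs (t - r)); auto; rabs).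
    unfold quot. destruct Req_EM_T as [-> | E]; unfold lin, linp.
    + rewrite Rplus_0_r, Rminus_0_r in *. rewrite Z1 by auto. field.
    + rewrite !Z0 by auto. field. auto.
Qed.

Lemma lin_decay_w (M L nu : R) :
  0 <= M -> 0 < L -> 0 <= nu ->
  exists C, 0 < C /\ forall th th1, profile M L th th1 -> forall t r, 0 <= t -> 0 <= r ->
    Rabs (quot (lin th) (linp th1) t r) <= C * (bp r (-1) * bp (t - r) (- nu)).
Proof.
  intros HM HL Hnu. exists (2 * L * Rpower (1 + M) nu).
  pose proof (Rpower_pos (1 + M) nu).
  split. { apply Rmult_lt_0_compat; lra. }
  intros th th1 HP t r Ht Hr. destruct (lin_decay M L th th1 t r ltac:(lra) HP Ht Hr) as [B Z].
  destruct (Rle_dec (Rabs (t - r)) M) as [h | h].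
  - pose proof (one_le_bp M (t - r) nu HM h Hnu) as B2. pose proof (bp_pos r (-1)).
    apply Rle_trans with (2 * L * bp r (-1) * (Rpower (1 + M) nu * bp (t - r) (- nu))).
    + rewrite <- (Rmult_1_r (Rabs _)). apply Rmult_le_compat; auto; try lra. apply Rabs_pos.
    + right; ring.
  - rewrite Z, Rabs_R0 by lra. pose proof (bp_pos r (-1)). pose proof (bp_pos (t - r) (- nu)).
    repeat apply Rmult_le_pos; lra.
Qed.

Lemma lin_decay_v (M L p mu : R) :
  0 <= M -> 0 < L -> 2 < p -> p < 3 -> 3 - p < mu -> mu < 1 ->
  exists C, 0 < C /\ forall th th1, profile M L th th1 -> forall t r, 0 <= t -> 0 <= r ->
    Rabs (quot (lin th) (linp th1) t r) <= C * iw2 p mu t r /\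
    Rabs (linp th1 t r - quot (lin th) (linp th1) t r) <= C * bp (t - r) (- mu).
Proof.
  intros HM HL Hp Hp3 Hmu Hmu1.
  set (C1 := 2 * L * (Rpower (1 + M) (p - 2) * Rpower (1 + 3 * M) mu)).
  set (C2 := 2 * L * (Rpower (1 + M) (p - 3 + mu) * 3)).
  set (C3 := 3 * L * Rpower (1 + M) mu).
  assert (P1 : 0 < C1).
  { unfold C1. apply Rmult_lt_0_compat; [lra |]. apply Rmult_lt_0_compat; apply Rpower_pos. }
  assert (P2 : 0 < C2).
  { unfold C2. apply Rmult_lt_0_compat; [lra |]. apply Rmult_lt_0_compat; [apply Rpower_pos | lra]. }
  assert (P3 : 0 < C3).
  { unfold C3. apply Rmult_lt_0_compat; [lra |]. apply Rpower_pos. }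
  exists (C1 + C2 + C3). split; [lra |].
  intros th th1 HP t r Ht Hr. destruct (lin_decay M L th th1 t r ltac:(lra) HP Ht Hr) as [B Z].
  pose proof (iw2_pos p mu t r) as PI. pose proof (bp_pos (t - r) (- mu)) as PB.
  pose proof (bp_le1 r (-1) ltac:(lra)) as BL. pose proof (bp_pos r (-1)) as BP.
  assert (B' : Rabs (quot (lin th) (linp th1) t r) <= 2 * L).
  { eapply Rle_trans; [exact B |]. rewrite <- (Rmult_1_r (2 * L)) at 2.
    apply Rmult_le_compat_l; lra. }
  split.
  - destruct (Rle_dec (Rabs (t - r)) M) as [h | h].
    2:{ rewrite Z, Rabs_R0 by lra. repeat apply Rmult_le_pos; lra. }
    unfold iw2 in *. destruct Rlt_dec as [h1 | h1].
    (* [r < t / 2] and [t - r <= M] force [t <= 2 * M], so the interior part of the support is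
       bounded. In the other branch [t <= 2 * r] gives [t + r <= 3 * r], whence the factor 3 in
       [C2]. *)
    + assert (Hr1 : Rabs r <= M) by rabs. assert (Ht1 : Rabs (t + r) <= 3 * M) by rabs.
      pose proof (one_le_bp M r (p - 2) HM Hr1 ltac:(lra)) as Q1.
      pose proof (one_le_bp (3 * M) (t + r) mu ltac:(lra) Ht1 ltac:(lra)) as Q2.
      replace (- (p - 2)) with (2 - p) in Q1 by ring.
      apply Rle_trans with (C1 * (bp r (2 - p) * bp (t + r) (- mu))).
      * unfold C1. eapply Rle_trans; [exact B' |].
        apply Rle_trans with (2 * L * ((Rpower (1 + M) (p - 2) * bp r (2 - p)) *
                                 (Rpower (1 + 3 * M) mu * bp (t + r) (- mu)))); [| right; ring].
        rewrite <- (Rmult_1_r (2 * L)) at 1. apply Rmult_le_compat_l; [lra |].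
        rewrite <- (Rmult_1_r 1) at 1. apply Rmult_le_compat; lra.
      * apply Rmult_le_compat_r; lra.
    + pose proof (one_le_bp M (t - r) (p - 3 + mu) HM h ltac:(lra)) as Q1.
      replace (- (p - 3 + mu)) with (3 - p - mu) in Q1 by ring.
      assert (Q2 : bp r (-1) <= 3 * bp (t + r) (-1)).
      { rewrite <- (Rpower_1 3) by lra. replace 1 with (- -1) at 1 by ring.
        apply bp_base_neg; try lra. unfold br. rabs. }
      apply Rle_trans with (C2 * (bp (t - r) (3 - p - mu) * bp (t + r) (-1))).
      * unfold C2. eapply Rle_trans; [exact B |].
        apply Rle_trans with (2 * L * ((Rpower (1 + M) (p - 3 + mu) * bp (t - r) (3 - p - mu))
                                 * (3 * bp (t + r) (-1)))); [| right; ring].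
        apply Rmult_le_compat_l; [lra |].
        rewrite <- (Rmult_1_l (bp r (-1))). apply Rmult_le_compat; lra.
      * apply Rmult_le_compat_r; lra.
  - destruct (Rle_dec (Rabs (t - r)) M) as [h | h].
    + pose proof (one_le_bp M (t - r) mu HM h ltac:(lra)) as Q1.
      apply Rle_trans with (C3 * bp (t - r) (- mu)).
      2:{ apply Rmult_le_compat_r; lra. }
      unfold C3. rewrite Rmult_assoc. apply Rle_trans with (3 * L).
      2:{ rewrite <- (Rmult_1_r (3 * L)) at 1. apply Rmult_le_compat_l; lra. }
      assert (Rabs (linp th1 t r) <= L).
      { destruct HP as (HD & Hc & B0 & B1 & Z0 & Z1).
        unfold linp, Rdiv. rewrite Rabs_mult, (Rabs_right (/ 2)) by lra.
        pose proof (B1 (t + r)). pose proof (B1 (t - r)).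
        pose proof (Rabs_triang (th1 (t + r)) (th1 (t - r))). lra. }
      pose proof (Rabs_triang (linp th1 t r) (- quot (lin th) (linp th1) t r)) as TR.
      rewrite Rabs_Ropp in TR. unfold Rminus at 1. lra.
    + rewrite Z by lra. destruct HP as (HD & Hc & B0 & B1 & Z0 & Z1).
      assert (M < Rabs (t + r)) by (apply Rlt_le_trans with (Rabs (t - r)); [lra | rabs]).
      unfold linp. rewrite (Z1 (t + r)), (Z1 (t - r)) by lra.
      replace ((0 + 0) / 2 - 0) with 0 by field. rewrite Rabs_R0.
      repeat apply Rmult_le_pos; lra.
Qed.

(** * Integral equations and initial data in terms of characteristics *)

Lemma Defs_RInt_eq (f : R -> R) (a b : R) : ex_RInt f a b -> Defs.RInt f a b = RInt f a b.
Proof.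
  intros H. unfold Defs.RInt. destruct ClassicalEpsilon.excluded_middle_informative as [h | h].
  - symmetry. apply RInt_Reals.
  - exfalso. apply h. constructor. now apply ex_RInt_Reals_0.
Qed.

Lemma Defs_RInt_ext (f h : R -> R) (a b : R) :
  (forall x, continuous h x) -> (forall x, Rmin a b <= x <= Rmax a b -> f x = h x) ->
  Defs.RInt f a b = RInt h a b.
Proof.
  intros Hh E. rewrite Defs_RInt_eq.
  - apply RInt_ext. intros x Hx. apply E. lra.
  - apply ex_RInt_ext with h; [| now apply ex_RInt_cont].
    intros x Hx. symmetry. apply E. lra.
Qed.

Lemma Gam_diff (G : R -> R -> R) (s a b : R) : cont2 G -> RInt (G s) a b = Gam G s b - Gam G s a.
Proof.
  intros HG. assert (Hc : forall x, continuous (G s) x) by (intros; cnt).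
  unfold Gam. rewrite <- (RInt_Chasles (V := R_CompleteNormedModule) (G s) a 0 b)
    by (apply ex_RInt_cont, Hc).
  rewrite <- (opp_RInt_swap (G s) 0 a) by (apply ex_RInt_cont, Hc).
  unfold plus, opp; simpl. ring.
Qed.

(** The operator sees only times between 0 and [t]. Hence [F] may come from a solution controlled
    for [s >= 0] alone, while [F'] is continuous on the whole plane. *)
Lemma Lop_eq (F F' : R -> R -> R) (t r : R) :
  cont2 F' -> 0 <= t -> r <> 0 -> (forall s y, 0 <= s -> F s y = F' s y) ->
  Lop F t r = cminus (Gam (fun s y => y * F' s y)) t r / r.
Proof.
  intros HF Ht Hr E. set (G := fun s y => y * F' s y).
  assert (HG : cont2 G) by (unfold G; cnt).
  assert (HGG := cont2_Gam G HG).
  unfold Lop.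
  rewrite (Defs_RInt_ext _ (fun s => Gam G s (r + 1 * (t - s)) - Gam G s (r + -1 * (t - s)))).
  - unfold cminus, charint.
    rewrite (RInt_minus (V := R_CompleteNormedModule)) by (apply ex_RInt_cont; intros; cnt).
    unfold minus, plus, opp; simpl. field. auto.
  - intros x. cnt.
  - intros s. rewrite Rmin_left, Rmax_right by lra. intros Hs.
    rewrite (Defs_RInt_ext _ (G s)).
    + rewrite Gam_diff by auto. f_equal; f_equal; ring.
    + intros; cnt.
    + intros y _. unfold G. now rewrite E by lra.
Qed.

Lemma bounded_of_compact_supp (h : R -> R) (M : R) :
  0 <= M -> (forall x, continuous h x) -> (forall x, M < Rabs x -> h x = 0) ->
  exists L, 0 < L /\ forall x, Rabs (h x) <= L.
Proof.
  intros HM Hc HZ.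
  destruct (continuity_ab_maj (fun x => Rabs (h x)) (- M) M ltac:(lra)) as [x0 [H0 _]].
  - intros c _. apply continuity_pt_filterlim.
    apply (continuous_Rabs_comp h c (Hc c)).
  - exists (Rabs (h x0) + 1). pose proof (Rabs_pos (h x0)). split; [lra |].
    intros x. destruct (Rle_dec (Rabs x) M) as [c | c].
    + assert (Rabs (h x) <= Rabs (h x0)) by (apply H0; rabs). lra.
    + rewrite HZ, Rabs_R0; lra.
Qed.

Lemma derive_zero_outside (h h1 : R -> R) (M : R) :
  (forall x, is_derive h x (h1 x)) -> (forall x, M < Rabs x -> h x = 0) ->
  forall x, M < Rabs x -> h1 x = 0.
Proof.
  intros HD HZ x Hx.
  assert (D : is_derive h x 0).
  { apply is_derive_ext_loc with (f := fun _ => 0); [| apply @is_derive_const].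
    assert (P : 0 < Rabs x - M) by lra.
    exists (mkposreal _ P). intros y Hy. change (Rabs (y - x) < Rabs x - M) in Hy.
    symmetry. apply HZ. rabs. }
  apply is_derive_unique in D. specialize (HD x). apply is_derive_unique in HD. lra.
Qed.

Lemma profile_of_data (f g : R -> R) :
  C2_0 f -> C1_0 g -> even_fun f -> even_fun g ->
  exists (M L : R) (th th1 th2 : R -> R), 0 <= M /\ 0 < L /\
    profile M L th th1 /\ profile M L th1 th2 /\
    forall t r, r <> 0 -> U0 f g t r = lin th t r / r.
Proof.
  intros [[Mf Hf0] [f1 [f2 [Hf1 [Hf2 Hfc]]]]] [[Mg Hg0] [g1 [Hg1 Hgc]]] Ef Eg.
  set (M := Rmax (Rmax Mf Mg) 0).
  assert (HM : 0 <= M) by apply Rmax_r.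
  assert (HMf : Mf <= M) by (unfold M; eapply Rle_trans; [apply Rmax_l | apply Rmax_l]).
  assert (HMg : Mg <= M) by (unfold M; eapply Rle_trans; [apply Rmax_r | apply Rmax_l]).
  assert (Df : forall x, is_derive f x (f1 x)) by (intros; now apply is_derive_Reals).
  assert (Df1 : forall x, is_derive f1 x (f2 x)) by (intros; now apply is_derive_Reals).
  assert (Dg : forall x, is_derive g x (g1 x)) by (intros; now apply is_derive_Reals).
  assert (Cf : forall x, continuous f x) by (intros; eapply is_derive_cont, Df).
  assert (Cf1 : forall x, continuous f1 x) by (intros; eapply is_derive_cont, Df1).
  assert (Cg : forall x, continuous g x) by (intros; eapply is_derive_cont, Dg).
  assert (Cf2 : forall x, continuous f2 x) by (intros; apply continuity_pt_filterlim, Hfc).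
  assert (Cg1 : forall x, continuous g1 x) by (intros; apply continuity_pt_filterlim, Hgc).
  set (G := fun (_ y : R) => y * g y).
  assert (HG : cont2 G) by (unfold G; cnt).
  assert (OG : odd_r G) by (intros s y; unfold G; rewrite Eg; ring).
  (* A profile is determined up to an additive constant, which cancels in [lin]. This choice makes
     [th] vanish to the right of [M], and since the primitive of the odd function [y * g y] is even,
     also to the left of [-M]. *)
  set (c := Gam G 0 M).
  set (th := fun x => x * f x + (Gam G 0 x - c)).
  set (th1 := fun x => (f x + x * f1 x) + x * g x).
  set (th2 := fun x => (f1 x + (f1 x + x * f2 x)) + (g x + x * g1 x)).
  assert (Dm : forall h h1 x, is_derive h x (h1 x) -> is_derive (fun y => y * h y) x (h x + x * h1 x)).
  { intros h h1 x D.
    pose proof (is_derive_mult (fun y : R => y) h x 1 _ (is_derive_id x) D Rmult_comm) as DD.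
    apply (is_derive_eq _ _ _ _ DD).
    unfold plus, mult; simpl. ring. }
  assert (D0 : forall x, is_derive th x (th1 x)).
  { intros x. apply (is_derive_plus (fun x => x * f x) (fun x => Gam G 0 x - c)).
    - now apply Dm.
    - replace (x * g x) with (G 0 x - 0) by (unfold G; ring).
      apply (is_derive_minus (Gam G 0) (fun _ => c)); [now apply is_derive_Gam | apply @is_derive_const]. }
  assert (D1 : forall x, is_derive th1 x (th2 x)).
  { intros x. apply (is_derive_plus (fun x => f x + x * f1 x) (fun x => x * g x)).
    - apply (is_derive_plus f (fun x => x * f1 x)); auto.
    - now apply Dm. }
  assert (C0 : forall x, continuous th x) by (intros; eapply is_derive_cont, D0).
  assert (C1 : forall x, continuous th1 x) by (intros; eapply is_derive_cont, D1).
  assert (C2 : forall x, continuous th2 x) by (intros; unfold th2; cnt).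
  assert (EG : forall x, Gam G 0 (Rabs x) = Gam G 0 x).
  { intros x. unfold Rabs. destruct Rcase_abs; auto. now apply Gam_even. }
  assert (Z0 : forall x, M < Rabs x -> th x = 0).
  { intros x Hx. unfold th. rewrite Hf0 by lra. rewrite <- EG.
    assert (E : Gam G 0 (Rabs x) - Gam G 0 M = 0).
    { rewrite <- Gam_diff by auto. rewrite (RInt_ext _ (fun _ => 0)).
      - rewrite RInt_const. unfold scal; simpl. unfold mult; simpl. ring.
      - intros y. rewrite Rmin_left, Rmax_right by lra. intros Hy. unfold G.
        rewrite Hg0; [apply Rmult_0_r |]. rewrite Rabs_right; lra. }
    unfold c. rewrite E. ring. }
  pose proof (derive_zero_outside th th1 M D0 Z0) as Z1.
  pose proof (derive_zero_outside th1 th2 M D1 Z1) as Z2.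
  destruct (bounded_of_compact_supp th M HM C0 Z0) as [L0 [HL0 B0]].
  destruct (bounded_of_compact_supp th1 M HM C1 Z1) as [L1 [HL1 B1]].
  destruct (bounded_of_compact_supp th2 M HM C2 Z2) as [L2 [HL2 B2]].
  exists M, (L0 + L1 + L2), th, th1, th2.
  assert (BB : forall x, Rabs (th x) <= L0 + L1 + L2 /\ Rabs (th1 x) <= L0 + L1 + L2
                      /\ Rabs (th2 x) <= L0 + L1 + L2).
  { intros x. specialize (B0 x). specialize (B1 x). specialize (B2 x). lra. }
  split; [auto | split; [lra | split; [| split]]].
  { unfold profile. split; [| split; [| split; [| split; [| split]]]]; auto; intros x; apply BB. }
  { unfold profile. split; [| split; [| split; [| split; [| split]]]]; auto; intros x; apply BB. }
  intros t r Hr. unfold U0.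
  rewrite (Defs_RInt_ext _ (G 0)).
  - rewrite Gam_diff by auto. unfold lin, th.
    replace (Gam G 0 (r - t)) with (Gam G 0 (t - r))
      by (rewrite <- (EG (t - r)), <- (EG (r - t)); f_equal; apply Rabs_minus_sym).
    replace (f (t - r)) with (f (r - t)) by (rewrite <- Ef; f_equal; ring).
    replace (t + r) with (r + t) by ring. field. auto.
  - intros; cnt.
  - intros y _. reflexivity.
Qed.

(** * Derivatives and continuity on the half-plane *)

Lemma hderiv_of_is_derive (phi : R -> R) (t l : R) : is_derive phi t l -> hderiv phi t l.
Proof.
  intros H eps Heps. apply is_derive_Reals in H. destruct (H eps Heps) as [d Hd].
  exists d. split; [apply cond_pos |]. intros tau _ Hne Hlt.
  specialize (Hd (tau - t) ltac:(lra) Hlt). now replace (t + (tau - t)) with tau in Hd by ring.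
Qed.

(** Increments [h > 0] decide, so [t = 0] is included. It identifies the field [ut] of an arbitrary
    solution, which is given only as a derivative of [u]. *)
Lemma hderiv_unique (phi : R -> R) (t l l' : R) :
  0 <= t -> hderiv phi t l -> hderiv phi t l' -> l = l'.
Proof.
  intros Ht H H'. destruct (Req_dec l l') as [| E]; auto. exfalso.
  assert (P : 0 < Rabs (l - l')) by (apply Rabs_pos_lt; lra).
  destruct (H (Rabs (l - l') / 2)) as [d [Hd B]]; [lra |].
  destruct (H' (Rabs (l - l') / 2)) as [d' [Hd' B']]; [lra |].
  set (h := Rmin d d' / 2).
  assert (Hh : 0 < h /\ h < d /\ h < d').
  { unfold h. pose proof (Rmin_l d d'). pose proof (Rmin_r d d').
    pose proof (Rmin_glb_lt d d' 0 Hd Hd'). lra. }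
  assert (Hr : Rabs (t + h - t) = h) by (replace (t + h - t) with h by ring; apply Rabs_right; lra).
  specialize (B (t + h) ltac:(lra) ltac:(lra) ltac:(lra)).
  specialize (B' (t + h) ltac:(lra) ltac:(lra) ltac:(lra)).
  rewrite Rabs_minus_sym in B.
  set (x := (phi (t + h) - phi t) / (t + h - t)) in *.
  assert (Rabs (l - l') <= Rabs (l - x) + Rabs (x - l')).
  { replace (l - l') with ((l - x) + (x - l')) by ring. apply Rabs_triang. }
  lra.
Qed.

Lemma hderiv_ext (phi psi : R -> R) (t l : R) :
  0 <= t -> (forall tau, 0 <= tau -> phi tau = psi tau) -> hderiv phi t l -> hderiv psi t l.
Proof.
  intros Ht E H eps Heps. destruct (H eps Heps) as [d [Hd B]].
  exists d. split; auto. intros tau H1 H2 H3. rewrite <- !E by auto. now apply B.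
Qed.

Lemma contH_of_cont2 (h : R -> R -> R) : cont2 h -> contH h.
Proof.
  intros H t r Ht eps Heps. destruct (cont2_pt h t r H (mkposreal eps Heps)) as [d Hd].
  exists d. split; [apply cond_pos |]. intros t' r' _ H1 H2. now apply Hd.
Qed.

Lemma cont2_freeze (h : R -> R -> R) : cont2 h -> cont2 (fun t r => h (Rmax t 0) r).
Proof. intros H. cnt. Qed.

Lemma contH_freeze (h : R -> R -> R) : contH h -> cont2 (fun t r => h (Rmax t 0) r).
Proof.
  intros H. apply (cont2_continuity_2d _ 0 0). intros t r eps.
  destruct (H (Rmax t 0) r (Rmax_r _ _) eps (cond_pos eps)) as [d [Hd B]].
  exists (mkposreal d Hd). simpl. intros t' r' H1 H2. apply B; auto; [apply Rmax_r |].
  eapply Rle_lt_trans; [| exact H1]. unfold Rmax. repeat destruct Rle_dec; rabs.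
Qed.

(** The integral equations are stated off the axis, because they divide by [r]; continuity carries
    them to [r = 0]. *)
Lemma eq_at0_of_continuous (f g : R -> R) :
  continuous f 0 -> continuous g 0 -> (forall r, r <> 0 -> f r = g r) -> f 0 = g 0.
Proof.
  intros Hf Hg E. apply Rminus_diag_uniq.
  destruct (Req_dec (f 0 - g 0) 0) as [| N]; auto. exfalso.
  apply Rabs_pos_lt in N.
  assert (C : continuous (fun r => f r - g r) 0) by now apply continuous_Rminus.
  destruct (proj1 (filterlim_locally _ _) C (mkposreal _ N)) as [d Hd].
  assert (Hd2 : 0 < d / 2 < d) by (pose proof (cond_pos d); lra).
  assert (B : ball 0 d (d / 2)).
  { change (Rabs (d / 2 - 0) < d). rewrite Rminus_0_r, Rabs_right; lra. }
  specialize (Hd _ B).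
  change (Rabs ((f (d / 2) - g (d / 2)) - (f 0 - g 0)) < Rabs (f 0 - g 0)) in Hd.
  rewrite (E (d / 2)) in Hd by lra.
  rewrite Rminus_diag, Rminus_0_l, Rabs_Ropp in Hd. lra.
Qed.

Lemma cminus_even (K : R -> R -> R) : cont2 K -> odd_r K -> even_r (cminus K).
Proof.
  intros HK HO t r. unfold cminus. rewrite !charint_odd by auto.
  replace (- (1)) with (-1) by ring. replace (- -1) with 1 by ring. field.
Qed.

(** * Regularity of waves *)

Section Wave.
Variables (e : R) (th th1 th2 : R -> R) (G g : R -> R -> R).
Hypotheses (Dth : forall x, is_derive th x (th1 x)) (Dth1 : forall x, is_derive th1 x (th2 x))
  (Cth2 : forall x, continuous th2 x).
Hypotheses (CG : cont2 G) (OG : odd_r G).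

Definition wave (t r : R) : R := e * lin th t r + cminus (Gam G) t r.
Definition wave_t (t r : R) : R := e * lin th1 t r + cplus G t r.
Definition wave_r (t r : R) : R := e * linp th1 t r + cminus G t r.
Definition wave_tr (t r : R) : R := e * linp th2 t r + cplus g t r.

Local Lemma cont2_scal_plus (c : R) (h k : R -> R -> R) :
  cont2 h -> cont2 k -> cont2 (fun t r => c * h t r + k t r).
Proof. intros. cnt. Qed.

Local Lemma Cth1 : forall x, continuous th1 x.
Proof using Dth1. intros x. eapply is_derive_cont, Dth1. Qed.
Local Lemma Cth : forall x, continuous th x.
Proof using Dth. intros x. eapply is_derive_cont, Dth. Qed.

Lemma cont2_wave : cont2 wave.
Proof using Dth CG. apply cont2_scal_plus; [apply cont2_lin, Cth | apply cont2_cminus, cont2_Gam, CG]. Qed.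

Lemma cont2_wave_t : cont2 wave_t.
Proof using Dth1 CG. apply cont2_scal_plus; [apply cont2_lin, Cth1 | apply cont2_cplus, CG]. Qed.

Lemma cont2_wave_r : cont2 wave_r.
Proof using Dth1 CG. apply cont2_scal_plus; [apply cont2_linp, Cth1 | apply cont2_cminus, CG]. Qed.

Lemma is_derive_wave_t (t r : R) : is_derive (fun t => wave t r) t (wave_t t r).
Proof using Dth CG.
  apply (is_derive_plus (fun t => e * lin th t r) (fun t => cminus (Gam G) t r)).
  - apply (is_derive_scal (fun t => lin th t r)). now apply is_derive_lin_t.
  - apply is_derive_cminus_t; auto using cont2_Gam. intros. now apply is_derive_Gam.
Qed.

Lemma is_derive_wave_r (t r : R) : is_derive (wave t) r (wave_r t r).
Proof using Dth CG.
  apply (is_derive_plus (fun r => e * lin th t r) (cminus (Gam G) t)).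
  - apply (is_derive_scal (lin th t)). now apply is_derive_lin_r.
  - apply is_derive_cminus_r; auto using cont2_Gam. intros. now apply is_derive_Gam.
Qed.

Lemma wave_odd : odd_r wave.
Proof using CG OG.
  intros t r. unfold wave. rewrite lin_odd, cminus_Gam_odd by auto. ring.
Qed.

Lemma wave_quot_cont2 : cont2 (quot wave wave_r).
Proof using Dth Dth1 CG OG.
  apply cont2_quot; auto using cont2_wave, cont2_wave_r, is_derive_wave_r.
  intros t. apply odd_at_0, wave_odd.
Qed.

Lemma wave_t_odd : odd_r (wave_t).
Proof using CG OG.
  intros t r. unfold wave_t. rewrite lin_odd, cplus_odd by auto. ring.
Qed.

Lemma wave_r_even : even_r wave_r.
Proof using CG OG.
  intros t r. unfold wave_r. rewrite linp_even, cminus_even; auto.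
Qed.

Section SecondOrder.
Hypotheses (Cg : cont2 g) (DG : forall s y, is_derive (G s) y (g s y)).

Lemma cont2_wave_tr : cont2 wave_tr.
Proof using Cth2 Cg. apply cont2_scal_plus; [apply cont2_linp, Cth2 | apply cont2_cplus, Cg]. Qed.

Lemma is_derive_wave_tr (t r : R) : is_derive (wave_t t) r (wave_tr t r).
Proof using Dth1 CG Cg DG.
  apply (is_derive_plus (fun r => e * lin th1 t r) (cplus G t)).
  - apply (is_derive_scal (lin th1 t)). now apply is_derive_lin_r.
  - now apply is_derive_cplus_r.
Qed.

(** The second derivatives in [t] and in [r] differ by [G], which is the one-dimensional wave
    equation. Integrals along characteristics depend on the vertex through their label and endpoint,
    so the radial derivative [g] of the source is the only derivative of it that enters. *)
Lemma wave_C2H : C2H wave.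
Proof using All.
  exists wave_t, wave_r,
    (fun t r => e * lin th2 t r + (G t r + cminus g t r)), wave_tr, wave_tr,
    (fun t r => e * lin th2 t r + cminus g t r).
  split.
  - intros t r _. repeat split.
    + apply hderiv_of_is_derive, is_derive_wave_t.
    + apply is_derive_Reals, is_derive_wave_r.
    + apply hderiv_of_is_derive.
      apply (is_derive_plus (fun t => e * lin th1 t r) (fun t => cplus G t r)).
      * apply (is_derive_scal (fun t => lin th1 t r)). now apply is_derive_lin_t.
      * now apply is_derive_cplus_t.
    + apply is_derive_Reals, is_derive_wave_tr.
    + apply hderiv_of_is_derive.
      apply (is_derive_plus (fun t => e * linp th1 t r) (fun t => cminus G t r)).
      * apply (is_derive_scal (fun t => linp th1 t r)). now apply is_derive_linp_t.
      * now apply is_derive_cminus_t.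
    + apply is_derive_Reals.
      apply (is_derive_plus (fun r => e * linp th1 t r) (cminus G t)).
      * apply (is_derive_scal (linp th1 t)). now apply is_derive_linp_r.
      * now apply is_derive_cminus_r.
  - assert (CM := cont2_cminus g Cg).
    repeat split; apply contH_of_cont2; auto using cont2_wave, cont2_wave_t, cont2_wave_r, cont2_wave_tr.
    + apply cont2_scal_plus; [apply cont2_lin, Cth2 | cnt].
    + apply cont2_scal_plus; [apply cont2_lin, Cth2 | auto].
Qed.

(** Off the axis [r] is a constant factor. On the axis the quotient is [wave_r], and its time
    derivative equals the radial derivative of [wave_t] because the explicit formulas for the two
    mixed derivatives agree. *)
Lemma is_derive_wave_quot_t (t r : R) :
  is_derive (fun t => quot wave wave_r t r) t (quot wave_t wave_tr t r).
Proof using All.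
  destruct (Req_EM_T r 0) as [-> | E].
  - rewrite quot_at0. apply is_derive_ext with (f := fun t => wave_r t 0).
    + intros. now rewrite quot_at0.
    + apply (is_derive_plus (fun t => e * linp th1 t 0) (fun t => cminus G t 0)).
      * apply (is_derive_scal (fun t => linp th1 t 0)). now apply is_derive_linp_t.
      * now apply is_derive_cminus_t.
  - rewrite quot_neq0 by auto.
    apply is_derive_ext with (f := fun t => / r * wave t r).
    + intros y. rewrite quot_neq0 by auto. unfold Rdiv. apply Rmult_comm.
    + unfold Rdiv. rewrite Rmult_comm. apply (is_derive_scal (fun t => wave t r)), is_derive_wave_t.
Qed.

End SecondOrder.
End Wave.

(** * Comparison of the two families of weights *)

Lemma jb_pos (x : R) : 1 <= jb x.
Proof. unfold jb. rewrite <- sqrt_1 at 1. apply sqrt_le_1_alt. pose proof (pow2_ge_0 x). lra. Qed.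

Lemma jb_le_br (x : R) : jb x <= br x.
Proof.
  unfold jb, br. rewrite <- (sqrt_Rsqr (1 + Rabs x)) by (pose proof (Rabs_pos x); lra).
  apply sqrt_le_1_alt. unfold Rsqr. rewrite <- (pow2_abs x). pose proof (Rabs_pos x). nra.
Qed.

Lemma br_le_2jb (x : R) : br x <= 2 * jb x.
Proof.
  unfold br. pose proof (jb_pos x).
  assert (Rabs x <= jb x); [| lra].
  unfold jb. rewrite <- (sqrt_Rsqr (Rabs x)) by apply Rabs_pos.
  apply sqrt_le_1_alt. unfold Rsqr. rewrite <- (pow2_abs x). nra.
Qed.

Lemma Rpower_jb_bp (x a : R) : 0 <= a -> Rpower (jb x) a * bp x (- a) <= 1.
Proof.
  intros Ha. rewrite <- (bp_inv x a). apply Rmult_le_compat_r; [left; apply bp_pos |].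
  apply Rle_Rpower_l; auto. pose proof (jb_pos x). split; [lra | apply jb_le_br].
Qed.

Lemma Rmult_le_1 (a b : R) : 0 <= a -> 0 <= b -> a <= 1 -> b <= 1 -> a * b <= 1.
Proof. intros. rewrite <- (Rmult_1_r 1). now apply Rmult_le_compat. Qed.

Lemma jb_bp_m1 (x : R) : jb x * bp x (-1) <= 1.
Proof. rewrite <- (Rpower_1 (jb x)) by (pose proof (jb_pos x); lra). apply (Rpower_jb_bp x 1). lra. Qed.

Lemma w2_iw2 (p mu t r : R) : 2 <= p -> 0 <= mu -> 3 <= p + mu -> w2 p mu t r * iw2 p mu t r <= 1.
Proof.
  intros Hp Hmu Hpmu. pose proof (jb_pos (t + r)).
  assert (P : forall x a, 0 <= Rpower (jb x) a * bp x (- a))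
    by (intros; apply Rmult_le_pos; left; [apply Rpower_pos | apply bp_pos]).
  unfold w2, iw2. destruct Rlt_dec.
  - replace (2 - p) with (- (p - 2)) by ring.
    replace (Rpower (jb r) (p - 2) * Rpower (jb (t + r)) mu * (bp r (- (p - 2)) * bp (t + r) (- mu)))
      with ((Rpower (jb r) (p - 2) * bp r (- (p - 2))) * (Rpower (jb (t + r)) mu * bp (t + r) (- mu))) by ring.
    apply Rmult_le_1; auto; apply Rpower_jb_bp; lra.
  - replace (3 - p - mu) with (- (p - 3 + mu)) by ring.
    replace (Rpower (jb (t - r)) (p - 3 + mu) * jb (t + r) * (bp (t - r) (- (p - 3 + mu)) * bp (t + r) (-1)))
      with ((Rpower (jb (t - r)) (p - 3 + mu) * bp (t - r) (- (p - 3 + mu))) * (jb (t + r) * bp (t + r) (-1))) by ring.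
    apply Rmult_le_1; auto; [| apply Rpower_jb_bp; lra | apply jb_bp_m1].
    apply Rmult_le_pos; [lra | left; apply bp_pos].
Qed.

(** * Contraction in the weighted ball *)

Definition adm (w : R -> R -> R) : Prop := cont2 w /\ even_r w.

(* Reciprocal of the weight [w1], with [br] in place of [jb]. *)
Definition iw1 (p mu t r : R) : R := bp r (-1) * bp (t - Rabs r) (- (mu / p)).

Lemma iw1_pos (p mu t r : R) : 0 < iw1 p mu t r.
Proof. apply Rmult_lt_0_compat; apply bp_pos. Qed.

Lemma Rpower_split (x a : R) : 0 < x -> Rpower x a = Rpower x (a - 1) * x.
Proof.
  intros Hx. rewrite <- (Rpower_1 x) at 3 by auto. rewrite <- Rpower_plus. f_equal. ring.
Qed.

Definition wball (p mu K : R) (w : R -> R -> R) : Prop :=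
  adm w /\ forall t r, 0 <= t -> Rabs (w t r) <= K * iw1 p mu t r.

Definition wclose (p mu D : R) (w w' : R -> R -> R) : Prop :=
  forall t r, 0 <= t -> Rabs (w t r - w' t r) <= D * iw1 p mu t r.

Lemma half_pow_small (K eps : R) : 0 < eps -> exists N, forall n, (N <= n)%nat -> K * (/ 2) ^ n < eps.
Proof.
  intros He.
  destruct (pow_lt_1_zero (/ 2) ltac:(rewrite Rabs_right; lra) (eps / (Rabs K + 1))) as [N HN].
  { apply Rdiv_lt_0_compat; auto. pose proof (Rabs_pos K). lra. }
  exists N. intros n Hn. specialize (HN n Hn).
  assert (P : 0 < (/ 2) ^ n) by (apply pow_lt; lra).
  rewrite Rabs_right in HN by lra. pose proof (Rabs_pos K). pose proof (Rle_abs K).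
  apply Rle_lt_trans with ((Rabs K + 1) * (/ 2) ^ n).
  - apply Rmult_le_compat_r; lra.
  - replace eps with ((Rabs K + 1) * (eps / (Rabs K + 1))) by (field; lra).
    apply Rmult_lt_compat_l; lra.
Qed.

Lemma cont2_uniform_limit (W : nat -> R -> R -> R) (w : R -> R -> R) (K : R) :
  (forall n, cont2 (W n)) -> (forall n t r, Rabs (w t r - W n t r) <= K * (/ 2) ^ n) -> cont2 w.
Proof.
  intros HW HU. apply (cont2_continuity_2d _ 0 0). intros t r eps.
  assert (He : 0 < eps / 3) by (pose proof (cond_pos eps); lra).
  destruct (half_pow_small K (eps / 3) He) as [N HN]. specialize (HN N (Nat.le_refl N)).
  destruct (cont2_pt (W N) t r (HW N) (mkposreal _ He)) as [d Hd].
  exists d. intros t' r' Ht Hr. specialize (Hd t' r' Ht Hr). simpl in Hd.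
  pose proof (HU N t' r'). pose proof (HU N t r) as B. rewrite Rabs_minus_sym in B.
  replace (w t' r' - w t r)
    with ((w t' r' - W N t' r') + ((W N t' r' - W N t r) + (W N t r - w t r))) by ring.
  eapply Rle_lt_trans; [apply Rabs_triang |].
  eapply Rle_lt_trans; [apply Rplus_le_compat_l, Rabs_triang |]. lra.
Qed.

Section FixedPoint.
Variables p mu K : R.
Variable Phi : (R -> R -> R) -> R -> R -> R.
Hypotheses (Hp : 0 < p) (Hmu : 0 < mu) (HK : 0 < K).
Hypothesis Hself : forall w, wball p mu K w -> wball p mu K (Phi w).
Hypothesis Hcontr : forall D w w', 0 <= D -> wball p mu K w -> wball p mu K w' ->
  wclose p mu D w w' -> wclose p mu (D / 2) (Phi w) (Phi w').
(** Weighted bounds are available for [t >= 0] only; this property transfers them to the whole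
    plane, where continuity of the limit is asked for. *)
Hypothesis Hfr : forall w t r, Phi w t r = Phi w (Rmax t 0) r.

Local Lemma iw1_le1 (t r : R) : iw1 p mu t r <= 1.
Proof using Hp Hmu.
  unfold iw1. rewrite <- (Rmult_1_r 1).
  assert (0 < mu / p) by now apply Rdiv_lt_0_compat.
  apply Rmult_le_compat; try (left; apply bp_pos); apply bp_le1; lra.
Qed.

Lemma close_of_balls (w w' : R -> R -> R) :
  wball p mu K w -> wball p mu K w' -> wclose p mu (2 * K) w w'.
Proof using.
  intros [_ H] [_ H'] t r Ht. specialize (H t r Ht). specialize (H' t r Ht).
  eapply Rle_trans; [apply Rabs_triang |]. rewrite Rabs_Ropp. lra.
Qed.

Lemma fixed_point_unique (w w' : R -> R -> R) :
  wball p mu K w -> wball p mu K w' -> (forall t r, w t r = Phi w t r) ->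
  (forall t r, w' t r = Phi w' t r) -> forall t r, w t r = w' t r.
Proof using Hp Hmu HK Hcontr Hfr.
  intros HB HB' HF HF' t r.
  assert (HC : forall n, wclose p mu (2 * K * (/ 2) ^ n) w w').
  { induction n as [| n IH].
    - rewrite pow_O, Rmult_1_r. now apply close_of_balls.
    - intros t0 r0 Ht0. rewrite HF, HF'.
      replace (2 * K * (/ 2) ^ S n) with (2 * K * (/ 2) ^ n / 2) by (simpl; field).
      apply Hcontr; auto. apply Rmult_le_pos; [lra | apply pow_le; lra]. }
  rewrite HF, HF', Hfr, (Hfr w'), <- HF, <- HF'. set (t' := Rmax t 0).
  assert (Ht' : 0 <= t') by apply Rmax_r.
  apply Rminus_diag_uniq. destruct (Req_dec (w t' r - w' t' r) 0) as [| E]; auto. exfalso.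
  apply Rabs_pos_lt in E.
  destruct (half_pow_small (2 * K) _ E) as [N HN]. specialize (HN N (Nat.le_refl N)).
  specialize (HC N t' r Ht'). pose proof (iw1_le1 t' r).
  assert (P : 0 <= 2 * K * (/ 2) ^ N) by (apply Rmult_le_pos; [lra | apply pow_le; lra]).
  pose proof (Rmult_le_compat_l _ _ _ P H). lra.
Qed.

(** Iteration from 0. The weighted rate puts the limit in the ball, and since [iw1 <= 1] it is also
    a uniform rate, which makes the limit continuous. *)
Lemma fixed_point_exists : exists w, wball p mu K w /\ forall t r, w t r = Phi w t r.
Proof using Hp Hmu HK Hself Hcontr Hfr.
  set (W := fun n => Nat.iter n Phi (fun _ _ => 0)).
  assert (HB : forall n, wball p mu K (W n)).
  { induction n as [| n IH]; [| now apply Hself].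
    split; [split |].
    - intros z. apply continuous_const.
    - intros s y. reflexivity.
    - intros t r Ht. change (W 0%nat t r) with 0. rewrite Rabs_R0.
      apply Rmult_le_pos; [lra | left; apply iw1_pos]. }
  assert (HS : forall n, wclose p mu (2 * K * (/ 2) ^ n) (W (S n)) (W n)).
  { induction n as [| n IH].
    - rewrite pow_O, Rmult_1_r. now apply close_of_balls.
    - replace (2 * K * (/ 2) ^ S n) with (2 * K * (/ 2) ^ n / 2) by (simpl; field).
      apply (Hcontr _ (W (S n)) (W n)); auto. apply Rmult_le_pos; [lra | apply pow_le; lra]. }
  (* [2 * K] bounds the distance of two elements of the ball, hence the first step; [4 * K] is the
     sum of the geometric series of steps, kept with its remainder so that the induction closes. *)
  assert (HT : forall n k, wclose p mu (4 * K * ((/ 2) ^ n - (/ 2) ^ (k + n))) (W (k + n)%nat) (W n)).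
  { intros n k t r Ht. induction k as [| k IH].
    - simpl. rewrite Rminus_diag, Rabs_R0. right; ring.
    - specialize (HS (k + n)%nat t r Ht).
      replace (W (S k + n)%nat t r - W n t r)
        with ((W (S (k + n)) t r - W (k + n)%nat t r) + (W (k + n)%nat t r - W n t r))
        by (simpl; ring).
      eapply Rle_trans; [apply Rabs_triang |].
      eapply Rle_trans; [apply Rplus_le_compat; [exact HS | exact IH] |].
      right. change (S k + n)%nat with (S (k + n)). rewrite <- tech_pow_Rmult. field. }
  assert (HFr : forall n t r, W n t r = W n (Rmax t 0) r).
  { intros [| n] t r; [reflexivity | apply (Hfr (W n))]. }
  assert (HT1 : forall n k t r, Rabs (W (k + n)%nat t r - W n t r) <= 4 * K * (/ 2) ^ n * iw1 p mu (Rmax t 0) r).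
  { intros n k t r. rewrite (HFr _ t r), (HFr n t r).
    eapply Rle_trans; [apply HT, Rmax_r |].
    apply Rmult_le_compat_r; [left; apply iw1_pos |]. apply Rmult_le_compat_l; [lra |].
    assert (0 < (/ 2) ^ (k + n)) by (apply pow_lt; lra). lra. }
  assert (HT2 : forall n k t r, Rabs (W (k + n)%nat t r - W n t r) <= 4 * K * (/ 2) ^ n).
  { intros n k t r. eapply Rle_trans; [apply HT1 |]. rewrite <- (Rmult_1_r (4 * K * (/ 2) ^ n)) at 2.
    apply Rmult_le_compat_l; [| apply iw1_le1]. apply Rmult_le_pos; [lra | apply pow_le; lra]. }
  set (w := fun t r => real (Lim_seq (fun n => W n t r))).
  assert (HL : forall t r, is_lim_seq (fun n => W n t r) (w t r)).
  { intros t r. apply Lim_seq_correct'. apply ex_lim_seq_cauchy_corr. intros eps.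
    assert (He : 0 < eps / 2) by (pose proof (cond_pos eps); lra).
    destruct (half_pow_small (4 * K) (eps / 2) He) as [N HN]. specialize (HN N (Nat.le_refl N)).
    exists N. intros n m Hn Hm.
    pose proof (HT2 N (n - N)%nat t r) as B1. pose proof (HT2 N (m - N)%nat t r) as B2.
    replace (n - N + N)%nat with n in B1 by lia. replace (m - N + N)%nat with m in B2 by lia.
    rewrite Rabs_minus_sym in B2.
    replace (W n t r - W m t r) with ((W n t r - W N t r) + (W N t r - W m t r)) by ring.
    eapply Rle_lt_trans; [apply Rabs_triang |]. lra. }
  assert (HLn : forall n t r, Rabs (w t r - W n t r) <= 4 * K * (/ 2) ^ n * iw1 p mu (Rmax t 0) r).
  { intros n t r.
    apply (is_lim_seq_le (fun k => Rabs (W (k + n)%nat t r - W n t r))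
             (fun _ => 4 * K * (/ 2) ^ n * iw1 p mu (Rmax t 0) r)
             (Rabs (w t r - W n t r)) (4 * K * (/ 2) ^ n * iw1 p mu (Rmax t 0) r)).
    - intros k. apply HT1.
    - apply (is_lim_seq_abs _ (Finite (w t r - W n t r))).
      apply (is_lim_seq_minus' (fun k => W (k + n)%nat t r) (fun _ => W n t r)).
      + now apply (is_lim_seq_incr_n (fun k => W k t r)).
      + apply is_lim_seq_const.
    - apply is_lim_seq_const. }
  assert (HLu : forall n t r, Rabs (w t r - W n t r) <= 4 * K * (/ 2) ^ n).
  { intros n t r. eapply Rle_trans; [apply HLn |]. rewrite <- (Rmult_1_r (4 * K * (/ 2) ^ n)) at 2.
    apply Rmult_le_compat_l; [| apply iw1_le1]. apply Rmult_le_pos; [lra | apply pow_le; lra]. }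
  assert (HwB : wball p mu K w).
  { split; [split |].
    - apply (cont2_uniform_limit W w (4 * K)); auto. intros n. apply HB.
    - intros t r. unfold w. f_equal. apply Lim_seq_ext. intros n. apply HB.
    - intros t r Ht.
      apply (is_lim_seq_le (fun n => Rabs (W n t r)) (fun _ => K * iw1 p mu t r)
               (Rabs (w t r)) (K * iw1 p mu t r)).
      + intros n. now apply HB.
      + now apply (is_lim_seq_abs _ (Finite (w t r))).
      + apply is_lim_seq_const. }
  exists w. split; auto. intros t r.
  assert (Hwf : w t r = w (Rmax t 0) r).
  { unfold w. f_equal. apply Lim_seq_ext. intros n. apply HFr. }
  rewrite Hwf, Hfr. set (t' := Rmax t 0). assert (Ht' : 0 <= t') by apply Rmax_r.
  assert (HC : forall n, wclose p mu (4 * K * (/ 2) ^ n) w (W n)).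
  { intros n t0 r0 Ht0. pose proof (HLn n t0 r0) as B. now rewrite Rmax_left in B by lra. }
  apply Rminus_diag_uniq. destruct (Req_dec (w t' r - Phi w t' r) 0) as [| E]; auto. exfalso.
  apply Rabs_pos_lt in E.
  (* The distance to the limit and the contraction each contribute [2 * K * (/ 2) ^ N], well below
     this threshold. *)
  destruct (half_pow_small (8 * K) _ E) as [N HN]. specialize (HN N (Nat.le_refl N)).
  assert (PN : 0 < (/ 2) ^ N) by (apply pow_lt; lra).
  pose proof (HLu (S N) t' r) as B1.
  pose proof (Hcontr (4 * K * (/ 2) ^ N) (W N) w
     ltac:(apply Rmult_le_pos; lra) (HB N) HwB
     ltac:(intros t0 r0 Ht0; rewrite Rabs_minus_sym; now apply HC) t' r Ht') as B2.
  change (Phi (W N) t' r) with (W (S N) t' r) in B2.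
  pose proof (iw1_le1 t' r) as B3.
  assert (P : 0 <= 4 * K * (/ 2) ^ N / 2) by (apply Rmult_le_pos; [apply Rmult_le_pos |]; lra).
  pose proof (Rmult_le_compat_l _ _ _ P B3).
  assert (PK : 0 < K * (/ 2) ^ N) by now apply Rmult_lt_0_compat.
  simpl pow in B1.
  assert (Rabs (w t' r - Phi w t' r) <= Rabs (w t' r - W (S N) t' r) + Rabs (W (S N) t' r - Phi w t' r)).
  { replace (w t' r - Phi w t' r) with ((w t' r - W (S N) t' r) + (W (S N) t' r - Phi w t' r)) by ring.
    apply Rabs_triang. }
  lra.
Qed.

End FixedPoint.

Lemma Rpower_small (a c : R) : 0 < a -> 0 < c ->
  exists d, 0 < d /\ forall x, 0 < x < d -> Rpower x a <= c.
Proof.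
  intros Ha Hc. destruct (powabs_small a c Ha Hc) as [d [Hd H]].
  exists d. split; auto. intros x Hx.
  specialize (H x ltac:(rewrite Rabs_right; lra)).
  rewrite powabs_neq0, Rabs_right in H by lra. lra.
Qed.

(** The three inequalities bound [v], then the new [∂_t u], then the Lipschitz constant of the
    iteration. The nonlinear terms have a positive power of [e] to spare, so the radius [K] may
    exceed [B] by any fixed factor, expressed by the free constant [k]. *)
Lemma smallness (p q C0 C1 C2 k : R) :
  2 < p -> 2 < q -> 0 < C0 -> 0 < C1 -> 0 < C2 -> 0 < k ->
  exists eps0, 0 < eps0 /\ forall e, 0 < e < eps0 ->
    let K := k * e in let B := 2 * C0 * e in
    e * C0 + C1 * Rpower K p <= B /\
    e * C0 + C2 * ((1 + q) * Rpower B q) <= 2 * C0 * e /\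
    C2 * ((q + q * q) * Rpower B (q - 1) * (C1 * (p * Rpower K (p - 1)))) <= / 2.
Proof.
  intros Hp Hq HC0 HC1 HC2 Hk.
  pose proof (Rpower_pos k p) as K1. pose proof (Rpower_pos k (p - 1)) as K2.
  pose proof (Rpower_pos (2 * C0) q) as B1. pose proof (Rpower_pos (2 * C0) (q - 1)) as B2.
  assert (Split : forall x e a, 0 < x -> 0 < e -> Rpower (x * e) a = Rpower x a * Rpower e a)
    by (intros; now rewrite Rpower_mult_distr).
  assert (Lower : forall e a, 0 < e -> Rpower e a = Rpower e (a - 1) * e)
    by (intros; now apply Rpower_split).
  destruct (Rpower_small (p - 1) (C0 / (C1 * Rpower k p))) as [d1 [Hd1 S1]]; [lra | |].
  { apply Rdiv_lt_0_compat; auto. now apply Rmult_lt_0_compat. }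
  destruct (Rpower_small (q - 1) (C0 / (C2 * ((1 + q) * Rpower (2 * C0) q)))) as [d2 [Hd2 S2]]; [lra | |].
  { apply Rdiv_lt_0_compat; auto. repeat apply Rmult_lt_0_compat; lra. }
  set (X := C2 * ((q + q * q) * Rpower (2 * C0) (q - 1) * (C1 * (p * Rpower k (p - 1))))).
  assert (HX : 0 < X).
  { unfold X. repeat apply Rmult_lt_0_compat; try lra. nra. }
  destruct (Rpower_small (q - 1) (/ 2 / X)) as [d3 [Hd3 S3]]; [lra | |].
  { apply Rdiv_lt_0_compat; lra. }
  exists (Rmin 1 (Rmin d1 (Rmin d2 d3))).
  split. { repeat apply Rmin_glb_lt; lra. }
  intros e [He He'].
  pose proof (Rmin_l 1 (Rmin d1 (Rmin d2 d3))). pose proof (Rmin_r 1 (Rmin d1 (Rmin d2 d3))).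
  pose proof (Rmin_l d1 (Rmin d2 d3)). pose proof (Rmin_r d1 (Rmin d2 d3)).
  pose proof (Rmin_l d2 d3). pose proof (Rmin_r d2 d3).
  specialize (S1 e ltac:(lra)). specialize (S2 e ltac:(lra)). specialize (S3 e ltac:(lra)).
  intros K B. unfold K, B. rewrite !(Split k e), !(Split (2 * C0) e) by lra.
  split; [| split].
  - rewrite (Lower e p) by auto.
    apply (Rmult_le_compat_r e) in S1; [| lra].
    apply (Rmult_le_compat_l (C1 * Rpower k p)) in S1; [| left; now apply Rmult_lt_0_compat].
    replace (C1 * Rpower k p * (C0 / (C1 * Rpower k p) * e)) with (C0 * e) in S1 by (field; lra).
    lra.
  - rewrite (Lower e q) by auto.
    assert (P : 0 < C2 * ((1 + q) * Rpower (2 * C0) q)) by (repeat apply Rmult_lt_0_compat; lra).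
    apply (Rmult_le_compat_r e) in S2; [| lra].
    apply (Rmult_le_compat_l (C2 * ((1 + q) * Rpower (2 * C0) q))) in S2; [| lra].
    replace (C2 * ((1 + q) * Rpower (2 * C0) q) * (C0 / (C2 * ((1 + q) * Rpower (2 * C0) q)) * e))
      with (C0 * e) in S2 by (field; lra).
    lra.
  - assert (E1 : Rpower e (p - 1) <= 1).
    { apply Rle_trans with (Rpower 1 (p - 1)); [apply Rle_Rpower_l; lra |].
      right. unfold Rpower. now rewrite ln_1, Rmult_0_r, exp_0. }
    pose proof (Rpower_pos e (p - 1)). pose proof (Rpower_pos e (q - 1)).
    apply Rle_trans with (X * (Rpower e (q - 1) * Rpower e (p - 1))); [unfold X; right; ring |].
    apply Rle_trans with (X * (Rpower e (q - 1) * 1)).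
    + apply Rmult_le_compat_l; [lra |]. apply Rmult_le_compat_l; lra.
    + rewrite Rmult_1_r. apply (Rmult_le_compat_l X) in S3; [| lra].
      replace (X * (/ 2 / X)) with (/ 2) in S3 by (field; lra). lra.
Qed.

(** * The iteration map and its fixed points *)

Section Map.
Variables p q mu e : R.
Variables tu tu1 tu2 tv tv1 tv2 : R -> R.
Hypotheses (Hq : 2 < q) (Hp : 2 < p) (Hp3 : p < 3) (Hmu : 3 - p < mu) (Hmu1 : mu < 1)
  (Hpq : p * (2 - (p - 2) * q) < (p * q - 1) * mu).
Hypotheses (Du : forall x, is_derive tu x (tu1 x)) (Du1 : forall x, is_derive tu1 x (tu2 x))
  (Cu2 : forall x, continuous tu2 x).
Hypotheses (Dv : forall x, is_derive tv x (tv1 x)) (Dv1 : forall x, is_derive tv1 x (tv2 x))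
  (Cv2 : forall x, continuous tv2 x).


(* Everything is a function of [w = ∂_t u]: [Gv] is [r |w|^p], [Nv] is [r v], [vof] is [v], [Gu] is
   [r |v|^q] with radial derivative [gu], and [Nut], [wof] are the new [r ∂_t u], [∂_t u]. *)
Definition Gv (w : R -> R -> R) (s y : R) : R := y * powabs (w s y) p.
Definition Nv (w : R -> R -> R) : R -> R -> R := wave e tv (Gv w).
Definition Nvr (w : R -> R -> R) : R -> R -> R := wave_r e tv1 (Gv w).
Definition vof (w : R -> R -> R) : R -> R -> R := quot (Nv w) (Nvr w).
Definition Gu (w : R -> R -> R) (s y : R) : R := y * powabs (vof w s y) q.
Definition gu (w : R -> R -> R) (s y : R) : R :=
  powabs (vof w s y) q + q * dpow (vof w s y) (q - 1) * (Nvr w s y - vof w s y).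
Definition Nut (w : R -> R -> R) : R -> R -> R := wave_t e tu1 (Gu w).
Definition Nutr (w : R -> R -> R) : R -> R -> R := wave_tr e tu2 (gu w).
Definition wof (w : R -> R -> R) : R -> R -> R := quot (Nut w) (Nutr w).


Lemma cont2_Gv (w : R -> R -> R) : cont2 w -> cont2 (Gv w).
Proof using Hp.
  intros Hw. unfold Gv. intros z.
  apply continuous_Rmult; [cnt |].
  apply (continuous_app (fun y => powabs y p)); [intros; apply continuous_powabs; lra | apply Hw].
Qed.

Lemma Gv_odd (w : R -> R -> R) : even_r w -> odd_r (Gv w).
Proof using. intros H s y. unfold Gv. rewrite H. ring. Qed.

Lemma cont2_Nv (w : R -> R -> R) : cont2 w -> cont2 (Nv w).
Proof using Dv Hp.
  intros Hw. apply (cont2_wave e tv tv1); auto using cont2_Gv.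
Qed.

Lemma cont2_Nvr (w : R -> R -> R) : cont2 w -> cont2 (Nvr w).
Proof using Dv1 Hp.
  intros Hw. apply (cont2_wave_r e tv1 tv2); auto using cont2_Gv.
Qed.

Lemma is_derive_Nv (w : R -> R -> R) (t r : R) : cont2 w -> is_derive (Nv w t) r (Nvr w t r).
Proof using Dv Hp.
  intros Hw. apply is_derive_wave_r; auto using cont2_Gv.
Qed.

Lemma Nv_odd (w : R -> R -> R) : adm w -> odd_r (Nv w).
Proof using Hp.
  intros [Hw Ew]. apply wave_odd; auto using cont2_Gv, Gv_odd.
Qed.

Lemma Nvr_even (w : R -> R -> R) : adm w -> even_r (Nvr w).
Proof using Hp.
  intros [Hw Ew]. apply wave_r_even; auto using cont2_Gv, Gv_odd.
Qed.

Lemma adm_vof (w : R -> R -> R) : adm w -> adm (vof w).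
Proof using Dv Dv1 Hp.
  intros Hw. split.
  - destruct Hw as [Hc He]. apply cont2_quot.
    + now apply cont2_Nv.
    + now apply cont2_Nvr.
    + intros. now apply is_derive_Nv.
    + intros t. apply odd_at_0. apply Nv_odd. now split.
  - apply quot_even. now apply Nv_odd.
Qed.

Lemma cont2_Gu (w : R -> R -> R) : adm w -> cont2 (Gu w).
Proof using Dv Dv1 Hp Hq.
  intros Hw. destruct (adm_vof w Hw) as [Hv _]. unfold Gu. intros z.
  apply continuous_Rmult; [cnt |].
  apply (continuous_app (fun y => powabs y q)); [intros; apply continuous_powabs; lra | apply Hv].
Qed.

Lemma Gu_odd (w : R -> R -> R) : adm w -> odd_r (Gu w).
Proof using Dv Dv1 Hp.
  intros Hw s y. destruct (adm_vof w Hw) as [_ He]. unfold Gu. rewrite He. ring.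
Qed.

Lemma cont2_gu (w : R -> R -> R) : adm w -> cont2 (gu w).
Proof using Dv Dv1 Hp Hq.
  intros Hw. destruct (adm_vof w Hw) as [Hv _]. destruct Hw as [Hw _].
  pose proof (cont2_Nvr w Hw) as Hr. unfold gu. intros z.
  apply continuous_Rplus.
  - apply (continuous_app (fun y => powabs y q)); [intros; apply continuous_powabs; lra | apply Hv].
  - apply continuous_Rmult.
    + apply continuous_Rmult; [cnt |].
      apply (continuous_app (fun y => dpow y (q - 1))); [| apply Hv].
      intros y. eapply (is_derive_cont (fun y => dpow y (q - 1))), is_derive_dpow. lra.
    + apply continuous_Rminus; [apply Hr | apply Hv].
Qed.

Lemma is_derive_Gu (w : R -> R -> R) (s y : R) : adm w -> is_derive (Gu w s) y (gu w s y).
Proof using Dv Dv1 Hp Hq.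
  intros Hw. unfold Gu, gu.
  apply (is_derive_mult_comp_quot (fun x => powabs x q) (fun x => q * dpow x (q - 1)) (Nv w) (Nvr w)).
  - now apply cont2_Nv, Hw.
  - now apply cont2_Nvr, Hw.
  - intros. apply is_derive_powabs. lra.
  - intros. now apply is_derive_Nv, Hw.
  - intros. now apply odd_at_0, Nv_odd.
Qed.

Lemma cont2_Nut (w : R -> R -> R) : adm w -> cont2 (Nut w).
Proof using Dv Dv1 Hp Hq Du1.
  intros Hw. apply (cont2_wave_t e tu1 tu2); auto using cont2_Gu.
Qed.

Lemma cont2_Nutr (w : R -> R -> R) : adm w -> cont2 (Nutr w).
Proof using Dv Dv1 Hp Hq Cu2.
  intros Hw. apply cont2_wave_tr; auto using cont2_gu.
Qed.

Lemma is_derive_Nut (w : R -> R -> R) (t r : R) : adm w -> is_derive (Nut w t) r (Nutr w t r).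
Proof using Dv Dv1 Hp Hq Du1.
  intros Hw. apply is_derive_wave_tr; auto using cont2_Gu, cont2_gu, is_derive_Gu.
Qed.

Lemma Nut_odd (w : R -> R -> R) : adm w -> odd_r (Nut w).
Proof using Dv Dv1 Hp Hq.
  intros Hw. apply wave_t_odd; auto using cont2_Gu, Gu_odd.
Qed.

Lemma adm_wof (w : R -> R -> R) : adm w -> adm (wof w).
Proof using Dv Dv1 Hp Hq Du1 Cu2.
  intros Hw. split.
  - apply cont2_quot.
    + now apply cont2_Nut.
    + now apply cont2_Nutr.
    + intros. now apply is_derive_Nut.
    + intros t. now apply odd_at_0, Nut_odd.
  - apply quot_even. now apply Nut_odd.
Qed.

Local Lemma iw1_pow_p (y s : R) : br y * Rpower (iw1 p mu s y) p = bp y (1 - p) * bp (s - Rabs y) (- mu).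
Proof using Hp.
  unfold iw1. rewrite <- Rpower_mult_distr by apply bp_pos. rewrite !Rpower_bp, <- bp_1.
  rewrite <- Rmult_assoc, <- bp_plus. f_equal; [f_equal; ring | f_equal; field; lra].
Qed.

Lemma bound1_Gv (K : R) (w : R -> R -> R) :
  0 < K -> wball p mu K w -> bound1 p mu (Rpower K p) (Gv w).
Proof using Hp.
  intros HK [_ HB] s y Hs. unfold Gv. rewrite Rabs_mult, <- iw1_pow_p.
  rewrite (Rabs_right (powabs _ _)) by apply Rle_ge, powabs_nonneg.
  pose proof (iw1_pos p mu s y) as PI.
  assert (B : powabs (w s y) p <= Rpower K p * Rpower (iw1 p mu s y) p).
  { rewrite Rpower_mult_distr by auto. apply powabs_le; [lra | now apply HB |].
    now apply Rmult_lt_0_compat. }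
  replace (Rpower K p * (br y * Rpower (iw1 p mu s y) p))
    with (br y * (Rpower K p * Rpower (iw1 p mu s y) p)) by ring.
  apply Rmult_le_compat; auto; [apply Rabs_pos | apply powabs_nonneg |].
  unfold br. lra.
Qed.

Lemma bound1_Gv_diff (K D : R) (w w' : R -> R -> R) :
  0 < K -> 0 <= D -> wball p mu K w -> wball p mu K w' -> wclose p mu D w w' ->
  bound1 p mu (p * Rpower K (p - 1) * D) (fun s y => Gv w s y - Gv w' s y).
Proof using Hp.
  intros HK HD [_ HB] [_ HB'] HC s y Hs. unfold Gv.
  rewrite <- Rmult_minus_distr_l, Rabs_mult, <- iw1_pow_p.
  pose proof (iw1_pos p mu s y) as PI.
  pose proof (powabs_lipschitz (w s y) (w' s y) p (K * iw1 p mu s y) ltac:(lra)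
                (Rmult_lt_0_compat _ _ HK PI) (HB s y Hs) (HB' s y Hs)) as B.
  rewrite <- Rpower_mult_distr in B by auto.
  pose proof (Rpower_pos K (p - 1)). pose proof (Rpower_pos (iw1 p mu s y) (p - 1)) as P2.
  replace (Rpower (iw1 p mu s y) p) with (Rpower (iw1 p mu s y) (p - 1) * iw1 p mu s y).
  2:{ rewrite <- (Rpower_1 (iw1 p mu s y)) at 2 by auto. rewrite <- Rpower_plus. f_equal. ring. }
  replace (p * Rpower K (p - 1) * D * (br y * (Rpower (iw1 p mu s y) (p - 1) * iw1 p mu s y)))
    with (br y * (p * (Rpower K (p - 1) * Rpower (iw1 p mu s y) (p - 1)) * (D * iw1 p mu s y))) by ring.
  apply Rmult_le_compat; try apply Rabs_pos; [unfold br; lra |].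
  eapply Rle_trans; [exact B |]. apply Rmult_le_compat_l; [| now apply HC].
  apply Rmult_le_pos; [lra |]. left. now apply Rmult_lt_0_compat.
Qed.

(* [Nvr - vof] is [r ∂_r v]. *)
Definition vbound (B : R) (w : R -> R -> R) : Prop :=
  forall t r, 0 <= t -> Rabs (vof w t r) <= B * iw2 p mu t (Rabs r) /\
    Rabs (Nvr w t r - vof w t r) <= B * bp (t - Rabs r) (- mu).

Definition vclose (E : R) (w w' : R -> R -> R) : Prop :=
  forall t r, 0 <= t -> Rabs (vof w t r - vof w' t r) <= E * iw2 p mu t (Rabs r) /\
    Rabs ((Nvr w t r - vof w t r) - (Nvr w' t r - vof w' t r)) <= E * bp (t - Rabs r) (- mu).

Local Lemma even_Rabs (h : R -> R -> R) (t r : R) : even_r h -> h t r = h t (Rabs r).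
Proof using. intros H. unfold Rabs. destruct Rcase_abs; auto. Qed.

Lemma vbound_of_ball (C0 C1 K : R) (w : R -> R -> R) :
  0 < e ->
  (forall t r, 0 <= t -> 0 <= r ->
    Rabs (quot (lin tv) (linp tv1) t r) <= C0 * iw2 p mu t r /\
    Rabs (linp tv1 t r - quot (lin tv) (linp tv1) t r) <= C0 * bp (t - r) (- mu)) ->
  (forall A G, 0 <= A -> cont2 G -> odd_r G -> bound1 p mu A G ->
    forall t r, 0 <= t -> 0 <= r ->
      Rabs (quot (cminus (Gam G)) (cminus G) t r) <= C1 * A * iw2 p mu t r /\
      Rabs (cminus G t r - quot (cminus (Gam G)) (cminus G) t r) <= C1 * A * bp (t - r) (- mu)) ->
  0 < K -> wball p mu K w -> vbound (e * C0 + C1 * Rpower K p) w.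
Proof using Hp.
  intros He HL HD HK HB t r Ht.
  assert (EV : vof w t r = vof w t (Rabs r)).
  { apply even_Rabs, quot_even, Nv_odd, HB. }
  assert (EN : Nvr w t r = Nvr w t (Rabs r)).
  { apply even_Rabs, Nvr_even, HB. }
  rewrite EV, EN. set (rho := Rabs r). assert (Hrho : 0 <= rho) by apply Rabs_pos.
  destruct (HL t rho Ht Hrho) as [L1 L2].
  destruct (HD (Rpower K p) (Gv w) (Rlt_le _ _ (Rpower_pos _ _)) (cont2_Gv w (proj1 (proj1 HB)))
    (Gv_odd w (proj2 (proj1 HB))) (bound1_Gv K w HK HB) t rho Ht Hrho) as [D1 D2].
  assert (EQ : vof w t rho = e * quot (lin tv) (linp tv1) t rho
                + quot (cminus (Gam (Gv w))) (cminus (Gv w)) t rho) by apply quot_linear.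
  rewrite EQ. unfold Nvr, wave_r.
  assert (X : forall a b A B W, Rabs a <= A * W -> Rabs b <= B * W ->
                Rabs (e * a + b) <= (e * A + B) * W).
  { intros a b A B W Ha Hb. eapply Rle_trans; [apply Rabs_triang |].
    rewrite Rabs_mult, (Rabs_right e) by lra.
    pose proof (Rmult_le_compat_l e _ _ (Rlt_le _ _ He) Ha). lra. }
  split; [now apply X |].
  match goal with |- Rabs ?x <= _ => replace x with
    (e * (linp tv1 t rho - quot (lin tv) (linp tv1) t rho) +
     (cminus (Gv w) t rho - quot (cminus (Gam (Gv w))) (cminus (Gv w)) t rho)) by ring end.
  now apply X.
Qed.

Lemma vclose_of_close (C1 K D : R) (w w' : R -> R -> R) :
  (forall A G, 0 <= A -> cont2 G -> odd_r G -> bound1 p mu A G ->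
    forall t r, 0 <= t -> 0 <= r ->
      Rabs (quot (cminus (Gam G)) (cminus G) t r) <= C1 * A * iw2 p mu t r /\
      Rabs (cminus G t r - quot (cminus (Gam G)) (cminus G) t r) <= C1 * A * bp (t - r) (- mu)) ->
  0 < K -> 0 <= D -> wball p mu K w -> wball p mu K w' -> wclose p mu D w w' ->
  vclose (C1 * (p * Rpower K (p - 1) * D)) w w'.
Proof using Hp.
  intros HD HK HD0 HB HB' HC t r Ht.
  assert (EV : forall w, wball p mu K w -> vof w t r = vof w t (Rabs r)).
  { intros w0 H0. apply even_Rabs, quot_even, Nv_odd, H0. }
  assert (EN : forall w, wball p mu K w -> Nvr w t r = Nvr w t (Rabs r)).
  { intros w0 H0. apply even_Rabs, Nvr_even, H0. }
  rewrite !EV, !EN by auto. set (rho := Rabs r). assert (Hrho : 0 <= rho) by apply Rabs_pos.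
  set (G := fun s y => Gv w s y - Gv w' s y).
  assert (CG := cont2_Gv w (proj1 (proj1 HB))). assert (CG' := cont2_Gv w' (proj1 (proj1 HB'))).
  assert (HG : cont2 G) by (unfold G; cnt).
  assert (OG : odd_r G).
  { intros s y. unfold G. rewrite (Gv_odd w (proj2 (proj1 HB))), (Gv_odd w' (proj2 (proj1 HB'))). ring. }
  assert (HA : 0 <= p * Rpower K (p - 1) * D).
  { apply Rmult_le_pos; auto. apply Rmult_le_pos; [lra | left; apply Rpower_pos]. }
  destruct (HD _ G HA HG OG (bound1_Gv_diff K D w w' HK HD0 HB HB' HC) t rho Ht Hrho) as [D1 D2].
  assert (EGam : Gam G = fun s y => Gam (Gv w) s y - Gam (Gv w') s y).
  { apply functional_extensionality; intros s. apply functional_extensionality; intros y.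
    now apply Gam_minus. }
  assert (ECm : cminus (Gam G) = fun t r => cminus (Gam (Gv w)) t r - cminus (Gam (Gv w')) t r).
  { rewrite EGam. apply functional_extensionality; intros s. apply functional_extensionality; intros y.
    apply cminus_minus; now apply cont2_Gam. }
  assert (ECr : cminus G = fun t r => cminus (Gv w) t r - cminus (Gv w') t r).
  { apply functional_extensionality; intros s. apply functional_extensionality; intros y.
    now apply cminus_minus. }
  assert (EQ : quot (cminus (Gam G)) (cminus G) t rho = vof w t rho - vof w' t rho).
  { rewrite ECm, ECr, quot_minus.
    assert (Q : forall w, vof w t rho = e * quot (lin tv) (linp tv1) t rho
                + quot (cminus (Gam (Gv w))) (cminus (Gv w)) t rho) by (intros; apply quot_linear).
    rewrite !Q. ring. }
  rewrite EQ in D1, D2. rewrite ECr in D2. split; [exact D1 |].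
  match goal with |- Rabs ?x <= _ => replace x with
    (cminus (Gv w) t rho - cminus (Gv w') t rho - (vof w t rho - vof w' t rho))
      by (unfold Nvr, wave_r; ring) end.
  exact D2.
Qed.

Local Lemma iw2_iw3 (s y : R) : 0 <= s -> iw2 p mu s (Rabs y) <= bp (s - Rabs y) (- mu).
Proof using Hp Hp3 Hmu. intros Hs. apply iw2_le_iw3; auto. apply Rabs_pos. Qed.

(** The derivative of [r |v|^q] has two terms: [|v|^q], with one factor downgraded by [iw2_iw3],
    contributes 1 to the constant, and [q |v|^(q-1) |r ∂_r v|] contributes [q]. *)
Lemma bound2_Gu (B : R) (w : R -> R -> R) :
  0 < B -> vbound B w -> bound2 p mu q ((1 + q) * Rpower B q) (Gu w) (gu w).
Proof using Hq Hp Hp3 Hmu.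
  intros HB HV s y Hs. destruct (HV s y Hs) as [V1 V2].
  set (W := iw2 p mu s (Rabs y)) in *. set (Z := bp (s - Rabs y) (- mu)) in *.
  assert (PW : 0 < W) by apply iw2_pos. assert (PZ : 0 < Z) by apply bp_pos.
  assert (PBW : 0 < B * W) by now apply Rmult_lt_0_compat.
  assert (HWZ : W <= Z) by now apply iw2_iw3.
  assert (PB := Rpower_pos B q). assert (PWq := Rpower_pos W q).
  assert (PWq1 := Rpower_pos W (q - 1)).
  assert (Pq : powabs (vof w s y) q <= Rpower B q * Rpower W q).
  { rewrite Rpower_mult_distr by auto. apply powabs_le; auto; lra. }
  assert (Pq1 : Rabs (dpow (vof w s y) (q - 1)) <= Rpower B (q - 1) * Rpower W (q - 1)).
  { rewrite dpow_abs, Rpower_mult_distr by auto. apply powabs_le; auto; lra. }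
  split.
  - unfold Gu. rewrite Rabs_mult, (Rabs_right (powabs _ _)) by apply Rle_ge, powabs_nonneg.
    apply Rle_trans with (br y * (Rpower B q * Rpower W q)).
    + apply Rmult_le_compat; auto; [apply Rabs_pos | apply powabs_nonneg | unfold br; lra].
    + assert (0 <= q * (Rpower B q * (br y * Rpower W q))).
      { pose proof (br_ge1 y). repeat apply Rmult_le_pos; lra. }
      lra.
  - unfold gu. eapply Rle_trans; [apply Rabs_triang |].
    rewrite (Rabs_right (powabs _ _)) by apply Rle_ge, powabs_nonneg.
    rewrite !Rabs_mult, (Rabs_right q) by lra.
    assert (A1 : powabs (vof w s y) q <= Rpower B q * (Rpower W (q - 1) * Z)).
    { eapply Rle_trans; [exact Pq |]. apply Rmult_le_compat_l; [lra |].
      rewrite (Rpower_split W q) by auto. apply Rmult_le_compat_l; lra. }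
    assert (A2 : q * Rabs (dpow (vof w s y) (q - 1)) * Rabs (Nvr w s y - vof w s y)
                 <= q * (Rpower B q * (Rpower W (q - 1) * Z))).
    { rewrite Rmult_assoc. apply Rmult_le_compat_l; [lra |].
      apply Rle_trans with ((Rpower B (q - 1) * Rpower W (q - 1)) * (B * Z)).
      - apply Rmult_le_compat; auto; apply Rabs_pos.
      - rewrite (Rpower_split B q) by auto. right; ring. }
    lra.
Qed.

Lemma bound2_Gu_diff (B E : R) (w w' : R -> R -> R) :
  0 < B -> 0 <= E -> vbound B w -> vbound B w' -> vclose E w w' ->
  bound2 p mu q ((q + q * q) * Rpower B (q - 1) * E)
    (fun s y => Gu w s y - Gu w' s y) (fun s y => gu w s y - gu w' s y).
Proof using Hq Hp Hp3 Hmu.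
  intros HB HE HV HV' HC s y Hs. destruct (HV s y Hs) as [V1 V2].
  destruct (HV' s y Hs) as [V1' V2']. destruct (HC s y Hs) as [C1 C2].
  set (W := iw2 p mu s (Rabs y)) in *. set (Z := bp (s - Rabs y) (- mu)) in *.
  set (v := vof w s y) in *. set (v' := vof w' s y) in *.
  set (z := Nvr w s y - v) in *. set (z' := Nvr w' s y - v') in *.
  assert (PW : 0 < W) by apply iw2_pos. assert (PZ : 0 < Z) by apply bp_pos.
  assert (PBW : 0 < B * W) by now apply Rmult_lt_0_compat.
  assert (HWZ : W <= Z) by now apply iw2_iw3.
  assert (PB1 := Rpower_pos B (q - 1)). assert (PW1 := Rpower_pos W (q - 1)).
  assert (PB2 := Rpower_pos B (q - 1 - 1)). assert (PW2 := Rpower_pos W (q - 1 - 1)).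
  assert (PEW : 0 <= E * W) by (apply Rmult_le_pos; lra).
  assert (PEZ : 0 <= E * Z) by (apply Rmult_le_pos; lra).
  assert (L1 : Rabs (powabs v q - powabs v' q) <= q * (Rpower B (q - 1) * Rpower W (q - 1)) * (E * W)).
  { rewrite Rpower_mult_distr by auto.
    eapply Rle_trans; [apply (powabs_lipschitz v v' q (B * W)); auto; lra |].
    apply Rmult_le_compat_l; auto. apply Rmult_le_pos; [lra | left; apply Rpower_pos]. }
  assert (L2 : Rabs (dpow v (q - 1) - dpow v' (q - 1))
                <= (q - 1) * (Rpower B (q - 1 - 1) * Rpower W (q - 1 - 1)) * (E * W)).
  { rewrite Rpower_mult_distr by auto.
    eapply Rle_trans; [apply (dpow_lipschitz v v' (q - 1) (B * W)); auto; lra |].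
    apply Rmult_le_compat_l; auto. apply Rmult_le_pos; [lra | left; apply Rpower_pos]. }
  assert (L3 : Rabs (dpow v (q - 1)) <= Rpower B (q - 1) * Rpower W (q - 1)).
  { rewrite dpow_abs, Rpower_mult_distr by auto. apply powabs_le; auto; lra. }
  split.
  - unfold Gu. fold v v'. rewrite <- Rmult_minus_distr_l, Rabs_mult.
    rewrite (Rpower_split W q) by auto.
    apply Rle_trans with (br y * (q * (Rpower B (q - 1) * Rpower W (q - 1)) * (E * W))).
    + apply Rmult_le_compat; auto; try apply Rabs_pos. unfold br; lra.
    + assert (0 <= q * q * Rpower B (q - 1) * E * (br y * (Rpower W (q - 1) * W))).
      { pose proof (br_ge1 y). repeat apply Rmult_le_pos; lra. }
      lra.
  - unfold gu. fold v v'. fold z z'.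
    set (X := Rpower B (q - 1) * E * (Rpower W (q - 1) * Z)).
    assert (A1 : Rabs (powabs v q - powabs v' q) <= q * X).
    { eapply Rle_trans; [exact L1 |]. unfold X.
      replace (q * (Rpower B (q - 1) * Rpower W (q - 1)) * (E * W))
        with (q * (Rpower B (q - 1) * E * Rpower W (q - 1)) * W) by ring.
      replace (q * (Rpower B (q - 1) * E * (Rpower W (q - 1) * Z)))
        with (q * (Rpower B (q - 1) * E * Rpower W (q - 1)) * Z) by ring.
      apply Rmult_le_compat_l; auto. repeat apply Rmult_le_pos; lra. }
    assert (A2 : Rabs (dpow v (q - 1) * (z - z')) <= X).
    { rewrite Rabs_mult. unfold X.
      apply Rle_trans with ((Rpower B (q - 1) * Rpower W (q - 1)) * (E * Z)); [| right; ring].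
      apply Rmult_le_compat; auto; apply Rabs_pos. }
    assert (A3 : Rabs ((dpow v (q - 1) - dpow v' (q - 1)) * z') <= (q - 1) * X).
    { rewrite Rabs_mult. unfold X.
      rewrite (Rpower_split B (q - 1)), (Rpower_split W (q - 1)) by auto.
      apply Rle_trans with ((q - 1) * (Rpower B (q - 1 - 1) * Rpower W (q - 1 - 1)) * (E * W) * (B * Z));
        [| right; ring].
      apply Rmult_le_compat; auto; apply Rabs_pos. }
    (* In the difference of products, [z - z'] costs one unit of [X] and the difference of [dpow]
       costs [q - 1]; multiplied by [q] this gives [q * q], next to [q] from the difference of
       [|v|^q]. *)
    replace (powabs v q + q * dpow v (q - 1) * z - (powabs v' q + q * dpow v' (q - 1) * z'))
      with ((powabs v q - powabs v' q) + q * (dpow v (q - 1) * (z - z')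
            + (dpow v (q - 1) - dpow v' (q - 1)) * z')) by ring.
    eapply Rle_trans; [apply Rabs_triang |]. rewrite (Rabs_mult q), (Rabs_right q) by lra.
    assert (A4 : Rabs (dpow v (q - 1) * (z - z') + (dpow v (q - 1) - dpow v' (q - 1)) * z') <= q * X).
    { eapply Rle_trans; [apply Rabs_triang |]. lra. }
    pose proof (Rmult_le_compat_l q _ _ ltac:(lra) A4).
    fold X. replace ((q + q * q) * Rpower B (q - 1) * E * (Rpower W (q - 1) * Z))
      with ((q + q * q) * X) by (unfold X; ring). lra.
Qed.

Lemma wof_bound (C0 C2 B : R) (w : R -> R -> R) :
  0 < e ->
  (forall t r, 0 <= t -> 0 <= r ->
    Rabs (quot (lin tu1) (linp tu2) t r) <= C0 * (bp r (-1) * bp (t - r) (- (mu / p)))) ->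
  (forall A G g, 0 <= A -> cont2 G -> cont2 g -> odd_r G ->
    (forall s y, is_derive (G s) y (g s y)) -> bound2 p mu q A G g ->
    forall t r, 0 <= t -> 0 <= r ->
      Rabs (quot (cplus G) (cplus g) t r) <= C2 * A * (bp r (-1) * bp (t - r) (- (mu / p)))) ->
  0 < B -> adm w -> vbound B w ->
  forall t r, 0 <= t -> Rabs (wof w t r) <= (e * C0 + C2 * ((1 + q) * Rpower B q)) * iw1 p mu t r.
Proof using Hq Hp Hp3 Hmu Dv Dv1 Du1.
  intros He HL HD HB HA HV t r Ht.
  assert (EW : wof w t r = wof w t (Rabs r)) by (apply even_Rabs, quot_even, Nut_odd, HA).
  rewrite EW. unfold iw1. rewrite <- (bp_Rabs r).
  set (rho := Rabs r). assert (Hrho : 0 <= rho) by apply Rabs_pos.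
  assert (PA : 0 <= (1 + q) * Rpower B q) by (pose proof (Rpower_pos B q); apply Rmult_le_pos; lra).
  pose proof (HD _ (Gu w) (gu w) PA (cont2_Gu w HA) (cont2_gu w HA) (Gu_odd w HA)
     (fun s y => is_derive_Gu w s y HA) (bound2_Gu B w HB HV) t rho Ht Hrho) as D1.
  pose proof (HL t rho Ht Hrho) as L1.
  assert (EQ : wof w t rho = e * quot (lin tu1) (linp tu2) t rho
                + quot (cplus (Gu w)) (cplus (gu w)) t rho) by apply quot_linear.
  rewrite EQ. eapply Rle_trans; [apply Rabs_triang |].
  rewrite Rabs_mult, (Rabs_right e) by lra.
  pose proof (Rmult_le_compat_l e _ _ (Rlt_le _ _ He) L1). lra.
Qed.

Lemma wof_close (C2 B E : R) (w w' : R -> R -> R) :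
  (forall A G g, 0 <= A -> cont2 G -> cont2 g -> odd_r G ->
    (forall s y, is_derive (G s) y (g s y)) -> bound2 p mu q A G g ->
    forall t r, 0 <= t -> 0 <= r ->
      Rabs (quot (cplus G) (cplus g) t r) <= C2 * A * (bp r (-1) * bp (t - r) (- (mu / p)))) ->
  0 < B -> 0 <= E -> adm w -> adm w' -> vbound B w -> vbound B w' -> vclose E w w' ->
  wclose p mu (C2 * ((q + q * q) * Rpower B (q - 1) * E)) (wof w) (wof w').
Proof using Hq Hp Hp3 Hmu Dv Dv1 Du1.
  intros HD HB HE HA HA' HV HV' HC t r Ht.
  assert (EW : forall w, adm w -> wof w t r = wof w t (Rabs r))
    by (intros w0 H0; apply even_Rabs, quot_even, Nut_odd, H0).
  rewrite !EW by auto. unfold iw1. rewrite <- (bp_Rabs r).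
  set (rho := Rabs r). assert (Hrho : 0 <= rho) by apply Rabs_pos.
  set (G := fun s y => Gu w s y - Gu w' s y). set (g := fun s y => gu w s y - gu w' s y).
  assert (CG := cont2_Gu w HA). assert (CG' := cont2_Gu w' HA').
  assert (Cg := cont2_gu w HA). assert (Cg' := cont2_gu w' HA').
  assert (HG : cont2 G) by (unfold G; cnt). assert (Hg : cont2 g) by (unfold g; cnt).
  assert (OG : odd_r G).
  { intros s y. unfold G. rewrite (Gu_odd w HA), (Gu_odd w' HA'). ring. }
  assert (DG : forall s y, is_derive (G s) y (g s y)).
  { intros s y. apply (is_derive_minus (Gu w s) (Gu w' s)); now apply is_derive_Gu. }
  assert (PA : 0 <= (q + q * q) * Rpower B (q - 1) * E).
  { apply Rmult_le_pos; auto. apply Rmult_le_pos; [nra | left; apply Rpower_pos]. }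
  pose proof (HD _ G g PA HG Hg OG DG (bound2_Gu_diff B E w w' HB HE HV HV' HC) t rho Ht Hrho) as D1.
  assert (EQ : quot (cplus G) (cplus g) t rho = wof w t rho - wof w' t rho).
  { assert (Q : forall w, wof w t rho = e * quot (lin tu1) (linp tu2) t rho
                + quot (cplus (Gu w)) (cplus (gu w)) t rho) by (intros; apply quot_linear).
    rewrite !Q.
    rewrite (quot_ext _ _ (fun t r => cplus (Gu w) t r - cplus (Gu w') t r)
                          (fun t r => cplus (gu w) t r - cplus (gu w') t r)).
    - rewrite quot_minus. ring.
    - now apply cplus_minus.
    - now apply cplus_minus. }
  now rewrite <- EQ.
Qed.

(* Freezing [t] at [0] for [t < 0] keeps every field continuous on the whole plane. *)
Definition Phi (w : R -> R -> R) (t r : R) : R := wof w (Rmax t 0) r.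
Definition uof (w : R -> R -> R) : R -> R -> R := quot (wave e tu (Gu w)) (wave_r e tu1 (Gu w)).
Definition gv (w : R -> R -> R) (s y : R) : R :=
  powabs (w s y) p + p * dpow (w s y) (p - 1) * (Nutr w (Rmax s 0) y - w s y).

Lemma cont2_gv (w : R -> R -> R) : adm w -> cont2 (gv w).
Proof using Dv Dv1 Hp Hq Cu2.
  intros Hw. pose proof (cont2_freeze _ (cont2_Nutr w Hw)) as HN. destruct Hw as [Hw _].
  unfold gv. intros z. apply continuous_Rplus.
  - apply (continuous_app (fun y => powabs y p)); [intros; apply continuous_powabs; lra | apply Hw].
  - apply continuous_Rmult.
    + apply continuous_Rmult; [cnt |].
      apply (continuous_app (fun y => dpow y (p - 1))); [| apply Hw].
      intros y. eapply (is_derive_cont (fun y => dpow y (p - 1))), is_derive_dpow. lra.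
    + apply continuous_Rminus; [apply HN | apply Hw].
Qed.

(** For a general [w] of the ball [r |w|^p] is only continuous. At a fixed point [w] is the quotient
    of a function with continuous radial derivative by [r], exactly as [v] is, so the same product
    rule applies. *)
Lemma is_derive_Gv (w : R -> R -> R) (s y : R) :
  adm w -> (forall t r, w t r = Phi w t r) -> is_derive (Gv w s) y (gv w s y).
Proof using Dv Dv1 Hp Hq Du1 Cu2.
  intros Hw HF.
  pose proof (is_derive_mult_comp_quot (fun x => powabs x p) (fun x => p * dpow x (p - 1))
    (fun t r => Nut w (Rmax t 0) r) (fun t r => Nutr w (Rmax t 0) r) s y
    (cont2_freeze _ (cont2_Nut w Hw)) (cont2_freeze _ (cont2_Nutr w Hw))
    (fun x => is_derive_powabs x p ltac:(lra))
    (fun t r => is_derive_Nut w (Rmax t 0) r Hw)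
    (fun t => odd_at_0 _ _ (Nut_odd w Hw))) as D.
  unfold gv. rewrite (HF s y).
  eapply is_derive_ext; [| exact D]. intros r. unfold Gv. now rewrite HF.
Qed.

Lemma hderiv_uof (w : R -> R -> R) (t r : R) :
  adm w -> hderiv (fun tau => uof w tau r) t (wof w t r).
Proof using Dv Dv1 Hp Hq Du Du1 Cu2.
  intros Hw. apply hderiv_of_is_derive. unfold uof, wof, Nut, Nutr.
  apply (is_derive_wave_quot_t e tu tu1 tu2 (Gu w) (gu w)); auto using cont2_Gu, cont2_gu, Gu_odd, is_derive_Gu.
Qed.

Variables f g ft gt : R -> R.
Hypotheses (HU : forall t r, r <> 0 -> U0 f g t r = lin tu t r / r)
  (HV : forall t r, r <> 0 -> U0 ft gt t r = lin tv t r / r).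

Lemma vof_equation (w F : R -> R -> R) (t r : R) :
  cont2 w -> (forall s y, 0 <= s -> F s y = w s y) -> 0 <= t -> r <> 0 ->
  e * U0 ft gt t r + Lop (fun s rho => powabs (F s rho) p) t r = vof w t r.
Proof using Hp HV.
  intros Hw E Ht Hr. unfold vof. rewrite quot_neq0, HV by auto.
  rewrite (Lop_eq _ (fun s y => powabs (w s y) p)); auto.
  - unfold Nv, wave, Gv. field. auto.
  - intros z. apply (continuous_app (fun y => powabs y p)); [intros; apply continuous_powabs; lra | apply Hw].
  - intros s y Hs. now rewrite E.
Qed.

Lemma uof_equation (w F : R -> R -> R) (t r : R) :
  adm w -> (forall s y, 0 <= s -> F s y = vof w s y) -> 0 <= t -> r <> 0 ->
  e * U0 f g t r + Lop (fun s rho => powabs (F s rho) q) t r = uof w t r.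
Proof using Hp Hq HU Dv Dv1.
  intros Hw E Ht Hr. unfold uof. rewrite quot_neq0, HU by auto.
  rewrite (Lop_eq _ (fun s y => powabs (vof w s y) q)); auto.
  - unfold wave, Gu. field. auto.
  - intros z. apply (continuous_app (fun y => powabs y q)); [intros; apply continuous_powabs; lra |].
    apply (adm_vof w Hw).
  - intros s y Hs. now rewrite E.
Qed.

Lemma rderiv_vof (w : R -> R -> R) (t r d : R) :
  adm w -> r <> 0 -> derivable_pt_lim (fun rho => vof w t rho) r d -> r * d = Nvr w t r - vof w t r.
Proof using Dv Dv1 Hp.
  intros Hw Hr Hd. apply is_derive_Reals in Hd.
  assert (D := is_derive_quot (Nv w) (Nvr w) t r Hr (odd_at_0 _ _ (Nv_odd w Hw))
                 (is_derive_Nv w t r (proj1 Hw))).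
  change (quot (Nv w) (Nvr w)) with (vof w) in D.
  apply is_derive_unique in D. apply is_derive_unique in Hd.
  change (fun rho => vof w t rho) with (vof w t) in Hd. rewrite D in Hd.
  rewrite <- Hd. field. auto.
Qed.

Lemma good_sol_of_fixed_point (A B C : R) (w : R -> R -> R) :
  A + B + B <= C * e -> 0 < A -> 0 < B -> wball p mu A w -> vbound B w ->
  (forall t r, w t r = Phi w t r) ->
  good_sol p q mu f g ft gt e C (uof w) (vof w).
Proof using All.
  intros HABC HA HB Hw HVB HF. destruct Hw as [Hw HAw].
  assert (HFt : forall t r, 0 <= t -> w t r = wof w t r).
  { intros t r Ht. rewrite HF. unfold Phi. now rewrite Rmax_left by lra. }
  assert (Cw : contH w) by (apply contH_of_cont2, Hw).
  assert (N0 : forall t, wave e tu (Gu w) t 0 = 0).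
  { intros t. apply odd_at_0, wave_odd; auto using cont2_Gu, Gu_odd. }
  assert (N0v : forall t, Nv w t 0 = 0) by (intros t; apply odd_at_0, Nv_odd, Hw).
  assert (P1 := jb_pos).
  assert (CGu := cont2_Gu w Hw). assert (OGu := Gu_odd w Hw).
  exists w. split; [| split; [| split; [| split; [| split; [| split; [| split; [| split; [| split]]]]]]]].
  - intros t r Ht. rewrite HFt by auto. now apply hderiv_uof.
  - intros t r Ht Hr. symmetry. apply uof_equation; auto.
  - intros t r Ht Hr. symmetry. apply vof_equation; auto. apply Hw.
  - exists A, B, B. split; [exact HABC |]. split; [| split].
    + intros t r Ht Hr. unfold w1.
      assert (X : jb r * Rpower (jb (t - r)) (mu / p) * iw1 p mu t r <= 1).
      { unfold iw1. rewrite (Rabs_right r) by lra.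
        replace (jb r * Rpower (jb (t - r)) (mu / p) * (bp r (-1) * bp (t - r) (- (mu / p))))
          with ((jb r * bp r (-1)) * (Rpower (jb (t - r)) (mu / p) * bp (t - r) (- (mu / p)))) by ring.
        assert (0 < mu / p) by (apply Rdiv_lt_0_compat; lra).
        specialize (P1 r).
        apply Rmult_le_1; [| | apply jb_bp_m1 | apply Rpower_jb_bp; lra].
        - apply Rmult_le_pos; [lra | left; apply bp_pos].
        - apply Rmult_le_pos; left; [apply Rpower_pos | apply bp_pos]. }
      eapply Rle_trans.
      * apply Rmult_le_compat_l; [| now apply HAw].
        apply Rmult_le_pos; [specialize (P1 r); lra | left; apply Rpower_pos].
      * rewrite <- (Rmult_1_r A) at 2. apply (Rmult_le_compat_l A) in X; lra.
    + intros t r Ht Hr. destruct (HVB t r Ht) as [V _]. rewrite (Rabs_right r) in V by lra.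
      pose proof (w2_iw2 p mu t r ltac:(lra) ltac:(lra) ltac:(lra)) as X.
      eapply Rle_trans.
      * apply Rmult_le_compat_l; [| exact V]. unfold w2.
        destruct Rlt_dec; apply Rmult_le_pos; try (left; apply Rpower_pos).
        specialize (P1 (t + r)); lra.
      * rewrite <- (Rmult_1_r B) at 2. apply (Rmult_le_compat_l B) in X; lra.
    + intros t r d Ht Hr Hd. rewrite (rderiv_vof w t r d Hw ltac:(lra) Hd).
      destruct (HVB t r Ht) as [_ V]. rewrite (Rabs_right r) in V by lra.
      unfold w3. pose proof (Rpower_jb_bp (t - r) mu ltac:(lra)) as X.
      eapply Rle_trans.
      * apply Rmult_le_compat_l; [left; apply Rpower_pos | exact V].
      * rewrite <- (Rmult_1_r B) at 2. apply (Rmult_le_compat_l B) in X; lra.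
  - intros t r _. split.
    + exact (quot_even _ (wave_r e tu1 (Gu w)) (wave_odd e tu (Gu w) (cont2_Gu w Hw) (Gu_odd w Hw)) t r).
    + apply adm_vof, Hw.
  - apply contH_of_cont2. apply (wave_quot_cont2 e tu tu1 tu2 (Gu w)); assumption.
  - apply contH_of_cont2, adm_vof, Hw.
  - exact Cw.
  - replace (fun t r => r * uof w t r) with (wave e tu (Gu w)).
    + apply (wave_C2H e tu tu1 tu2 (Gu w) (gu w)); auto using cont2_Gu, cont2_gu, Gu_odd, is_derive_Gu.
    + apply functional_extensionality; intros t. apply functional_extensionality; intros r.
      symmetry. apply quot_mult, N0.
  (* This is where the fixed point equation is needed for regularity: it provides the radial
     derivative [gv] of the source of [r v]. *)
  - replace (fun t r => r * vof w t r) with (Nv w).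
    + apply (wave_C2H e tv tv1 tv2 (Gv w) (gv w)); auto using cont2_gv, is_derive_Gv.
      * apply cont2_Gv, Hw.
      * apply Gv_odd, Hw.
    + apply functional_extensionality; intros t. apply functional_extensionality; intros r.
      symmetry. apply quot_mult, N0v.
Qed.

(** Each of the two brackets costs a factor at most 2 when [br] is replaced by [jb], the second
    because [mu / p <= 1]. *)
Lemma one_le_w1_iw1 (t r : R) : 0 <= r -> 1 <= 4 * (w1 p mu t r * iw1 p mu t r).
Proof using Hp Hmu Hmu1 Hp3.
  intros Hr. unfold w1, iw1. rewrite (Rabs_right r) by lra.
  assert (N : 0 < mu / p <= 1).
  { split; [apply Rdiv_lt_0_compat; lra |].
    apply Rmult_le_reg_r with p; [lra |]. unfold Rdiv. rewrite Rmult_assoc, Rinv_l; lra. }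
  assert (X1 : 1 <= 2 * jb r * bp r (-1)).
  { rewrite bp_m1. pose proof (br_ge1 r). apply Rmult_le_reg_r with (br r); [lra |].
    rewrite Rmult_assoc, Rinv_l, Rmult_1_r, Rmult_1_l by lra. apply br_le_2jb. }
  assert (X2 : 1 <= 2 * Rpower (jb (t - r)) (mu / p) * bp (t - r) (- (mu / p))).
  { rewrite <- (bp_inv (t - r) (mu / p)).
    apply Rmult_le_compat_r; [left; apply bp_pos |].
    apply Rle_trans with (Rpower (2 * jb (t - r)) (mu / p)).
    - apply Rle_Rpower_l; [lra |]. pose proof (br_ge1 (t - r)). split; [lra | apply br_le_2jb].
    - rewrite <- Rpower_mult_distr by (pose proof (jb_pos (t - r)); lra).
      apply Rmult_le_compat_r; [left; apply Rpower_pos |].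
      rewrite <- (Rpower_1 2) at 2 by lra. apply Rle_Rpower; lra. }
  replace (4 * (jb r * Rpower (jb (t - r)) (mu / p) * (bp r (-1) * bp (t - r) (- (mu / p)))))
    with ((2 * jb r * bp r (-1)) * (2 * Rpower (jb (t - r)) (mu / p) * bp (t - r) (- (mu / p)))) by ring.
  rewrite <- (Rmult_1_r 1) at 1. apply Rmult_le_compat; lra.
Qed.

(** [ut] determines [v] by the second equation, [v] determines [u] by the first, and differentiating
    [u] in time returns [ut]. Uniqueness of the solution thus reduces to uniqueness of the fixed
    point. *)
Lemma fixed_point_of_good_sol (C : R) (u' v' : R -> R -> R) :
  0 < e -> 0 < C -> good_sol p q mu f g ft gt e C u' v' ->
  exists w, wball p mu (4 * (C * e)) w /\ (forall t r, w t r = Phi w t r) /\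
    forall t r, 0 <= t -> u' t r = uof w t r /\ v' t r = vof w t r.
Proof using All.
  intros He HC (ut & Hut & EU & EV & HN & HE & Cu' & Cv' & Cut & _ & _).
  set (w := fun t r => ut (Rmax t 0) r).
  assert (Ew : forall t r, 0 <= t -> ut t r = w t r)
    by (intros; unfold w; now rewrite Rmax_left by lra).
  (* A solution is required to be even in [u] and [v]; [ut] inherits this as the only possible time
     derivative of [u]. *)
  assert (Evn : forall t r, 0 <= t -> ut t (- r) = ut t r).
  { intros t r Ht. apply (hderiv_unique (fun tau => u' tau r) t); auto.
    apply hderiv_ext with (fun tau => u' tau (- r)); auto. intros tau Htau. now apply HE. }
  assert (Hw : adm w).
  { split; [now apply contH_freeze |]. intros t r. apply Evn, Rmax_r. }
  assert (Axis : forall h k : R -> R -> R, contH h -> cont2 k ->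
            (forall t r, 0 <= t -> r <> 0 -> h t r = k t r) ->
            forall t r, 0 <= t -> h t r = k t r).
  { intros h k Hh Hk E t r Ht. destruct (Req_EM_T r 0) as [-> | Hr]; [| now apply E].
    replace (h t 0) with (h (Rmax t 0) 0) by now rewrite Rmax_left by lra.
    apply (eq_at0_of_continuous (fun r => h (Rmax t 0) r) (fun r => k t r)).
    - apply (cont2_slice1 (fun t r => h (Rmax t 0) r)). now apply contH_freeze.
    - now apply cont2_slice1.
    - intros y Hy. rewrite Rmax_left by lra. now apply E. }
  assert (EV' : forall t r, 0 <= t -> v' t r = vof w t r).
  { apply Axis; auto; [apply adm_vof, Hw |]. intros t r Ht Hr.
    rewrite EV by auto. apply vof_equation; auto. apply Hw. }
  assert (EU' : forall t r, 0 <= t -> u' t r = uof w t r).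
  { apply Axis; auto.
    - apply (wave_quot_cont2 e tu tu1 tu2 (Gu w)); try assumption; [now apply cont2_Gu | now apply Gu_odd].
    - intros t r Ht Hr. rewrite EU by auto. now apply uof_equation. }
  assert (EF : forall t r, 0 <= t -> ut t r = wof w t r).
  { intros t r Ht. apply (hderiv_unique (fun tau => u' tau r) t); auto.
    apply hderiv_ext with (fun tau => uof w tau r); auto.
    - intros tau Htau. symmetry. now apply EU'.
    - now apply hderiv_uof. }
  exists w. split; [| split].
  - split; auto. intros t r Ht.
    destruct HN as (A & B & D & HABD & HA & HB & HD).
    assert (PB : 0 <= B).
    { eapply Rle_trans; [| apply (HB 0 0); lra]. apply Rmult_le_pos; [| apply Rabs_pos].
      unfold w2. pose proof (jb_pos (0 + 0)).
      destruct Rlt_dec; apply Rmult_le_pos; try (left; apply Rpower_pos). lra. }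
    (* The norm bounds only the sum [A + B + D], so [A <= C * e] needs the signs of the others. The
       bound defining [D] speaks only of points where [v'] has a radial derivative; [(0, 1)] is one,
       as [v'] agrees there with [vof w]. *)
    assert (PD : 0 <= D).
    { eapply Rle_trans; [| apply (HD 0 1 ((Nvr w 0 1 - vof w 0 1) / 1)); try lra].
      - apply Rmult_le_pos; [left; apply Rpower_pos | apply Rabs_pos].
      - apply is_derive_Reals. apply is_derive_ext with (f := vof w 0).
        + intros y. symmetry. apply EV'. lra.
        + apply is_derive_quot; [lra | apply odd_at_0, Nv_odd, Hw | apply is_derive_Nv, Hw]. }
    rewrite (even_Rabs w t r) by apply Hw. unfold iw1. rewrite <- (bp_Rabs r).
    set (rho := Rabs r). assert (Hrho : 0 <= rho) by apply Rabs_pos.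
    specialize (HA t rho Ht Hrho). rewrite Ew in HA by auto.
    pose proof (one_le_w1_iw1 t rho Hrho) as X. unfold iw1 in X. rewrite (Rabs_right rho) in X by lra.
    set (I := bp rho (-1) * bp (t - rho) (- (mu / p))) in *.
    assert (PI : 0 < I) by (apply Rmult_lt_0_compat; apply bp_pos).
    pose proof (Rabs_pos (w t rho)) as PW.
    apply Rle_trans with (4 * I * (w1 p mu t rho * Rabs (w t rho))).
    + apply (Rmult_le_compat_r _ _ _ PW) in X. lra.
    + replace (4 * (C * e) * I) with (4 * I * (C * e)) by ring.
      apply Rmult_le_compat_l; lra.
  - intros t r. unfold w at 1, Phi. apply EF, Rmax_r.
  - auto.
Qed.

End Map.

(** * Choice of constants and conclusion *)

Theorem theorem1p2 :
  forall (p q mu : R) (f ft g gt : R -> R),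
    2 < q -> 2 < p -> p < 3 -> (p - 1) * (p * q - 1) > p + 2 ->
    3 - p < mu -> mu < 1 -> p * (2 - (p - 2) * q) < (p * q - 1) * mu ->
    C2_0 f -> C2_0 ft -> C1_0 g -> C1_0 gt ->
    even_fun f -> even_fun ft -> even_fun g -> even_fun gt ->
    exists eps2 C2, 0 < eps2 /\ 0 < C2 /\
      forall eps, 0 < eps -> eps < eps2 ->
        exists u v : R -> R -> R,
          good_sol p q mu f g ft gt eps C2 u v /\
          forall u' v' : R -> R -> R,
            good_sol p q mu f g ft gt eps C2 u' v' ->
            forall t r, 0 <= t -> u' t r = u t r /\ v' t r = v t r.
Proof.
  intros p q mu f ft g gt Hq Hp Hp3 _ Hmu Hmu1 Hpq Hf Hft Hg Hgt Ef Eft Eg Egt.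
  destruct (profile_of_data f g Hf Hg Ef Eg)
    as (Mu & Lu & tu & tu1 & tu2 & HMu & HLu & Pu & Pu1 & HU).
  destruct (profile_of_data ft gt Hft Hgt Eft Egt)
    as (Mv & Lv & tv & tv1 & tv2 & HMv & HLv & Pv & Pv1 & HV).
  assert (Nmu : 0 < mu / p) by (apply Rdiv_lt_0_compat; lra).
  (* The time derivative of the free part of [r u] has profile [tu1], so the decay is applied to the
     pair [(tu1, tu2)]; for [v] it is applied to [(tv, tv1)]. *)
  destruct (lin_decay_w Mu Lu (mu / p) HMu HLu (Rlt_le _ _ Nmu)) as [Cu [HCu LU]].
  specialize (LU tu1 tu2 Pu1).
  destruct (lin_decay_v Mv Lv p mu HMv HLv Hp Hp3 Hmu Hmu1) as [Cv [HCv LV]].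
  specialize (LV tv tv1 Pv).
  destruct (duhamel_first p mu Hp Hp3 Hmu Hmu1) as [C1 [HC1 D1]].
  destruct (duhamel_second p mu q Hq Hp Hp3 Hmu Hmu1 Hpq) as [C2 [HC2 D2]].
  pose proof (proj1 Pu) as Du. pose proof (proj1 Pu1) as Du1. pose proof (proj1 (proj2 Pu1)) as Cu2.
  pose proof (proj1 Pv) as Dv. pose proof (proj1 Pv1) as Dv1. pose proof (proj1 (proj2 Pv1)) as Cv2.
  set (C0 := Cu + Cv). assert (HC0 : 0 < C0) by (unfold C0; lra).
  (* The constructed solution has norm at most [B + B + B] with [B = 2 * C0 * e], whence the
     constant [6 * C0]. A competitor of norm at most [6 * C0 * e] lies, after the loss of the factor
     4 between weights, in the ball of radius [24 * C0 * e], so contraction is arranged on that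
     ball. *)
  destruct (smallness p q C0 C1 C2 (24 * C0) Hp Hq HC0 HC1 HC2 ltac:(lra)) as [eps0 [Heps0 S]].
  exists eps0, (6 * C0). split; [auto | split; [lra |]]. intros e He He0.
  destruct (S e (conj He He0)) as (S1 & S2 & S3). cbv zeta in S1, S2, S3. clear S.
  set (K := 24 * C0 * e) in *. set (B := 2 * C0 * e) in *.
  assert (HC0e : 0 < C0 * e) by now apply Rmult_lt_0_compat.
  assert (HK : 0 < K) by (unfold K; lra). assert (HB : 0 < B) by (unfold B; lra).
  assert (VB : forall w, wball p mu K w -> vbound p mu e tv tv1 B w).
  { intros w Hw. pose proof (vbound_of_ball p mu e tv tv1 Hp Cv C1 K w He LV D1 HK Hw) as V.
    assert (HE : e * Cv + C1 * Rpower K p <= B).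
    { assert (e * Cv <= e * C0) by (apply Rmult_le_compat_l; unfold C0; lra). lra. }
    intros t r Ht. destruct (V t r Ht) as [V1 V2]. split.
    - eapply Rle_trans; [exact V1 |]. apply Rmult_le_compat_r; auto. left; apply iw2_pos.
    - eapply Rle_trans; [exact V2 |]. apply Rmult_le_compat_r; auto. left; apply bp_pos. }
  set (F := Phi p q e tu1 tu2 tv tv1).
  assert (WB : forall w, wball p mu K w -> wball p mu B (F w)).
  { intros w Hw. assert (Aw := proj1 Hw).
    pose proof (adm_wof p q e tu1 tu2 tv tv1 tv2 Hq Hp Du1 Cu2 Dv Dv1 w Aw) as [A1 A2].
    split; [split |].
    - now apply cont2_freeze.
    - intros t r. apply A2.
    - intros t r Ht. unfold F, Phi. rewrite Rmax_left by lra.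
      eapply Rle_trans.
      + apply (wof_bound p q mu e tu1 tu2 tv tv1 tv2 Hq Hp Hp3 Hmu Du1 Dv Dv1 Cu C2 B w); auto.
      + apply Rmult_le_compat_r; [left; apply iw1_pos |].
        assert (e * Cu <= e * C0) by (apply Rmult_le_compat_l; unfold C0; lra). unfold B in *. lra. }
  assert (Enlarge : forall w, wball p mu B w -> wball p mu K w).
  { intros w [Aw Bw]. split; auto. intros t r Ht. eapply Rle_trans; [now apply Bw |].
    apply Rmult_le_compat_r; [left; apply iw1_pos | unfold B, K; lra]. }
  assert (Contr : forall D w w', 0 <= D -> wball p mu K w -> wball p mu K w' ->
            wclose p mu D w w' -> wclose p mu (D / 2) (F w) (F w')).
  { intros D w w' HD Hw Hw' HC t r Ht. unfold F, Phi. rewrite Rmax_left by lra.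
    pose proof (vclose_of_close p mu e tv tv1 Hp C1 K D w w' D1 HK HD Hw Hw' HC) as VC.
    pose proof (Rpower_pos K (p - 1)).
    assert (HE : 0 <= C1 * (p * Rpower K (p - 1) * D)).
    { apply Rmult_le_pos; [lra |]. apply Rmult_le_pos; auto. apply Rmult_le_pos; lra. }
    pose proof (wof_close p q mu e tu1 tu2 tv tv1 tv2 Hq Hp Hp3 Hmu Du1 Dv Dv1 C2 B _ w w' D2 HB HE
      (proj1 Hw) (proj1 Hw') (VB w Hw) (VB w' Hw') VC t r Ht) as WC.
    eapply Rle_trans; [exact WC |]. apply Rmult_le_compat_r; [left; apply iw1_pos |].
    apply (Rmult_le_compat_r D) in S3; lra. }
  assert (Frozen : forall w t r, F w t r = F w (Rmax t 0) r).
  { intros w t r. unfold F, Phi. now rewrite (Rmax_left (Rmax t 0)) by apply Rmax_r. }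
  destruct (fixed_point_exists p mu K F ltac:(lra) ltac:(lra) HK
              (fun w Hw => Enlarge _ (WB w Hw)) Contr Frozen) as [w [Hw HF]].
  (* Being its own image, the fixed point lies in the smaller ball into which the map sends the
     large one. *)
  assert (HwB : wball p mu B w).
  { replace w with (F w); [now apply WB |].
    apply functional_extensionality; intros t. apply functional_extensionality; intros r.
    symmetry. apply HF. }
  exists (uof p q e tu tu1 tv tv1 w), (vof p e tv tv1 w). split.
  - apply (good_sol_of_fixed_point p q mu e tu tu1 tu2 tv tv1 tv2) with (A := B) (B := B); auto.
    unfold B. lra.
  - intros u' v' Hs.
    destruct (fixed_point_of_good_sol p q mu e tu tu1 tu2 tv tv1 tv2 Hq Hp Hp3 Hmu Hmu1 Hpq
      Du Du1 Cu2 Dv Dv1 Cv2 f g ft gt HU HV (6 * C0) u' v' He ltac:(lra) Hs)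
      as (w' & Hw' & HF' & HE).
    replace (4 * (6 * C0 * e)) with K in Hw' by (unfold K; ring).
    replace w with w'; [exact HE |].
    apply functional_extensionality; intros t. apply functional_extensionality; intros r.
    apply (fixed_point_unique p mu K F); try assumption; lra.
Qed.
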